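(* Let $K$ be a field, let $G$ be a finite simple graph on the vertex set $\{1,\dots,d\}$, and let $\mathcal{P}_G$ be its edge polytope. Then the following conditions are equivalent: (i) $G$ satisfies condition (Q); (ii) the toric ideal $I_{\mathcal{P}_G}$ is quadratic; (iii) $\mathcal{P}_G$ has the clique-face property; (iv) $I_{\mathcal{P}_G}$ has no indispensable monomials of degree $\ge 3$.
   Context: Edge polytope: $\mathcal{P}_G=\mathrm{conv}\{\mathbf{e}_i+\mathbf{e}_j : \{i,j\}\in E(G)\}\subset\mathbb{R}^d$, with $\mathbf{e}_i$ the unit coordinate vectors. It is a $(0,1)$-polytope. Cycles and chords: a cycle of $G$ is a closed walk $C=(\{v_1,v_2\},\{v_2,v_3\},\dots,\{v_q,v_1\})$ with $q\ge 3$ and $v_1,\dots,v_q$ distinct; $q$ is its length, and $C$ is even/odd according to the parity of $q$. A chord of $C$ is an edge $\{v_i,v_j\}\in E(G)\setminus E(C)$ with $1\le i<j\le q$. A cycle is induced if it has no chords. If $C$ is even, a chord $\{v_i,v_j\}$ ($i<j$) is even if $j-i$ is odd and odd if $j-i$ is even. Let $e=\{v_i,v_j\}$ and $e'=\{v_k,v_\ell\}$ ($i<j$, $k<\ell$) be odd chords of an even cycle $C$. They cross in $C$ if (1) $i<k<j<\ell$ or $k<i<\ell<j$, and (2) either $\{v_i,v_k\},\{v_j,v_\ell\}$ are both edges of $C$, or $\{v_i,v_\ell\},\{v_j,v_k\}$ are both edges of $C$. If $C_1,C_2$ are cycles with no common vertices, a bridge between them is an edge $\{i,j\}$ of $G$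 with $i\in V(C_1)$, $j\in V(C_2)$. Condition (Q): all of the following hold: (Q-i) if $C$ is an even cycle of $G$ of length $\ge 6$, then either $C$ has an even chord or $C$ has three (distinct) odd chords $e,e',e''$ such that $e$ and $e'$ cross in $C$; (Q-ii) if $C_1$ and $C_2$ are induced odd cycles having exactly one common vertex, then there exists an edge $\{i,j\}\notin E(C_1)\cup E(C_2)$ of $G$ with $i\in V(C_1)$ and $j\in V(C_2)$; (Q-iii) if $C_1$ and $C_2$ are induced odd cycles in the same connected component of $G$ having no common vertices, then there exist at least two bridges between $C_1$ and $C_2$. Clique-face property: the $1$-skeleton $\mathrm{sk}(P)$ of a polytope $P$ is the simple graph on the vertices of $P$ with $v\ne w$ adjacent iff $\mathrm{conv}(\{v,w\})$ is an edge of $P$. $P$ has the clique-face property if every clique (vertex set of a complete subgraph) of $\mathrm{sk}(P)$ is the vertex set of a face of $P$, where $P$ itself is regarded as a face. Toric ideal: for a lattice polytope $P\subset\mathbb{R}^d$ with $P\cap\mathbb{Z}^d=\{\mathbf{a}_1,\dots,\mathbf{a}_n\}$, $I_P$ is the kernel of the $K$-algebra homomorphism $K[x_1,\dots,x_n]\to K[t_1^{\pm1},\dots,t_d^{\pm1},s]$, $x_i\mapsto \mathbf{t}^{\mathbf{a}_i}s$. A binomial is a difference of two distinct monomials. $I_P$ is quadratic if it is generated by homogeneous binomials of degree $2$ (the zero ideal counts as quadratic). A monomial $m$ is indispensable for $I_P$ if every system of binomial generators of $I_P$ contains a binomial having $m$ as one of its two monomials. *)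

(* Defs.v *)
From mathcomp Require Import all_boot all_order all_algebra.
From mathcomp Require Import classical_sets reals.
From mathcomp Require Import mpoly.

Set Implicit Arguments.
Unset Strict Implicit.
Unset Printing Implicit Defensive.

Import GRing.Theory Num.Theory.

Record graph (d : nat) := Graph {
  edges : {set {set 'I_d}};
  card_edge : forall e, e \in edges -> #|e| = 2
}.

Definition adjacent d (G : graph d) : rel 'I_d :=
  [rel x y | [set x; y] \in edges G].

(* The cycle ({v_1,v_2}, ..., {v_q,v_1}) is given by its tuple of vertices,
   and [ordS] is the successor modulo q.  The indices run from 0 to q - 1, which
   changes neither their order nor their differences. *)
Section Cycles.
Variables (d q : nat) (G : graph d) (C : q.-tuple 'I_d).
Implicit Types e f : {set 'I_d}.

Definition cycle_vertices : {set 'I_d} := [set x in C].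

Definition cycle_edges : {set {set 'I_d}} :=
  [set [set tnth C i; tnth C (ordS i)] | i : 'I_q].

Definition is_cycle : Prop :=
  [/\ 3 <= q, uniq C & cycle_edges \subset edges G].

Definition is_chord (i j : 'I_q) e : Prop :=
  [/\ i < j, e = [set tnth C i; tnth C j] & e \in edges G :\: cycle_edges].

Definition even_chord e : Prop := exists i j, is_chord i j e /\ odd (j - i).
Definition odd_chord e : Prop := exists i j, is_chord i j e /\ ~~ odd (j - i).

Definition induced_cycle : Prop :=
  is_cycle /\ ~ exists i j e, is_chord i j e.

Definition cross e f : Prop :=
  exists i j k l : 'I_q,
  [/\ [/\ i < j, e = [set tnth C i; tnth C j],
          k < l & f = [set tnth C k; tnth C l]],
      i < k < j /\ j < l \/ k < i < l /\ l < j
    & ([set tnth C i; tnth C k] \in cycle_edges /\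
       [set tnth C j; tnth C l] \in cycle_edges) \/
      ([set tnth C i; tnth C l] \in cycle_edges /\
       [set tnth C j; tnth C k] \in cycle_edges)].

End Cycles.

Definition bridges d (G : graph d) q1 (C1 : q1.-tuple 'I_d)
    q2 (C2 : q2.-tuple 'I_d) : {set {set 'I_d}} :=
  [set e in edges G | [exists i in cycle_vertices C1,
                       exists j in cycle_vertices C2, e == [set i; j]]].

Definition condition_Qi d (G : graph d) : Prop :=
  forall q (C : q.-tuple 'I_d), is_cycle G C -> ~~ odd q -> 6 <= q ->
    (exists e, even_chord G C e) \/
    (exists e e' e'' : {set 'I_d},
       [/\ uniq [:: e; e'; e''], odd_chord G C e, odd_chord G C e',
           odd_chord G C e'' & cross C e e']).

Definition condition_Qii d (G : graph d) : Prop :=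
  forall q1 (C1 : q1.-tuple 'I_d) q2 (C2 : q2.-tuple 'I_d),
    induced_cycle G C1 -> odd q1 -> induced_cycle G C2 -> odd q2 ->
    #|cycle_vertices C1 :&: cycle_vertices C2| = 1 ->
    exists i j, [/\ i \in cycle_vertices C1, j \in cycle_vertices C2,
      [set i; j] \in edges G
      & [set i; j] \notin cycle_edges C1 :|: cycle_edges C2].

Definition condition_Qiii d (G : graph d) : Prop :=
  forall q1 (C1 : q1.-tuple 'I_d) q2 (C2 : q2.-tuple 'I_d),
    induced_cycle G C1 -> odd q1 -> induced_cycle G C2 -> odd q2 ->
    {in cycle_vertices C1 & cycle_vertices C2,
      forall x y, connect (adjacent G) x y} ->
    [disjoint cycle_vertices C1 & cycle_vertices C2] ->
    2 <= #|bridges G C1 C2|.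

Definition condition_Q d (G : graph d) : Prop :=
  [/\ condition_Qi G, condition_Qii G & condition_Qiii G].

Local Open Scope ring_scope.

Section Polytopes.
Variables (R : realType) (d : nat).
Implicit Types (P F W : set 'rV[R]_d) (v w : 'rV[R]_d).

Definition convex_hull (A : set 'rV[R]_d) : set 'rV[R]_d :=
  [set x | exists (k : nat) (p : 'I_k -> 'rV[R]_d) (c : 'I_k -> R),
     [/\ forall i, A (p i), forall i, 0 <= c i, \sum_i c i = 1
       & x = \sum_i c i *: p i]]%classic.

(* The inequality may be trivial, so that both P and the empty set are faces
   of P. *)
Definition is_face P F : Prop :=
  exists (c : 'rV[R]_d) (b : R),
    (forall x, P x -> \sum_i c 0 i * x 0 i <= b) /\
    F = [set x | P x /\ \sum_i c 0 i * x 0 i = b]%classic.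

Definition vertices P : set 'rV[R]_d :=
  [set v | is_face P [set v]]%classic.

Definition skeleton_adj P v w : Prop :=
  [/\ vertices P v, vertices P w, v <> w
    & is_face P (convex_hull [set v; w]%classic)].

Definition is_clique P W : Prop :=
  (W `<=` vertices P)%classic /\
  forall v w, W v -> W w -> v <> w -> skeleton_adj P v w.

Definition clique_face_property P : Prop :=
  forall W, is_clique P W -> exists F, is_face P F /\ vertices F = W.

Definition edge_polytope (G : graph d) : set 'rV[R]_d :=
  convex_hull [set x | exists i j, [set i; j]%SET \in edges G /\
                 x = delta_mx 0 i + delta_mx 0 j]%classic.

Definition lattice_points P : set 'rV[int]_d :=
  [set z | P (map_mx intr z)]%classic.

End Polytopes.

Arguments edge_polytope R {d} G.

Section ToricIdeals.
Variables (K : fieldType) (n : nat).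
Implicit Types (S I : set {mpoly K[n]}) (m : 'X_{1..n}).

Definition ideal_generated S : set {mpoly K[n]} :=
  [set p | exists (k : nat) (g h : 'I_k -> {mpoly K[n]}),
     (forall i, S (g i)) /\ p = \sum_i h i * g i]%classic.

Definition is_binomial (b : {mpoly K[n]}) : Prop :=
  exists m m', m != m' /\ b = 'X_[m] - 'X_[m'].

Definition binomial_generators I S : Prop :=
  (S `<=` is_binomial)%classic /\ ideal_generated S = I.

Definition is_quadratic I : Prop :=
  exists S, binomial_generators I S /\
            forall b, S b -> b \is 2.-homog.

Definition indispensable I m : Prop :=
  forall S, binomial_generators I S -> exists2 b, S b & m \in msupp b.

Section ToricMap.
Variables (d : nat) (a : 'I_n -> 'rV[int]_d).

Definition laurent_monomial (z : 'rV[int]_d) : {fraction {mpoly K[d]}} :=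
  \prod_j (tofrac 'X_j) ^ z 0 j.

(* The target K[t_1^{+-1}, ..., t_d^{+-1}, s] is regarded as a subring of
   K(t_1, ..., t_d)[s], with s = 'X; this does not change the kernel. *)
Definition toric_map : {mpoly K[n]} -> {poly {fraction {mpoly K[d]}}} :=
  mmap (fun c => (tofrac c%:MP)%:P)
       (fun i => (laurent_monomial (a i))%:P * 'X).

Definition toric_ideal : set {mpoly K[n]} := [set p | toric_map p = 0]%classic.

End ToricMap.
End ToricIdeals.

Arguments toric_ideal K {n d} a.

(* Main.v *)
Require Import Defs.
From mathcomp Require Import all_boot all_order all_algebra.
From mathcomp Require Import boolp classical_sets reals.
From mathcomp Require Import mpoly zify ring.

(** Write a monomial of degree r as a list of r pairs of adjacent vertices.  Two
monomials have the same image under the toric map exactly when the same vertices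
occur in both lists, with the same multiplicities ([fibre_ends]), so the toric
ideal records how edges of G can be exchanged without changing degrees of
vertices.  A quadratic binomial exchanges two opposite edges of a closed walk of
length 4 for the other two; call this a switch.

Condition (Q) makes the ideal quadratic.  Two monomials of one fibre, superposed,
decompose into closed walks whose steps belong alternately to the one and to the
other ([closed_trail]).  So it suffices that, for every closed walk of even
length, the steps of even rank and the steps of odd rank are related by switches
([walk_balanced]).  Consider a shortest walk for which this fails.  A chord
between positions of different parity, or a vertex visited twice at positions of
the same parity, would cut it into shorter walks ([even_chord_balanced],
[even_return_balanced]).  A vertex visited twice at positions of different
parity, or a crossing pair of odd chords, allows one to reverse a segment of the
walk at the cost of one switch ([reversal_balanced]).  Chords that join the
segment A to its complement B change parity under the reversal; as no chord is
even before or after it, A and B are disjoint and only the ends of A are joined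
to the ends of B ([segments_edge], [segments_neq]).  A repeated vertex, or else
the third odd chord that (Q-i) provides, now yields two odd closed walks that a
single vertex separates.  Conditions (Q-ii) and (Q-iii) exclude this
([condition_Q_no_odd_cut_vertex]).

A quadratic ideal gives the clique-face property.  If a clique W is not the
vertex set of a face, then by Farkas' lemma some monomial supported on W shares
its fibre with a monomial that involves a vertex outside W
([separate_or_relate]).  A quadratic generator would then move a product of two
variables of W; but two vertices that span an edge of the polytope are alone in
their fibre ([face_pair_not_movable]).

The clique-face property excludes indispensable monomials of degree at least 3.
The indispensable monomials are those which are minimal for divisibility among
the monomials that are not alone in their fibre ([indispensableP]).  If such a
monomial has degree at least 3, any two of its variables are alone in their
fibre, hence span an edge of the polytope ([face_of_not_movable]).  Its support
is then a clique, and the face with these vertices contains the support of every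
monomial of the fibre, whereas minimality makes two such supports disjoint.

Without indispensable monomials of degree at least 3, (Q) holds.  By the same
characterization, each monomial that is not alone in its fibre then contains two
opposite edges of a 4-cycle of G whose other two edges give a different monomial
([movable_switchable]).  This is applied to the two halves of an even cycle,
which produces its chords ([switchable_Qi]); to two odd cycles through a common
vertex ([switchable_Qii]); and to two odd cycles joined by a shortest path that
is travelled twice, which produces the bridges ([switchable_Qiii]). *)

Set Implicit Arguments.
Unset Strict Implicit.
Unset Printing Implicit Defensive.

Import Order.TTheory GRing.Theory Num.Theory.

(** * Switches and closed walks of even length *)

Section ClosedWalks.
Variables (T : eqType) (e : rel T).
Implicit Types (s w l : seq T) (p q : seq (T * T)).

(** A list x0 y0 x1 y1 stands for the edges x0y0, x1y1.  For a closed walk w,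
[pairs w] and [pairs (rot 1 w)] are its two classes of alternate steps. *)
Fixpoint pairs s : seq (T * T) :=
  if s is x :: y :: s' then (x, y) :: pairs s' else [::].

Lemma even_seq_ind (P : seq T -> Prop) :
    P [::] -> (forall x y s, ~~ odd (size s) -> P s -> P [:: x, y & s]) ->
  forall s, ~~ odd (size s) -> P s.
Proof.
move=> P0 P2 s; have [n] := ubnP (size s); elim: n s => // n IHn.
case=> [|x [|y s]] //=; rewrite !ltnS negbK => sn os.
by apply: (P2 _ _ _ os); apply: IHn => //; apply: leq_trans sn.
Qed.

Lemma pairs_cat s (t : seq T) : ~~ odd (size s) -> pairs (s ++ t) = pairs s ++ pairs t.
Proof. by move: s; apply: even_seq_ind => //= x y s _ ->. Qed.

(** Two lists of oriented edges are equivalent when their monomials are congruent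
modulo the quadratic binomials of the toric ideal; see [switch_equiv_binomial]. *)
Inductive switch_equiv : seq (T * T) -> seq (T * T) -> Prop :=
| switch_perm p q : perm_eq p q -> switch_equiv p q
| switch_flip x y p : switch_equiv ((x, y) :: p) ((y, x) :: p)
| switch_switch x y z t p : e x y -> e y z -> e z t -> e t x ->
    switch_equiv [:: (x, y), (z, t) & p] [:: (y, z), (t, x) & p]
| switch_sym p q : switch_equiv p q -> switch_equiv q p
| switch_trans q p r : switch_equiv p q -> switch_equiv q r -> switch_equiv p r.

Lemma switch_refl p : switch_equiv p p.
Proof. exact: switch_perm. Qed.

Lemma switch_catr r p q : switch_equiv p q -> switch_equiv (p ++ r) (q ++ r).
Proof.
elim=> {p q} [p q pq|x y p|x y z t p|p q _|q p p' _ IH1 _ IH2].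
- by apply: switch_perm; rewrite perm_cat2r.
- exact: switch_flip.
- exact: switch_switch.
- exact: switch_sym.
- exact: switch_trans IH1 IH2.
Qed.

Lemma switch_catl r p q : switch_equiv p q -> switch_equiv (r ++ p) (r ++ q).
Proof.
move=> /(switch_catr r) pq; apply: (switch_trans (q := p ++ r)).
  by apply: switch_perm; rewrite perm_catC.
by apply: switch_trans pq _; apply: switch_perm; rewrite perm_catC.
Qed.

Lemma switch_cat p p' q q' :
  switch_equiv p p' -> switch_equiv q q' -> switch_equiv (p ++ q) (p' ++ q').
Proof.
by move=> /(switch_catr q) pp' /(switch_catl p'); apply: switch_trans pp'.
Qed.

Lemma switch_rev s : ~~ odd (size s) -> switch_equiv (pairs (rev s)) (pairs s).
Proof.
move: s; apply: even_seq_ind => [|x y s os IHs]; first exact: switch_refl.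
rewrite !rev_cons -!cats1 -catA pairs_cat ?size_rev //=.
apply: (switch_trans (q := (y, x) :: pairs (rev s))).
  by apply: switch_perm; rewrite perm_catC.
apply: switch_trans (switch_flip _ _ _) _.
by rewrite -[(x, y) :: _]cat1s -[(x, y) :: pairs s]cat1s; apply: switch_catl.
Qed.

Definition balanced w := switch_equiv (pairs w) (pairs (rot 1 w)).

Lemma pairs_rot2 w : ~~ odd (size w) -> perm_eq (pairs (rot 1 (rot 1 w))) (pairs w).
Proof.
case: w => [|x [|y s]] //=; rewrite negbK => os.
rewrite rot1_cons rcons_cons rot1_cons -!cats1 -catA pairs_cat //=.
by rewrite -[(x, y) :: _]cat1s perm_catC.
Qed.

Lemma balanced_rot1 w : ~~ odd (size w) -> balanced (rot 1 w) <-> balanced w.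
Proof.
move=> ow; have /switch_perm Ew := pairs_rot2 ow; split=> bw.
  by apply: switch_sym; apply: switch_trans bw Ew.
by apply: switch_sym; apply: switch_trans Ew bw.
Qed.

Lemma balanced_rot k w : ~~ odd (size w) -> balanced (rot k w) <-> balanced w.
Proof.
move=> ow; elim: k => [|k IHk]; first by rewrite rot0.
have [kw|wk] := ltnP k (size w); last by rewrite rot_oversize // ltnW.
by rewrite rotS // -IHk balanced_rot1 // size_rot.
Qed.

End ClosedWalks.

Section Splitting.
Variables (T : eqType) (e : rel T).
Hypotheses (esym : ssrbool.symmetric e).
Implicit Types (s w l : seq T).

Notation closed := (path.cycle e).

Definition short_balanced n := forall w,
  closed w -> ~~ odd (size w) -> size w < n -> balanced e w.

(** The chord xy cuts w into two closed walks of even length.  Exchanging the classes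
of the first one introduces the edge xy, and exchanging those of the second one
uses it up again. *)
Lemma even_chord_balanced x y l1 l2 :
    let w := x :: l1 ++ y :: l2 in
    short_balanced (size w) -> closed w -> e x y ->
    ~~ odd (size l1) -> ~~ odd (size l2) -> 0 < size l1 -> 0 < size l2 ->
  balanced e w.
Proof.
move=> /= IH; rewrite /= rcons_cat cat_path /= => /and3P[pl1 ey pl2] exy o1 o2 n1 n2.
have b1 : balanced e (x :: rcons l1 y).
  apply: IH; rewrite /= ?size_rcons /= ?negbK ?size_cat /=; try lia.
  by rewrite !rcons_path pl1 !last_rcons ey esym.
have b2 : balanced e (y :: rcons l2 x).
  apply: IH; rewrite /= ?size_rcons /= ?negbK ?size_cat /=; try lia.
  by rewrite [path _ _ _]rcons_path pl2 last_rcons.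
rewrite /balanced rot1_cons rcons_cat rcons_cons.
rewrite -cat_rcons -cat_cons pairs_cat /= ?size_rcons //= ?negbK //.
rewrite pairs_cat //; apply: switch_trans (switch_catr _ b1) _.
rewrite rot1_cons -!cats1 -catA pairs_cat //= -catA; apply: switch_catl.
apply: switch_sym; rewrite cats1; apply: switch_trans b2 _.
rewrite rot1_cons -!cats1 -catA pairs_cat //=.
apply: (switch_trans (q := (x, y) :: pairs l2)); last exact: switch_flip.
by apply: switch_perm; rewrite perm_catC.
Qed.

(** The walk is the concatenation of two closed walks of even length at x, and the
classes of w are the unions of theirs. *)
Lemma even_return_balanced x l1 l2 :
    let w := x :: l1 ++ x :: l2 in
    short_balanced (size w) -> closed w -> odd (size l1) -> odd (size l2) ->
  balanced e w.
Proof.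
move=> /= IH; rewrite /= rcons_cat cat_path /= => /and3P[pl1 ey pl2] o1 o2.
have b1 : balanced e (x :: l1).
  by apply: IH; rewrite /= ?negbK ?size_cat /= ?rcons_path ?pl1 ?ey //; lia.
have b2 : balanced e (x :: l2).
  by apply: IH; rewrite /= ?negbK ?size_cat /= ?pl2 //; lia.
rewrite /balanced rot1_cons rcons_cat rcons_cons.
rewrite -cat_cons pairs_cat /= ?negbK // -cat_rcons pairs_cat ?size_rcons ?negbK //.
by apply: switch_cat; [move: b1 | move: b2]; rewrite /balanced rot1_cons.
Qed.

(** Reversing A keeps the first class of steps.  In the second class it only replaces
the two edges between A and B by xy and x'y', which is a switch. *)
Lemma reversal_balanced x x' y y' l1 l2 :
    let A := x :: rcons l1 x' in let B := y :: rcons l2 y' in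
    closed (A ++ B) -> e x y -> e x' y' -> ~~ odd (size l1) -> ~~ odd (size l2) ->
  balanced e (rev A ++ B) -> balanced e (A ++ B).
Proof.
move=> /= cw exy exy' o1 o2.
have ex'y : e x' y.
  by move: cw; rewrite rcons_cat cat_path last_rcons /= => /and3P[].
have eyx : e y' x.
  by move: cw; rewrite rcons_path last_cat /= last_rcons => /andP[].
rewrite /balanced => bw.
have ev1 : ~~ odd (size (x :: rcons l1 x')) by rewrite /= size_rcons /= negbK.
rewrite -cat_cons pairs_cat //.
apply: switch_trans (switch_catr _ (switch_sym (switch_rev e ev1))) _.
rewrite -pairs_cat ?size_rev //; apply: switch_trans bw _.
rewrite rev_cons rev_rcons cat_cons rot1_cons rcons_cat cat_rcons cat_cons.
rewrite rot1_cons rcons_cat pairs_cat ?size_rev // cat_rcons pairs_cat //.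
apply: switch_cat; first exact: switch_rev.
rewrite /= -!cats1 -!catA /= !pairs_cat //=.
have sw (a b : T * T) : switch_equiv e (a :: pairs l2 ++ [:: b]) [:: a, b & pairs l2].
  by apply: switch_perm; rewrite perm_cons perm_catC.
apply: switch_trans (sw _ _) _.
apply: (switch_trans (q := [:: (x', y), (y', x) & pairs l2])); last exact/switch_sym.
apply: switch_trans (switch_flip _ _ _ _) _.
apply: (switch_trans (switch_switch _ _ _ _ _)); rewrite // 1?esym //.
apply: switch_trans (switch_flip _ _ _ _) _; apply: switch_perm.
by apply: (permEl (perm_catCA [:: (y', x)] [:: (x', y)] (pairs l2))).
Qed.
End Splitting.

(** * Reversing a segment of a shortest unbalanced walk *)

Section Reversal.
Variables (T : eqType) (e : rel T).
Hypotheses (esym : ssrbool.symmetric e).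
Implicit Types (w l A B : seq T).

Notation closed := (path.cycle e).

Definition unbalanced w :=
  [/\ short_balanced e (size w), closed w, ~~ odd (size w) & ~ balanced e w].

(** Positions i < j that are neighbours on a cycle of length n. *)
Definition consecutive n i j := (j == i.+1) || ((i == 0) && (j.+1 == n)).

Lemma rot_split (x0 : T) w i j : i < j < size w ->
  exists l1 l2, [/\ rot i w = nth x0 w i :: l1 ++ nth x0 w j :: l2,
                    size l1 = (j - i).-1 & size l2 = size w - (j - i).+1].
Proof.
case/andP=> ij jw; have iw := ltn_trans ij jw.
exists (take (j - i).-1 (drop i.+1 w)), (drop j.+1 w ++ take i w); split.
- rewrite /rot (drop_nth x0) // cat_cons; congr (_ :: _).
  rewrite -{1}(cat_take_drop (j - i).-1 (drop i.+1 w)) drop_drop.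
  have -> : (j - i).-1 + i.+1 = j by lia.
  by rewrite (drop_nth x0 jw) -catA.
- by rewrite size_take size_drop; case: ltnP; lia.
- by rewrite size_cat size_drop size_take iw; lia.
Qed.

Lemma unbalanced_rot k w : unbalanced w -> unbalanced (rot k w).
Proof.
case=> sw cw ow bw; split; rewrite ?size_rot ?rot_cycle //.
by move/(balanced_rot e k ow).
Qed.

Lemma unbalanced_chord x0 w i j : unbalanced w -> i < j < size w ->
  odd (j - i) -> e (nth x0 w i) (nth x0 w j) -> consecutive (size w) i j.
Proof.
move=> bw ijw oij eij; apply/negP => /negP cij; rewrite /consecutive in cij.
have [l1 [l2 [Ew n1 n2]]] := rot_split x0 ijw.
have := unbalanced_rot i bw; have : ~~ odd (size w) by case: bw.
rewrite Ew => ow [sw cw ow' ]; apply; apply: even_chord_balanced => //; lia.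
Qed.

Lemma unbalanced_return x0 w i j : unbalanced w -> i < j < size w ->
  nth x0 w i = nth x0 w j -> odd (j - i).
Proof.
move=> bw ijw eij; apply/negP => /negP oij.
have [l1 [l2 [Ew n1 n2]]] := rot_split x0 ijw.
have := unbalanced_rot i bw; have : ~~ odd (size w) by case: bw.
by rewrite Ew -eij => ow [sw cw _]; apply; apply: even_return_balanced => //; lia.
Qed.

Lemma even_ends A : ~~ odd (size A) -> 0 < size A ->
  exists x l x', A = x :: rcons l x' /\ ~~ odd (size l).
Proof.
case: A => // x; case/lastP => // l x'; rewrite /= size_rcons /= negbK => ol _.
by exists x, l, x'.
Qed.

Section Segments.
Variables (x0 : T) (A B : seq T).
Hypotheses (oA : ~~ odd (size A)) (oB : ~~ odd (size B)).
Hypotheses (nA : 0 < size A) (nB : 0 < size B).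
Hypotheses (efirst : e (nth x0 A 0) (nth x0 B 0)).
Hypotheses (elast : e (nth x0 A (size A).-1) (nth x0 B (size B).-1)).
Hypothesis unbAB : unbalanced (A ++ B).

Lemma unbalanced_reversal : unbalanced (rev A ++ B).
Proof.
have [sw cw ow bw] := unbAB.
have [x [l1 [x' [EA o1]]]] := even_ends oA nA.
have [y [l2 [y' [EB o2]]]] := even_ends oB nB.
have exy : e x y by move: efirst; rewrite EA EB.
have exy' : e x' y'.
  by move: elast; rewrite !nth_last EA EB /= !last_rcons.
split; last first.
- move=> bw'; apply: bw; move: cw bw'.
  by rewrite EA EB => cw; apply: reversal_balanced.
- by move: ow; rewrite !size_cat size_rev.
- move: cw; rewrite EA EB rev_cons rev_rcons /= !rcons_cat !cat_path !last_rcons.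
  move=> /andP[p1 /=]; rewrite rcons_path last_rcons.
  move=> /and3P[ex'y p2 ey'x]; rewrite [path e y _]rcons_path last_rcons p2 exy.
  rewrite (esym y') exy' andbT.
  have := rev_path e x (rcons l1 x'); rewrite last_rcons belast_rcons rev_cons.
  by rewrite (eq_path (e' := e)) ?p1 // => ->.
- by move: sw; rewrite !size_cat size_rev.
Qed.

(** The reversal of A moves position i to position |A| - 1 - i, of the other parity,
and fixes the positions of B.  An edge between A and B is thus a chord of odd
span in the walk or in the reversed walk, and such chords are steps of the walk
by [unbalanced_chord].  The steps between A and B are those between the ends. *)
Lemma segments_edge i j : i < size A -> j < size B ->
    e (nth x0 A i) (nth x0 B j) ->
  ((i == 0) || (i.+1 == size A)) /\
  (~~ odd (i + j) -> (i == 0) && (j == 0) ||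
                     (i.+1 == size A) && (j.+1 == size B)).
Proof.
move=> iA jB eij.
have [oij|oij] := boolP (odd (i + j)).
  have := unbalanced_chord (x0 := x0) (i := i) (j := size A + j) unbAB.
  rewrite size_cat !nth_cat iA [_ + _ < size A]ltnNge leq_addr addKn /= eij /consecutive.
  move=> ij; have {ij}/orP ij := ij ltac:(lia) ltac:(lia) isT.
  split=> //; case: ij.
  - by move=> ?; lia.
  - by move=> ?; lia.
have := unbalanced_chord (x0 := x0) (i := (size A).-1 - i) (j := size A + j)
          unbalanced_reversal.
rewrite size_cat !nth_cat size_rev nth_rev; last by lia.
have -> : size A - ((size A).-1 - i).+1 = i by lia.
have -> : (size A).-1 - i < size A by lia.
rewrite [_ + _ < size A]ltnNge leq_addr addKn /= eij /consecutive => ij.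
have {ij}/orP[] := ij ltac:(lia) ltac:(lia) isT.
- by move=> ?; lia.
- by move=> ?; lia.
Qed.

(** As for edges: a common vertex of A and B would be visited twice at positions of
the same parity, before or after the reversal. *)
Lemma segments_neq i j : i < size A -> j < size B -> nth x0 A i <> nth x0 B j.
Proof.
move=> iA jB eij.
have := unbalanced_return (x0 := x0) (i := i) (j := size A + j) unbAB.
rewrite size_cat !nth_cat iA [_ + _ < size A]ltnNge leq_addr addKn /= => /(_ _ eij) o1.
have := unbalanced_return (x0 := x0) (i := (size A).-1 - i) (j := size A + j)
          unbalanced_reversal.
rewrite size_cat !nth_cat size_rev nth_rev; last by lia.
have -> : size A - ((size A).-1 - i).+1 = i by lia.
have -> : (size A).-1 - i < size A by lia.
rewrite [_ + _ < size A]ltnNge leq_addr addKn /= => /(_ _ eij) o2.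
have {}o1 : odd (size A + j - i) by apply: o1; lia.
have {}o2 : odd (size A + j - ((size A).-1 - i)) by apply: o2; lia.
lia.
Qed.

End Segments.
End Reversal.

(** * Every closed walk of even length is balanced *)

Section WalksBalanced.
Variables (T : finType) (e : rel T).
Hypotheses (esym : ssrbool.symmetric e) (eirr : irreflexive e).
Implicit Types (w l A B : seq T).

Notation closed := (path.cycle e).

(** The consequence of (Q-ii) and (Q-iii) that the argument uses: no vertex x separates
two odd closed walks, each of which may pass through x. *)
Definition no_odd_cut_vertex := forall x A B,
  closed A -> odd (size A) -> closed B -> odd (size B) ->
  (forall a b, a \in A -> b \in B -> connect e a b) ->
  ~ (forall a b, a \in A -> b \in B -> a != x -> b != x -> a != b /\ ~~ e a b).

(** The situation in which [reversal_balanced] applies to A ++ B. *)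
Definition reversible x0 A B :=
  [/\ ~~ odd (size A), ~~ odd (size B), 0 < size A, 0 < size B &
      e (nth x0 A 0) (nth x0 B 0) /\
      e (nth x0 A (size A).-1) (nth x0 B (size B).-1)].

(** The form in which (Q-i) is used: a pair of crossing odd chords of a cycle w cuts
it into segments A and B and consists of the edges between their first and
between their last vertices; the positions i and j are the ends of a third odd
chord. *)
Definition chorded_split x0 w := exists k A B i j,
   [/\ rot k w = A ++ B, reversible x0 A B, i < j < size w,
       ~~ odd (j - i) /\ e (nth x0 (A ++ B) i) (nth x0 (A ++ B) j) &
       ~~ ((i == 0) && (j == size A)) /\
       ~~ ((i.+1 == size A) && (j.+1 == size w))].

Definition long_cycles_chorded := forall x0 w,
    closed w -> uniq w -> ~~ odd (size w) -> 6 <= size w ->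
  (exists i j, [/\ i < j < size w, odd (j - i), e (nth x0 w i) (nth x0 w j) &
                   ~~ consecutive (size w) i j]) \/
  chorded_split x0 w.

Lemma connect_closed w a b : closed w -> a \in w -> b \in w -> connect e a b.
Proof.
move=> cw aw bw.
by apply: (connect_cycle (p := w)).
Qed.

Hypotheses (Hcut : no_odd_cut_vertex) (Hchord : long_cycles_chorded).

(** If x is visited twice, the two returns to x have odd length.  Taking for A the first
one with both its ends at x, the edges from x to the ends of B are steps of the
walk, so A can be reversed; hence x separates the two returns. *)
Lemma unbalanced_uniq w : unbalanced e w -> uniq w.
Proof.
move=> bw; apply/negPn/negP => uw.
have x0 : T by case: w bw uw => [|x].
have /(uniqPn x0)[i [j [ij jw eij]]] := uw.
have ijw : i < j < size w by rewrite ij.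
have oij := unbalanced_return bw ijw eij.
have [l1 [l2 [Ew n1 n2]]] := rot_split x0 ijw.
rewrite -eij in Ew; have := unbalanced_rot i bw; rewrite Ew => {}bw.
set x := nth x0 w i in Ew bw.
have ow : ~~ odd (size w) by case: bw => _ _; rewrite -Ew size_rot.
have o1 : ~~ odd (size l1) by rewrite n1; lia.
have o2 : ~~ odd (size l2).
  rewrite n2 oddB ?(negbTE ow) /= ?oij //; apply: leq_trans jw; lia.
have [sw cw _ _] := bw.
have := cw; rewrite /= rcons_cat cat_path /= => /and3P[p1 ex p2].
have n1' : 0 < size l1 by case: l1 {Ew bw sw cw n1 o1} p1 ex => //=; rewrite eirr.
have n2' : 0 < size l2 by case: l2 {Ew bw sw cw n2 o2} p2 => //=; rewrite eirr.
pose A := rcons (x :: l1) x.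
have bAB : unbalanced e (A ++ l2) by rewrite /A cat_rcons.
have sA : size A = (size l1).+2 by rewrite size_rcons.
have oA : ~~ odd (size A) by rewrite sA; lia.
have nA : 0 < size A by rewrite sA.
have ef : e (nth x0 A 0) (nth x0 l2 0) by case: l2 n2' p2 {Ew bw sw cw n2 o2 bAB} => //= ? ? _ /andP[].
have el : e (nth x0 A (size A).-1) (nth x0 l2 (size l2).-1).
  rewrite !nth_last last_rcons esym; case/lastP: l2 n2' p2 {Ew bw sw cw n2 o2 bAB ef} => //= l y _.
  by rewrite rcons_path !last_rcons => /andP[].
apply: (Hcut (x := x) (A := x :: l1) (B := x :: l2)).
- by rewrite /= rcons_path p1.
- by rewrite /=.
- by rewrite /=.
- by rewrite /=.
- move=> a b aA bB; apply: (connect_closed cw).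
    by move: aA; rewrite !inE mem_cat => /orP[->|->]; rewrite ?orbT.
  by move: bB; rewrite !inE mem_cat inE => /orP[->|->]; rewrite ?orbT.
move=> a b; rewrite !inE => /orP[/eqP->|aA]; first by rewrite eqxx.
case/orP=> [/eqP->|bB]; first by rewrite eqxx.
move=> ax bx.
have aA' : index a l1 < size l1 by rewrite index_mem.
have bB' : index b l2 < size l2 by rewrite index_mem.
have Ea : nth x0 A (index a l1).+1 = a.
  by rewrite /A rcons_cons /= nth_rcons aA' nth_index.
have Eb : nth x0 l2 (index b l2) = b by rewrite nth_index.
have ia : (index a l1).+1 < size A by rewrite sA !ltnS ltnW.
split.
  apply/eqP; rewrite -Ea -Eb.
  exact: (segments_neq esym oA o2 nA n2' ef el bAB).
apply/negP => eab.
have := segments_edge esym oA o2 nA n2' ef el bAB ia bB'.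
by rewrite Ea Eb => /(_ eab)[/orP[//|]]; rewrite sA !eqSS ltn_eqF.
Qed.

Lemma unbalanced_long w : unbalanced e w -> 6 <= size w.
Proof.
case=> sw cw ow bw; rewrite leqNgt; apply/negP => w6; apply: bw.
case: w cw {sw} ow w6 => [|x [|y [|z [|t [|? [|? ?]]]]]] //= cw _ _.
- exact: switch_refl.
- exact: switch_flip.
- by case/and5P: cw => ? ? ? ? _; apply: switch_switch.
Qed.

(** Together with the segment of A that it spans, the odd chord closes an odd cycle
which misses one end of A.  The other end x of A is joined to both ends of B, so
x and B form an odd cycle too, and x separates the two. *)
Lemma segments_chord_first x0 A B i j : unbalanced e (A ++ B) -> uniq (A ++ B) ->
    reversible x0 A B -> i < j < size A -> ~~ odd (j - i) ->
  e (nth x0 A i) (nth x0 A j) -> False.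
Proof.
move=> bw uw [oA oB nA nB [ef el]] /andP[ij jA] oij eij.
have seg := segments_edge esym oA oB nA nB ef el bw.
have segn := segments_neq esym oA oB nA nB ef el bw.
have [_ cw _ _] := bw.
have [uA uB dAB] : [/\ uniq A, uniq B & forall a, a \in A -> a \in B -> False].
  move: uw; rewrite cat_uniq => /and3P[uA /hasPn AB uB]; split=> // a aA /AB.
  by rewrite aA.
(* D runs from position i to position j and closes up along the chord; its
   length j - i + 1 is odd. *)
pose D := take (j - i).+1 (drop i A).
have sD : size D = (j - i).+1.
  by rewrite size_take size_drop; clear -ij jA; case: ltnP; lia.
have nD k : k < size D -> nth x0 D k = nth x0 A (i + k).
  by rewrite sD => kD; rewrite nth_take // nth_drop.
have D_A a : a \in D -> exists2 k, i <= k <= j & a = nth x0 A k.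
  move=> aD; exists (i + index a D); last by rewrite -nD ?index_mem // nth_index.
  by move: aD; rewrite -index_mem sD; clear -ij; lia.
have pA : path e (head x0 A) (behead A).
  case: (A) nA cw => //= a l _; by rewrite rcons_cat cat_path => /andP[].
have pB : path e (head x0 B) (behead B).
  case: (A) nA cw => //= a l _; case: (B) nB => //= b l' _.
  by rewrite rcons_cat cat_path /= rcons_path => /and3P[_ _ /andP[]].
have cD : closed D.
  have : sorted e D by apply/take_sorted/drop_sorted; case: (A) nA pA.
  have : e (last x0 D) (nth x0 D 0).
    by rewrite -nth_last !nD ?sD //= addn0 subnKC 1?ltnW // esym.
  by case: (D) => //= a l el'; rewrite rcons_path el' => ->.
have closeB x : x = nth x0 A 0 \/ x = nth x0 A (size A).-1 ->
    e x (nth x0 B 0) && e x (nth x0 B (size B).-1).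
  have eAB : e (nth x0 A (size A).-1) (nth x0 B 0).
    rewrite nth_last; case: (A) nA cw => //= a l _; case: (B) nB => //= b l' _.
    by rewrite rcons_cat cat_path /= => /and3P[].
  have eBA : e (nth x0 A 0) (nth x0 B (size B).-1).
    rewrite nth_last esym; case: (A) nA cw => //= a l _; case: (B) nB => //= b l' _.
    by rewrite rcons_path last_cat /= => /andP[].
  by case=> ->; rewrite ?ef ?el ?eAB ?eBA.
have mA m : i <= m <= j -> m < size A by case/andP=> _ mj; apply: leq_ltn_trans jA.
(* A has even size, so D misses an end of A; the other end, at position k, is
   the cut vertex. *)
have [k [kA kend kavoid]] : exists k, [/\ k < size A,
    nth x0 A k = nth x0 A 0 \/ nth x0 A k = nth x0 A (size A).-1 &
    forall m, i <= m <= j -> m = 0 \/ m.+1 = size A -> m = k].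
  have [jA'|jA'] := leqP (size A) j.+1.
    exists (size A).-1; split; [by rewrite ltn_predL|by right|move=> m mij mm].
    have EA : size A = j.+1 by clear -jA jA'; lia.
    case: mm => [m0|<- //]; move: oij oA; have -> : i = 0 by clear -m0 mij; lia.
    by rewrite EA subn0 /= negbK => /negbTE->.
  by exists 0; split; [|left|move=> m mij mm; clear -jA jA' mij mm; lia].
set x := nth x0 A k in kend.
apply: (Hcut (x := x) (A := D) (B := x :: B)) => //.
- by rewrite sD; clear -oij ij; lia.
- have /andP[e1 e2] := closeB _ kend.
  case: (B) nB e1 e2 pB => //= b l _ -> e2 pb /=.
  by rewrite rcons_path pb esym -[last b l]/(last x0 (b :: l)) -nth_last.
- move=> a b /D_A[m mij ->] bB; apply: (connect_closed cw).
    by rewrite mem_cat mem_nth //; apply: mA.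
  move: bB; rewrite inE mem_cat => /orP[/eqP->|->]; rewrite ?orbT //.
  by rewrite mem_nth.
move=> a b /D_A[m mij Ea]; rewrite inE => /orP[/eqP->|bB]; first by rewrite eqxx.
move=> ax bx; split.
  apply/eqP => ab; apply: (dAB b) => //; rewrite -ab Ea mem_nth //; exact: mA.
apply/negP; rewrite Ea -[b](nth_index x0 bB) => /seg [||mend _]; first exact: mA.
  by rewrite index_mem.
move: ax; rewrite Ea /x (kavoid m mij) ?eqxx //.
by case/orP: mend => /eqP; [left|right].
Qed.

Lemma walk_balanced w : closed w -> ~~ odd (size w) -> balanced e w.
Proof.
have [n] := ubnP (size w); elim: n w => // n IHn w wn cw ow.
apply: contrapT => bw.
have {IHn wn cw ow bw} bw : unbalanced e w.
  by split=> // w' cw' ow' w'w; apply: IHn => //; apply: leq_trans w'w _.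
have uw := unbalanced_uniq bw; have w6 := unbalanced_long bw.
have [_ cw ow _] := bw.
have x0 : T by case: w w6 {bw uw cw ow}.
case: (Hchord x0 cw uw ow w6) => [[i [j [ijw oij eij]]]|].
  by rewrite (unbalanced_chord esym bw ijw oij eij).
move=> [k [A [B [i [j [Ew rAB ijw [oij eij] [n1 n2]]]]]]].
have := unbalanced_rot k bw; have := uw; rewrite -(rot_uniq k) Ew => uAB bAB.
have sw : size w = size A + size B by rewrite -(size_rot k) Ew size_cat.
have /andP[ij jw] := ijw.
have [jA|Aj] := ltnP j (size A).
  apply: (@segments_chord_first x0 A B i j) => //; first by rewrite ij.
  by move: eij; rewrite !nth_cat jA (ltn_trans ij jA).
have [iA|Ai] := ltnP i (size A).
  move: eij; rewrite !nth_cat iA ltnNge Aj /= => eij.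
  have [oA oB nA nB [ef el]] := rAB.
  have arith a b c : c = a + b -> ~~ odd a -> a <= j -> j < c -> ~~ odd (i + (j - a)) &&
      (j - a < b) /\ ((i == 0) && (j - a == 0) || (i.+1 == a) && ((j - a).+1 == b) ->
      (i == 0) && (j == a) || (i.+1 == a) && (j.+1 == c)).
    by clear -oij ij; lia.
  have [/andP[ev jB] ends] := arith _ _ _ sw oA Aj jw.
  have [_ /(_ ev)/ends] := segments_edge esym oA oB nA nB ef el bAB iA jB eij.
  by rewrite (negbTE n1) (negbTE n2).
have rBA : reversible x0 B A.
  by have [oA oB nA nB [ef el]] := rAB; split=> //; rewrite ![e (nth x0 B _) _]esym.
have bBA : unbalanced e (B ++ A) by rewrite -(rot_size_cat A B); apply: unbalanced_rot.
apply: (@segments_chord_first x0 B A (i - size A) (j - size A)) => //.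
- by rewrite uniq_catC.
- by rewrite ltn_sub2r ?(leq_ltn_trans Ai) //= ltn_subLR // -sw.
- by rewrite subnBA // subnK.
- by move: eij; rewrite !nth_cat !ltnNge Aj Ai.
Qed.

End WalksBalanced.

(** * Decomposition of a pair of monomials into alternating closed walks *)

Section Trails.
Variables (T : eqType) (e : rel T).
Hypotheses (esym : ssrbool.symmetric e).
Implicit Types (s w : seq T) (p q : seq (T * T)).

Notation closed := (path.cycle e).

Definition ends p := flatten [seq [:: u.1; u.2] | u <- p].

Definition edge_pairs p := all (fun u => e u.1 u.2) p.

Lemma perm_ends p q : perm_eq p q -> perm_eq (ends p) (ends q).
Proof. by move=> pq; apply/perm_flatten/perm_map. Qed.

(** An edge of q at z can be moved to the front and oriented away from z. *)
Lemma ends_pick z q : z \in ends q -> edge_pairs q -> exists z' q',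
  [/\ switch_equiv e q ((z, z') :: q'), size q = (size q').+1, e z z',
      edge_pairs q' & perm_eq (ends q) [:: z, z' & ends q']].
Proof.
move=> /flattenP[_ /mapP[[a b] abq ->]]; rewrite !inE /= => zab vq.
have pq := perm_to_rem abq.
have := vq; rewrite /edge_pairs (perm_all _ pq) /= => /andP[eab vr].
have /perm_size /= sq := pq; have /= eq := perm_ends pq.
case/orP: zab => /eqP->.
  by exists b, (rem (a, b) q); split=> //; apply: switch_perm.
exists a, (rem (a, b) q); split=> //; last 1 first.
- by apply: perm_trans eq _; apply: (permEl (perm_catCA [:: a] [:: b] _)).
- exact: switch_trans (switch_perm _ pq) (switch_flip _ _ _ _).
- by rewrite esym.
Qed.

(** If p and q have the same vertex degrees except for an excess at x in p and at y in
q, then follow edges of q and of p alternately from x: the excess travels along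
the trail, which can only stop at y. *)
Lemma open_trail p q x y : edge_pairs p -> edge_pairs q ->
    perm_eq (x :: ends p) (y :: ends q) -> exists s p' q',
  [/\ [/\ path e x s, last x s = y & ~~ odd (size s)],
      switch_equiv e p (pairs s ++ p') /\ switch_equiv e q (pairs (x :: s) ++ q'),
      size p' <= size p, edge_pairs p' /\ edge_pairs q' &
      perm_eq (ends p') (ends q')].
Proof.
have [n] := ubnP (size p); elim: n p q x => // n IHn p q x pn vp vq pq.
have [xy|xy] := eqVneq x y.
  exists [::], p, q; split=> //; first by split; apply: switch_refl.
  by move: pq; rewrite xy perm_cons.
have xq : x \in ends q.
  by have := perm_mem pq x; rewrite !inE eqxx (negbTE xy) /= => <-.
have [z [q0 [q_sw sq exz vq0 eq0]]] := ends_pick xq vq.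
have {}pq : perm_eq (ends p) [:: y, z & ends q0].
  rewrite -(perm_cons x); apply: perm_trans pq _.
  apply: (perm_trans (y := y :: [:: x, z & ends q0])); first by rewrite perm_cons.
  exact: (permEl (perm_catCA [:: y] [:: x] _)).
have zp : z \in ends p by rewrite (perm_mem pq) !inE eqxx orbT.
have [x1 [p0 [p_sw sp ezx vp0 ep0]]] := ends_pick zp vp.
have {}pq : perm_eq (x1 :: ends p0) (y :: ends q0).
  rewrite -(perm_cons z); apply: perm_trans (_ : perm_eq _ (ends p)) _.
    by rewrite perm_sym.
  by apply: perm_trans pq _; apply: (permEl (perm_catCA [:: y] [:: z] _)).
have [|s [p' [q' [[ps ls os] [sp' sq'] np' v' e']]]] := IHn p0 q0 x1 _ vp0 vq0 pq.
  by rewrite sp in pn.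
exists [:: z, x1 & s], p', q'; split=> //.
- by rewrite /= exz ezx ps negbK.
- split.
    by apply: switch_trans p_sw _; apply: (switch_catl [:: (z, x1)]).
  by apply: switch_trans q_sw _; apply: (switch_catl [:: (x, z)]).
- by rewrite sp; apply: leq_trans np' _.
Qed.

Lemma closed_trail p q : edge_pairs p -> edge_pairs q -> 0 < size p ->
    perm_eq (ends p) (ends q) -> exists w p' q',
  [/\ closed w /\ ~~ odd (size w),
      switch_equiv e p (pairs (rot 1 w) ++ p') /\ switch_equiv e q (pairs w ++ q'),
      size p' < size p, edge_pairs p' /\ edge_pairs q' &
      perm_eq (ends p') (ends q')].
Proof.
case: p => //= -[a b] p /= /andP[/= eab vp] vq _ pq.
have bq : b \in ends q by rewrite -(perm_mem pq) !inE eqxx orbT.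
have [z [q0 [q_sw sq ebz vq0 eq0]]] := ends_pick bq vq.
have {}pq : perm_eq (a :: ends p) (z :: ends q0).
  rewrite -(perm_cons b); apply: perm_trans (_ : perm_eq _ _) eq0.
  apply: perm_trans (_ : perm_eq _ _) pq.
  exact: (permEl (perm_catCA [:: b] [:: a] _)).
have [s [p' [q' [[ps ls os] [sp' sq'] np' v' e']]]] := open_trail vp vq0 pq.
exists (a :: rcons s b), p', q'; split=> //; first split.
- by rewrite /= !rcons_path last_rcons ps ls esym ebz esym.
- by rewrite /= size_rcons /= negbK.
- split.
    rewrite rot1_cons -!cats1 -catA pairs_cat //= -catA.
    apply: switch_trans (switch_flip _ _ _ _) _.
    apply: switch_trans (switch_catl [:: (b, a)] sp') _.
    by apply: switch_perm; rewrite perm_catCA.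
  apply: switch_trans q_sw _; apply: switch_trans (switch_catl [:: _] sq') _.
  case/lastP: s ls os {ps sp' sq'} => [/= <- _|s z'].
    exact: switch_flip.
  rewrite last_rcons size_rcons [odd _]/= negbK => -> os.
  rewrite -(cats1 (rcons s z)) cat_rcons -cats1 -!cat_cons.
  rewrite !pairs_cat ?[odd _]/= ?negbK //.
  rewrite [pairs [:: z]]/= cats0.
  rewrite -catA; apply: (switch_trans (switch_flip e b z _)).
  by apply: switch_perm; rewrite (perm_catCA [:: (z, b)]).
Qed.

(** Split off alternating closed walks one at a time; each is balanced. *)
Lemma switch_of_perm_ends p q :
    (forall w, closed w -> ~~ odd (size w) -> balanced e w) ->
    edge_pairs p -> edge_pairs q -> perm_eq (ends p) (ends q) ->
  switch_equiv e p q.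
Proof.
move=> bal; have [n] := ubnP (size p); elim: n p q => // n IHn p q pn vp vq pq.
have [p0|p0] := posnP (size p).
  move/size0nil: p0 pq => ->; case: q {vq} => [|[a b] q] /perm_size //= _.
  exact: switch_refl.
have [w [p' [q' [[cw ow] [sp sq] np [vp' vq'] e']]]] := closed_trail vp vq p0 pq.
apply: switch_trans sp _; apply: switch_trans _ (switch_sym sq).
apply: switch_cat; first exact/switch_sym/bal.
by apply: IHn => //; apply: leq_trans np _.
Qed.

End Trails.

(** * Induced odd cycles *)

Section InducedOddCycles.
Variables (T : eqType) (e : rel T).
Hypotheses (esym : ssrbool.symmetric e) (eirr : irreflexive e).
Implicit Types (w l D : seq T).

Notation closed := (path.cycle e).

Definition chordless w := forall x0 i j, i < j < size w ->
  e (nth x0 w i) (nth x0 w j) -> consecutive (size w) i j.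

Definition induced_odd_cycle w :=
  [/\ closed w, uniq w, odd (size w) & chordless w].

Lemma odd_closed_size w : closed w -> odd (size w) -> 2 < size w.
Proof. by case: w => [|x [|y [|z w]]] //=; rewrite eirr. Qed.

(** A shortest odd closed walk inside w: a repeated vertex or a chord would cut it
into two closed walks, one of which is odd and shorter. *)
Lemma induced_odd_cycle_sub w : closed w -> odd (size w) ->
  exists D, induced_odd_cycle D /\ {subset D <= w}.
Proof.
have [n] := ubnP (size w); elim: n w => // n IHn w wn cw ow.
have shorter w' : size w' < size w -> odd (size w') -> closed w' ->
    {subset w' <= w} -> exists D, induced_odd_cycle D /\ {subset D <= w}.
  move=> w'w ow' cw' sw'; have [|//|//|D [iD sD]] := IHn w'.
    exact: leq_trans w'w wn.
  by exists D; split=> // a /sD /sw'.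
have [uw|] := boolP (uniq w); last first.
  have x0 : T by case: w ow {wn cw shorter} => [|x].
  case/(uniqPn x0) => i [j [ij jw eij]]; have ijw : i < j < size w by rewrite ij.
  have [l1 [l2 [Ew n1 n2]]] := rot_split x0 ijw.
  move: Ew; rewrite -eij; set x := nth x0 w i => Ew.
  have sw : size w = (size l1 + size l2).+2.
    by rewrite -(size_rot i) Ew /= size_cat /= addnS.
  have mw a : (a \in w) = (a \in x :: l1 ++ x :: l2) by rewrite -Ew mem_rot.
  have := cw; rewrite -(rot_cycle i e) Ew /= rcons_cat cat_path /=.
  case/and3P=> p1 ex p2; have [o1|o1] := boolP (odd (size l1)); last first.
    apply: (shorter (x :: l1)) => //=; rewrite ?rcons_path ?p1 // ?sw; first lia.
    by move=> a; rewrite mw !inE mem_cat => /orP[->|->]; rewrite ?orbT.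
  apply: (shorter (x :: l2)) => //=; rewrite ?sw; first lia.
    by move: ow; rewrite sw /= negbK oddD o1.
  by move=> a; rewrite mw !inE mem_cat inE => /orP[]->; rewrite ?orbT.
have [ch|] := pselect (chordless w); first by exists w; split.
move=> nch; have [x0 [i [j [ijw eij cij]]]] : exists x0 i j,
    [/\ i < j < size w, e (nth x0 w i) (nth x0 w j) & ~~ consecutive (size w) i j].
  apply: contrapT => nex; apply: nch => x0 i j ijw eij; apply/negPn/negP => cij.
  by apply: nex; exists x0, i, j.
have [l1 [l2 [Ew n1 n2]]] := rot_split x0 ijw.
move: eij Ew; set x := nth x0 w i; set y := nth x0 w j => exy Ew.
have sw : size w = (size l1 + size l2).+2.
  by rewrite -(size_rot i) Ew /= size_cat /= addnS.
have mw a : (a \in w) = (a \in x :: l1 ++ y :: l2) by rewrite -Ew mem_rot.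
have [p1 p2] : 0 < size l1 /\ 0 < size l2.
  by clear -n1 n2 cij ijw; rewrite /consecutive in cij; lia.
have := cw; rewrite -(rot_cycle i e) Ew /= rcons_cat cat_path /=.
case/and3P=> q1 ey q2; have [o1|o1] := boolP (odd (size l1)).
  apply: (shorter (x :: rcons l1 y)) => //=; rewrite ?size_rcons ?sw //=.
  - by clear -p1 p2; lia.
  - by rewrite negbK.
  - by rewrite !rcons_path q1 !last_rcons ey esym.
  - move=> a; rewrite mw !inE mem_rcons mem_cat !inE.
    by case/or3P=> ->; rewrite ?orbT.
apply: (shorter (y :: rcons l2 x)) => //=; rewrite ?size_rcons ?sw //=.
  - by clear -p1 p2; lia.
- by move: ow; rewrite sw /= !negbK oddD (negbTE o1).
- by rewrite [path _ _ _]rcons_path q2 !last_rcons.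
- move=> a; rewrite mw !inE mem_rcons mem_cat !inE.
  by case/or3P=> ->; rewrite ?orbT.
Qed.

Lemma chordless_rot1 w : chordless w -> chordless (rot 1 w).
Proof.
case: w => [|a l] // ch x0 i j; rewrite rot1_cons size_rcons => /andP[ij jl].
have il : i < size l by apply: leq_trans ij jl.
rewrite !nth_rcons il; have [jl'|lj] := ltnP j (size l) => eij.
  have := ch x0 i.+1 j.+1; rewrite /= !ltnS ij jl' /consecutive /= eqSS orbF.
  by move=> /(_ isT eij) ->.
have Ej : j = size l by apply/eqP; rewrite eqn_leq lj andbT.
move: eij; rewrite Ej eqxx esym => eij.
have := ch x0 0 i.+1 il eij; rewrite /consecutive /= !eqSS.
by case/orP=> [/eqP->|]; rewrite ?eqxx ?orbT // => /eqP->; rewrite eqxx.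
Qed.

Lemma induced_odd_cycle_rot k w :
  induced_odd_cycle w -> induced_odd_cycle (rot k w).
Proof.
case=> cw uw ow ch; split; rewrite ?rot_cycle ?rot_uniq ?size_rot //.
elim: k => [|k IHk]; first by rewrite rot0.
have [kw|wk] := ltnP k (size w); last by rewrite rot_oversize // ltnW.
by rewrite rotS //; apply: chordless_rot1.
Qed.

(** The neighbours of x cut D into arcs, an odd number of which have odd length.  An
arc of odd length without neighbours of x inside closes up through x; it is
found by shrinking an arc whose number [size l1] of inner vertices is even. *)
Lemma induced_odd_cycle_through D x y z : induced_odd_cycle D -> x \notin D ->
    y \in D -> z \in D -> y != z -> e x y -> e x z ->
  exists D', [/\ induced_odd_cycle D', x \in D' & {subset D' <= x :: D}].
Proof.
move=> iD xD yD zD yz exy exz.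
(* The two arcs between y and z have inner parts of different parity. *)
have [y' [z' [l1 [l2 [iE ED exy' exz' o1]]]]] : exists y' z' l1 l2,
    [/\ induced_odd_cycle (y' :: l1 ++ z' :: l2), y' :: l1 ++ z' :: l2 =i D,
        e x y', e x z' & ~~ odd (size l1)].
  have [_ uD oD _] := iD; have [i p1 p2 _ _ Ei] := rot_to_arc uD yD zD yz.
  have iE := induced_odd_cycle_rot i iD; rewrite Ei in iE.
  have ED := mem_rot i D; rewrite Ei in ED.
  have [o1|o1] := boolP (odd (size p1)); last by exists y, z, p1, p2.
  exists z, y, p2, p1; rewrite -[z :: p2 ++ _]/((z :: p2) ++ y :: p1) -rot_size_cat.
  split=> //; first exact: induced_odd_cycle_rot.
    by move=> a; rewrite mem_rot ED.
  by move: oD; rewrite -(size_rot i) Ei /= size_cat /= addnS /= negbK oddD o1; case: odd.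
have [n] := ubnP (size l1).
elim: n y' z' l1 l2 iE ED exy' exz' o1 => // n IHn y1 z1 l1 l2 iE ED ey ez o1 ln.
have [/hasP[u ul1 eu]|/hasPn nl1] := boolP (has (e x) l1).
  case/splitPr: {l1} ul1 iE ED o1 ln => p1 p2; rewrite -catA /= => iE ED.
  rewrite !size_cat /= addnS /= negbK oddD => o12 ln.
  have [op1|op1] := boolP (odd (size p1)); last first.
    by apply: (IHn y1 u p1 (p2 ++ z1 :: l2)) => //; clear -ln; lia.
  have E : rot (size (y1 :: p1)) ((y1 :: p1) ++ u :: p2 ++ z1 :: l2) =
           u :: p2 ++ z1 :: (l2 ++ y1 :: p1).
    by rewrite rot_size_cat /= -catA.
  apply: (IHn u z1 p2 (l2 ++ y1 :: p1)) => //; rewrite -?E.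
  - exact: induced_odd_cycle_rot.
  - by move=> a; rewrite mem_rot ED.
  - by move: o12; rewrite op1; case: odd.
  - by clear -ln; lia.
exists (x :: y1 :: rcons l1 z1).
have [cE uE oE ch] := iE.
split; last 2 first.
- by rewrite mem_head.
- move=> a; rewrite !inE mem_rcons inE -ED !inE mem_cat !inE.
  by case/or4P=> ->; rewrite ?orbT.
have sE : size (y1 :: l1 ++ z1 :: l2) = (size l1 + size l2).+2.
  by rewrite /= size_cat /= addnS.
split.
- move: cE; rewrite /= rcons_cat cat_path /= => /and3P[p1 e1 _].
  by rewrite ey !rcons_path p1 e1 last_rcons esym ez.
- have xE : x \notin y1 :: l1 ++ z1 :: l2 by rewrite ED.
  have sub : {subset y1 :: rcons l1 z1 <= y1 :: l1 ++ z1 :: l2}.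
    move=> a; rewrite !inE mem_rcons mem_cat !inE.
    by case/or3P=> ->; rewrite ?orbT.
  rewrite cons_uniq (contra (sub x)) //=; move: uE.
  rewrite -cat_cons -cat_rcons cat_uniq => /andP[].
  by rewrite rcons_cons.
- by rewrite /= size_rcons /= negbK.
move=> x0 [|i] [|j] // /=; rewrite size_rcons !ltnS => ij.
  case: j ij => [|j] //= jl1; rewrite nth_rcons /consecutive /=.
  have [jl|lj] := ltnP j (size l1); first by rewrite (negbTE (nl1 _ (mem_nth _ jl))).
  by rewrite !eqSS eqn_leq lj -ltnS jl1.
have [ij' jl] := andP ij.
have nE k : k <= (size l1).+1 ->
    nth x0 (y1 :: rcons l1 z1) k = nth x0 (y1 :: l1 ++ z1 :: l2) k.
  case: k => //= k; rewrite ltnS => kl; rewrite nth_rcons nth_cat.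
  by case: ltngtP kl => // ->; rewrite subnn.
have il : i <= (size l1).+1 by apply: leq_trans (ltnW ij') jl.
rewrite -![nth _ (y1 :: _) _]/(nth x0 (y1 :: rcons l1 z1) _) !nE // => eij.
have l2p : odd (size l2) by move: oE; rewrite sE /= negbK oddD (negbTE o1).
have := ch x0 i j _ eij; rewrite sE ij' /consecutive /= !eqSS orbF.
have -> : j < (size l1 + size l2).+2 by clear -jl; lia.
by move=> /(_ isT)/orP[//|/andP[_ /eqP Ej]]; clear -Ej jl l2p; lia.
Qed.

Lemma induced_odd_cycle_no_square D x y z t : induced_odd_cycle D ->
    x \in D -> y \in D -> z \in D -> t \in D -> uniq [:: x; y; z; t] ->
  e x y -> e z t -> e x z -> e y t -> False.
Proof.
move=> [cD uD oD ch] xD yD zD tD; rewrite /= !inE !negb_or andbT.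
case/and3P=> /and3P[xy xz xt] /andP[yz yt] zt exy ezt exz eyt.
have adj a b : a \in D -> b \in D -> e a b ->
    let i := index a D in let j := index b D in
    [|| j == i.+1, i == j.+1, (i == 0) && (j.+1 == size D) |
        (j == 0) && (i.+1 == size D)].
  move=> aD bD eab /=.
  have ne : index a D != index b D.
    by apply: contraTneq eab => /(congr1 (nth a D)); rewrite !nth_index // => ->; rewrite eirr.
  have [ij|ji|ij] := ltngtP (index a D) (index b D); last by rewrite ij eqxx in ne.
    have := ch a (index a D) (index b D); rewrite !nth_index // ij index_mem bD.
    by rewrite /consecutive => /(_ isT eab) /orP[]->; rewrite ?orbT.
  have := ch a (index b D) (index a D); rewrite !nth_index // ji index_mem aD esym.
  by rewrite /consecutive => /(_ isT eab) /orP[]->; rewrite ?orbT.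
have neq a b : a \in D -> b \in D -> a != b -> index a D != index b D.
  by move=> aD bD; apply: contraNneq => /(congr1 (nth a D)); rewrite !nth_index // => ->.
have lt a : a \in D -> index a D < size D by rewrite index_mem.
move: (adj _ _ xD yD exy) (adj _ _ zD tD ezt) (adj _ _ xD zD exz) (adj _ _ yD tD eyt).
move: (neq _ _ xD tD xt) (neq _ _ yD zD yz).
move: (lt _ xD) (lt _ yD) (lt _ zD) (lt _ tD); move: oD; clear.
move: (index x D) (index y D) (index z D) (index t D) (size D) => a b c d n /=.
lia.
Qed.

End InducedOddCycles.

(** * Cycles, chords and bridges of a graph *)

Section GraphCycles.
Variables (d : nat) (G : graph d).
Local Notation adj := (adjacent G).
Implicit Types (w D A B : seq 'I_d).

Lemma eq_set2 (T : finType) (a b c d' : T) :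
  [set a; b] = [set c; d'] -> a = c /\ b = d' \/ a = d' /\ b = c.
Proof.
move=> E; have : a \in [set c; d'] by rewrite -E set21.
have : b \in [set c; d'] by rewrite -E set22.
rewrite !in_set2 => /orP[]/eqP Eb /orP[]/eqP Ea; rewrite Ea Eb in E *;
  try by [left|right].
- by have := set22 c d'; rewrite -E !in_set2 orbb => /eqP ->; left.
- by have := set21 c d'; rewrite -E !in_set2 orbb => /eqP ->; left.
Qed.

Lemma adjC : ssrbool.symmetric adj.
Proof. by move=> x y; rewrite /adjacent /= finset.setUC. Qed.

Lemma adj_irr : irreflexive adj.
Proof.
move=> x; apply/negP; rewrite /adjacent /= finset.setUid => /card_edge.
by rewrite cards1.
Qed.

Lemma next_tnth q (C : q.-tuple 'I_d) i :
  uniq C -> next C (tnth C i) = tnth C (ordS i).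
Proof.
move=> uC; have x0 := tnth C i.
rewrite next_nth mem_tnth !(tnth_nth x0) index_uniq ?size_tuple //=.
have sC : size C = q by rewrite size_tuple.
move: (nat_of_ord i) (ltn_ord i) => {i}m; move: (tval C) sC {uC} => s <-.
case: s => //= y l; rewrite ltnS leq_eqVlt => /orP[/eqP->|ml].
  by rewrite modnn /= nth_default.
by rewrite modn_small ?ltnS //=; apply: set_nth_default.
Qed.

Lemma is_cycleP q (C : q.-tuple 'I_d) :
  is_cycle G C <-> [/\ 3 <= q, uniq C & path.cycle adj C].
Proof.
split=> [[q3 uC sC]|[q3 uC cC]]; split=> //.
  apply: cycle_from_next => // x /tnthP[i ->]; rewrite next_tnth //.
  by rewrite /adjacent /=; apply/(fintype.subsetP sC)/imset_f.
apply/fintype.subsetP => _ /imsetP[i _ ->]; rewrite -next_tnth //.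
exact: (next_cycle cC (mem_tnth i C)).
Qed.

Lemma val_ordS q (k : 'I_q) :
  ordS k = (if k.+1 < q then k.+1 else 0) :> nat.
Proof.
rewrite /=; case: ltnP => [kq|qk]; first by rewrite modn_small.
have /eqP qE : k.+1 == q by rewrite eqn_leq qk ltn_ord.
by rewrite qE modnn.
Qed.

Lemma cycle_edge_consecutive q (C : q.-tuple 'I_d) (i j : 'I_q) :
    uniq C -> i < j ->
  ([set tnth C i; tnth C j] \in cycle_edges C) = consecutive q i j.
Proof.
move=> uC ij; have injC : injective (tnth C) by apply/tuple_uniqP.
apply/imsetP/idP => [[k _ /eq_set2 E]|].
  have {}E : (i = k /\ j = ordS k) \/ (i = ordS k /\ j = k).
    by case: E => -[/injC-> /injC->]; [left|right].
  rewrite /consecutive; case: E ij => -[-> ->]; rewrite val_ordS.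
    by case: ifP => // _ _; rewrite eqxx.
  case: (ltnP k.+1 q) => kq ij; first by rewrite ltnNge leqnSn in ij.
  by rewrite [X in _ || X]eqn_leq kq ltn_ord orbT.
case/orP=> [/eqP ji|/andP[/eqP i0 /eqP jq]].
  exists i => //; congr [set _; tnth _ _]; apply: val_inj => /=.
  by rewrite modn_small -ji // ltn_ord.
exists j => //; rewrite finset.setUC; congr [set _; tnth _ _]; apply: val_inj => /=.
by rewrite jq modnn.
Qed.

Lemma induced_odd_cycleP q (C : q.-tuple 'I_d) :
  induced_cycle G C /\ odd q <-> induced_odd_cycle adj C.
Proof.
split=> [[[/is_cycleP[q3 uC cC] nch] oq]|[cC uC oC ch]].
  split=> //; first by rewrite size_tuple.
  move=> x0 i j; rewrite size_tuple => /andP[ij jq] eij.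
  have iq := ltn_trans ij jq.
  apply/negPn/negP => cij; apply: nch.
  exists (Ordinal iq), (Ordinal jq), [set nth x0 C i; nth x0 C j].
  rewrite /is_chord !(tnth_nth x0); split=> //=; rewrite inE -[_ \in edges G]/(adj _ _) eij andbT.
  have := @cycle_edge_consecutive _ _ (Ordinal iq) (Ordinal jq) uC ij.
  by rewrite !(tnth_nth x0) /= => ->.
have q3 : 3 <= q by have := odd_closed_size adj_irr cC oC; rewrite size_tuple.
rewrite size_tuple in oC; split=> //; split; first exact/is_cycleP.
move=> [i [j [f [ij Ef]]]]; have x0 := tnth C i.
rewrite inE Ef (cycle_edge_consecutive uC ij) => /andP[/negP ncij eij]; apply: ncij.
by have := ch x0 i j; rewrite size_tuple ij ltn_ord -!tnth_nth; apply.
Qed.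

Lemma induced_odd_cycle_tuple D : induced_odd_cycle adj D ->
  induced_cycle G (in_tuple D) /\ odd (size D).
Proof. by move=> iD; apply/(@induced_odd_cycleP _ (in_tuple D)). Qed.

Lemma induced_cycle_edge q (C : q.-tuple 'I_d) x y :
    induced_odd_cycle adj C -> x \in C -> y \in C -> adj x y ->
  [set x; y] \in cycle_edges C.
Proof.
case=> _ uC _ ch /tnthP[i ->] /tnthP[j ->] eij.
wlog ij : i j eij / i < j.
  move=> H; have [ij|ji|/val_inj ij] := ltngtP i j; first exact: H.
    by rewrite finset.setUC; apply: H => //; rewrite adjC.
  by rewrite ij adj_irr in eij.
rewrite cycle_edge_consecutive //; have x0 := tnth C i.
by have := ch x0 i j; rewrite size_tuple ij ltn_ord -!tnth_nth; apply.
Qed.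

Lemma bridgesP q1 (C1 : q1.-tuple 'I_d) q2 (C2 : q2.-tuple 'I_d) f :
  reflect (exists x y, [/\ x \in C1, y \in C2, adj x y & f = [set x; y]])
          (f \in bridges G C1 C2).
Proof.
rewrite inE; apply: (iffP andP) => [[fG]|[x [y [x1 y2 exy ->]]]].
  case/existsP=> x /andP[]; rewrite inE => x1 /existsP[y /andP[]].
  by rewrite inE => y2 /eqP Ef; exists x, y; split=> //; rewrite /adjacent /= -Ef.
split=> //; apply/existsP; exists x; rewrite inE x1 /=.
by apply/existsP; exists y; rewrite inE y2 /=.
Qed.

End GraphCycles.

(** * What condition (Q) forbids and provides *)

Section ConditionQ.
Variables (d : nat) (G : graph d).
Local Notation adj := (adjacent G).
Implicit Types (w D A B : seq 'I_d).

Definition cut_by x A B := forall a b,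
  a \in A -> b \in B -> a != x -> b != x -> a != b /\ ~~ adj a b.

Lemma cut_by_sym x A B : cut_by x A B -> cut_by x B A.
Proof.
move=> cAB a b aB bA ax bx; rewrite eq_sym adjC.
exact: cAB.
Qed.

Lemma cut_by_sub x A B A' B' : cut_by x A B ->
  {subset A' <= x :: A} -> {subset B' <= x :: B} -> cut_by x A' B'.
Proof.
move=> cAB sA sB a b /sA + /sB; rewrite !inE => /orP[->//|aA] /orP[->//|bB].
exact: cAB.
Qed.

(** The edge that (Q-ii) provides would have to contain x, hence lie in one of the two
cycles, which are induced. *)
Lemma no_cut_shared x D1 D2 : condition_Qii G ->
    induced_odd_cycle adj D1 -> induced_odd_cycle adj D2 ->
  x \in D1 -> x \in D2 -> cut_by x D1 D2 -> False.
Proof.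
move=> Qii i1 i2 x1 x2 c12.
have [ic1 o1] := induced_odd_cycle_tuple i1.
have [ic2 o2] := induced_odd_cycle_tuple i2.
have [|i [j]] := Qii _ _ _ _ ic1 o1 ic2 o2.
  rewrite (_ : _ :&: _ = [set x]) ?cards1 //; apply/setP=> a; rewrite !inE.
  apply/andP/eqP => [[a1 a2]|-> //]; apply/eqP/negPn/negP => ax.
  by have [] := c12 a a a1 a2 ax ax; rewrite eqxx.
rewrite !inE => -[iD jD eij]; rewrite negb_or => /andP[/negP n1 /negP n2].
have [ix|ix] := eqVneq i x.
  by apply: n2; apply: (@induced_cycle_edge _ G _ (in_tuple D2)) => //; rewrite ix.
have [jx|jx] := eqVneq j x.
  by apply: n1; apply: (@induced_cycle_edge _ G _ (in_tuple D1)) => //; rewrite jx.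
by have [_ /negP] := c12 i j iD jD ix jx; apply.
Qed.

(** All bridges contain x, so the two bridges of (Q-iii) give two neighbours of x on
D1.  An induced odd cycle through x inside D1 and x then contradicts
[no_cut_shared]. *)
Lemma no_cut_one_side x D1 D2 : condition_Qii G -> condition_Qiii G ->
    induced_odd_cycle adj D1 -> induced_odd_cycle adj D2 -> x \notin D1 ->
    (forall a b, a \in D1 -> b \in D2 -> connect adj a b) ->
  cut_by x D1 D2 -> False.
Proof.
move=> Qii Qiii i1 i2 x1 con c12.
have [ic1 o1] := induced_odd_cycle_tuple i1.
have [ic2 o2] := induced_odd_cycle_tuple i2.
have D1x a : a \in D1 -> a != x by apply: contraTneq => ->.
have /card_gt1P[f [f' [/bridgesP[a [b [a1 b2 eab ->]]]]]] :
    1 < #|bridges G (in_tuple D1) (in_tuple D2)|.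
  apply: (Qiii _ _ _ _ ic1 o1 ic2 o2).
    by move=> a b; rewrite !inE; apply: con.
  rewrite disjoint_subset; apply/fintype.subsetP=> a; rewrite !inE => a1.
  apply/negP => a2; have ax := D1x a a1.
  by have [] := c12 a a a1 a2 ax ax; rewrite eqxx.
case/bridgesP=> a' [b' [a1' b2' eab' ->]] ff.
have b2x c b0 : c \in D1 -> b0 \in D2 -> adj c b0 -> b0 = x.
  move=> c1 b02 ecb; apply/eqP/negPn/negP => bx.
  by have [_] := c12 c b0 c1 b02 (D1x c c1) bx; rewrite ecb.
have Eb := b2x _ _ a1 b2 eab; have Eb' := b2x _ _ a1' b2' eab'; subst b b'.
have aa' : a != a' by apply: contraNneq ff => ->.
rewrite adjC in eab; rewrite adjC in eab'.
have [D' [iD' xD' sD']] :=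
  induced_odd_cycle_through (@adjC _ G) i1 x1 a1 a1' aa' eab eab'.
apply: (no_cut_shared Qii iD' i2 xD' b2).
by apply: cut_by_sub c12 sD' _ => c cD; rewrite inE cD orbT.
Qed.

Lemma condition_Q_no_odd_cut_vertex :
  condition_Qii G -> condition_Qiii G -> no_odd_cut_vertex adj.
Proof.
move=> Qii Qiii x A B cA oA cB oB con cAB.
have [D1 [i1 s1]] := induced_odd_cycle_sub (@adjC _ G) cA oA.
have [D2 [i2 s2]] := induced_odd_cycle_sub (@adjC _ G) cB oB.
have {cAB} c12 : cut_by x D1 D2.
  by apply: cut_by_sub cAB _ _ => a; [move/s1|move/s2] => aX; rewrite inE aX orbT.
have {con} con a b : a \in D1 -> b \in D2 -> connect adj a b.
  by move=> /s1 aA /s2 bB; apply: con.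
have [x1|x1] := boolP (x \in D1); last exact: (no_cut_one_side Qii Qiii i1 i2 x1 con c12).
have [x2|x2] := boolP (x \in D2); first exact: (no_cut_shared Qii i1 i2 x1 x2 c12).
apply: (no_cut_one_side Qii Qiii i2 i1 x2) (cut_by_sym c12) => //.
move=> a b a2 b1; rewrite (sym_connect_sym (@adjC _ G)); exact: con.
Qed.

(** On a cycle of even length, rotations preserve relative parities of positions. *)
Lemma odd_index_rot k w x : uniq w -> ~~ odd (size w) -> x \in w -> k <= size w ->
  odd (index x (rot k w)) = odd (index x w) (+) odd k.
Proof.
move=> uw ow xw; elim: k => [|k IHk] kw; first by rewrite rot0 addbF.
rewrite rotS //= addbN -IHk 1?ltnW //.
have := mem_rot k w x; rewrite xw; have := size_rot k w.
case Ew: (rot k w) => [|a l] //= sw; rewrite rot1_cons inE.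
have [Eax|xa] := eqVneq a x; last first.
  by move=> /= xl; rewrite -cats1 index_cat xl negbK.
have /andP[/negPf al _] : uniq (a :: l) by rewrite -Ew rot_uniq.
move=> _; rewrite -cats1 index_cat -Eax al /= eqxx addn0.
by move: ow; rewrite -sw /= negbK.
Qed.

(** The crossing chords are given here by their positions in the rotated cycle: they
join 0 to m and m - 1 to the last position, so that A consists of the positions
below m. *)
Lemma crossing_reversible w k m x y x0 :
    uniq w -> ~~ odd (size w) -> k <= size w ->
    ~~ odd m -> 0 < m < size w ->
    let u := rot k w in
    adj (nth x0 u 0) (nth x0 u m) ->
    adj (nth x0 u m.-1) (nth x0 u (size w).-1) ->
    x \in w -> y \in w -> adj x y -> ~~ odd (index x w + index y w) ->
    [set x; y] != [set nth x0 u 0; nth x0 u m] ->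
    [set x; y] != [set nth x0 u m.-1; nth x0 u (size w).-1] ->
  chorded_split adj x0 w.
Proof.
move=> uw ow kw om /andP[m0 mw] u e1 e2 xw yw exy oxy n1 n2.
wlog ixy : x y xw yw exy oxy n1 n2 / index x u < index y u.
  move=> H; have [ij|ji|ij] := ltngtP (index x u) (index y u).
  - exact: (H x y).
  - by apply: (H y x); rewrite // 1?adjC // 1?addnC // finset.setUC.
  - have := adj_irr G x; have xu : x \in u by rewrite mem_rot.
    have yu : y \in u by rewrite mem_rot.
    by rewrite -{2}(nth_index x0 xu) ij nth_index // exy.
have su : size u = size w by rewrite size_rot.
exists k, (take m u), (drop m u), (index x u), (index y u).
have xu : x \in u by rewrite mem_rot.
have yu : y \in u by rewrite mem_rot.
have st : size (take m u) = m by rewrite size_takel // su ltnW.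
rewrite cat_take_drop !nth_index // st; split=> //.
- split; rewrite ?st ?size_drop ?su ?subn_gt0 //.
    by rewrite oddB 1?ltnW // (negbTE ow).
  have Elast : m + (size w - m).-1 = (size w).-1 by clear -mw; lia.
  by rewrite !nth_take ?prednK // !nth_drop addn0 Elast.
- by rewrite ixy -su index_mem.
- split=> //; rewrite oddB 1?ltnW // !(odd_index_rot uw) //.
  by move: oxy; rewrite oddD; do 2 case: (odd (index _ _)); case: odd.
split; apply/negP => /andP[/eqP Ei /eqP Ej].
  by move/negP: n1; apply; rewrite -Ei -Ej !nth_index.
move/negP: n2; apply.
by rewrite -Ei -Ej /= !nth_index.
Qed.


Lemma odd_chordP q (C : q.-tuple 'I_d) (i j : 'I_q) : uniq C -> i < j ->
  odd_chord G C [set tnth C i; tnth C j] ->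
  adj (tnth C i) (tnth C j) /\ ~~ odd (j - i).
Proof.
move=> uC ij [i' [j' [[ij' E eG] oij]]].
have injC : injective (tnth C) by apply/tuple_uniqP.
split; first by move: eG; rewrite inE => /andP[_].
by case: (eq_set2 E) => -[/injC Ei /injC Ej]; move: oij ij' ij; rewrite Ei Ej // => _; lia.
Qed.

(** The two patterns of cycle edges allowed for crossing chords correspond to
k = i + 1, l = j + 1 and to i = 0, j = k + 1, l = n - 1. *)
Lemma cross_split x0 w (C := in_tuple w) (i j k l : 'I_(size w)) x y :
    uniq w -> ~~ odd (size w) -> i < k < j -> j < l ->
    adj (tnth C i) (tnth C j) -> adj (tnth C k) (tnth C l) -> ~~ odd (j - i) ->
    ([set tnth C i; tnth C k] \in cycle_edges C /\
     [set tnth C j; tnth C l] \in cycle_edges C) \/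
    ([set tnth C i; tnth C l] \in cycle_edges C /\
     [set tnth C j; tnth C k] \in cycle_edges C) ->
    x \in w -> y \in w -> adj x y -> ~~ odd (index x w + index y w) ->
    [set x; y] != [set tnth C i; tnth C j] ->
    [set x; y] != [set tnth C k; tnth C l] ->
  chorded_split adj x0 w.
Proof.
move=> uw ow /andP[ik kj] jl e1 e2 oij ec xw yw exy oxy n1 n2.
have il : i < l by apply: ltn_trans jl; apply: ltn_trans kj.
have lw := ltn_ord l.
case: ec => -[].
  rewrite !cycle_edge_consecutive // /consecutive => c1 c2.
  have Ek : val k = i.+1 by clear -c1 lw kj jl; rewrite /=; lia.
  have El : val l = j.+1 by clear -c2 lw ik kj jl; rewrite /=; lia.
  have hk : i.+1 <= size w by clear -il lw; lia.
  have hm : 0 < j - i < size w by clear -ik kj jl lw; lia.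
  have nthu m : m < size w -> nth x0 (rot i.+1 w) m =
      if m < size w - i.+1 then nth x0 w (i.+1 + m) else nth x0 w (m - (size w - i.+1)).
    move=> mw; rewrite nth_cat size_drop nth_drop; case: ltnP => // m1.
    by rewrite nth_take //; rewrite ltn_subLR ?subnK.
  have u0 : nth x0 (rot i.+1 w) 0 = tnth C k.
    rewrite nthu; last by clear -lw; lia.
    by rewrite (tnth_nth x0) Ek addn0; case: ltnP => //; clear -il lw; lia.
  have um : nth x0 (rot i.+1 w) (j - i) = tnth C l.
    rewrite nthu; last by clear -hm; lia.
    rewrite (tnth_nth x0) El; case: ltnP => h; last by clear -h jl lw ik kj; lia.
    congr (nth _ _ _); clear -ik kj; lia.
  have um1 : nth x0 (rot i.+1 w) (j - i).-1 = tnth C j.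
    rewrite nthu; last by clear -hm; lia.
    rewrite (tnth_nth x0); case: ltnP => h; last by clear -h jl lw ik kj; lia.
    congr (nth _ _ _); clear -ik kj; lia.
  have uq : nth x0 (rot i.+1 w) (size w).-1 = tnth C i.
    rewrite nthu; last by clear -lw; lia.
    rewrite (tnth_nth x0); case: ltnP => h; first by clear -h lw; lia.
    congr (nth _ _ _); clear -il lw; lia.
  apply: (@crossing_reversible w i.+1 (j - i) x y x0) => //; rewrite ?u0 ?um ?um1 ?uq //.
  - by rewrite adjC.
  - by rewrite (finset.setUC [set tnth C j]).
rewrite cycle_edge_consecutive // finset.setUC cycle_edge_consecutive // /consecutive => c1 c2.
have Ei : val i = 0 by clear -c1 ik kj jl; rewrite /=; lia.
have El : val l = (size w).-1 by clear -c1 ik kj jl; rewrite /=; lia.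
have Ek : val k = j.-1 by clear -c2 ik; rewrite /=; lia.
have hm : 0 < j < size w by clear -ik kj jl lw; lia.
apply: (@crossing_reversible w 0 j x y x0); rewrite ?rot0 //.
- by move: oij; rewrite /= in Ei; rewrite Ei subn0.
- by move: e1; rewrite !(tnth_nth x0) /= -Ei.
- by move: e2; rewrite !(tnth_nth x0) /= -Ek -El.
- by move: n1; rewrite !(tnth_nth x0) /= -Ei.
- by move: n2; rewrite !(tnth_nth x0) /= -Ek -El.
Qed.

Lemma condition_Qi_chorded : condition_Qi G -> long_cycles_chorded adj.
Proof.
move=> Qi x0 w cw uw ow w6; pose C := in_tuple w.
have iC : is_cycle G C by apply/is_cycleP; split=> //; apply: leq_trans w6.
case: (Qi _ C iC ow w6) => [[f [i [j [[ij Ef fG] oij]]]]|].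
  left; exists i, j; rewrite -!(tnth_nth x0 C) ij ltn_ord; split=> //.
    by move: fG; rewrite inE Ef => /andP[].
  by move: fG; rewrite inE Ef => /andP[]; rewrite cycle_edge_consecutive.
move=> [f [f' [f'' [uf of1 of2 of3 [i [j [k [l [[ij Ef kl Ef'] ord ec]]]]]]]]].
right.
have [p [r [[pr Ef'' fG] opr]]] := of3.
move: uf; rewrite /= !inE negb_or andbT => /andP[/andP[_ n1] n2].
rewrite eq_sym in n1; rewrite eq_sym in n2.
rewrite Ef Ef' Ef'' in n1 n2 of1 of2 fG.
have [e1 o1] := odd_chordP (C := C) uw ij of1; have [e2 o2] := odd_chordP (C := C) uw kl of2.
have e3 : adj (tnth C p) (tnth C r) by move: fG; rewrite inE => /andP[].
have pw : tnth C p \in w by apply: mem_tnth.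
have rw : tnth C r \in w by apply: mem_tnth.
have o3 : ~~ odd (index (tnth C p) w + index (tnth C r) w).
  rewrite !(tnth_nth x0) !index_uniq ?ltn_ord //.
  by move: opr; rewrite oddB 1?ltnW // oddD addbC.
case: ord => -[].
  by move=> ikj jl; apply: (@cross_split x0 w i j k l (tnth C p) (tnth C r)).
move=> kil lj; apply: (@cross_split x0 w k l i j (tnth C p) (tnth C r)) => //.
case: ec => -[ec1 ec2]; [left|right].
  by rewrite (finset.setUC [set tnth C k]) (finset.setUC [set tnth C l]).
by split; rewrite finset.setUC.
Qed.

End ConditionQ.

(** * Graphs in which every movable monomial admits a switch *)

Section Switchable.
Variables (d : nat) (G : graph d).
Local Notation adj := (adjacent G).
Implicit Types (w s : seq 'I_d) (p : seq ('I_d * 'I_d)).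

Definition edge_sets p : seq {set 'I_d} := [seq [set u.1; u.2] | u <- p].

(** A monomial that is not alone in its fibre contains two opposite edges of a 4-cycle
of G.  Since x, y, z, t are distinct, the exchange of xy, zt for xz, yt is a
proper one. *)
Definition switchable := forall p q,
    edge_pairs adj p -> edge_pairs adj q -> perm_eq (ends p) (ends q) ->
    ~~ perm_eq (edge_sets p) (edge_sets q) ->
  exists x y z t, [/\ uniq [:: x; y; z; t], [set x; y] \in edge_sets p,
                      [set z; t] \in edge_sets p, adj x z & adj y t].

Lemma ends_pairs w : ~~ odd (size w) -> ends (pairs w) = w.
Proof. by move: w; apply: even_seq_ind => // x y s _ {2}<-. Qed.

Lemma edge_pairs_closed w : path.cycle adj w -> edge_pairs adj (pairs w).
Proof.
case: w => //= x s; rewrite rcons_path => /andP[+ _].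
have [n] := ubnP (size s).
elim: n x s => // n IHn x [|y [|z s]] //= sn /and3P[exy _ ps].
by rewrite /edge_pairs /= exy; apply: IHn ps; apply: ltnW.
Qed.

Lemma mem_edge_sets w f : f \in edge_sets (pairs w) -> forall x0, exists i,
  i.*2.+1 < size w /\ f = [set nth x0 w i.*2; nth x0 w i.*2.+1].
Proof.
have [n] := ubnP (size w); elim: n w => // n IHn [|x [|y s]] //= sn.
rewrite inE => /orP[/eqP->|fs] x0; first by exists 0.
have [|i [si Ef]] := IHn s _ fs x0; first exact: ltnW.
by exists i.+1.
Qed.

Lemma switchable_walk w f : switchable -> path.cycle adj w -> ~~ odd (size w) ->
    f \in edge_sets (pairs w) -> f \notin edge_sets (pairs (rot 1 w)) ->
  exists x y z t, [/\ uniq [:: x; y; z; t], [set x; y] \in edge_sets (pairs w),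
                      [set z; t] \in edge_sets (pairs w), adj x z & adj y t].
Proof.
move=> sw cw ow f1 f2; apply: (sw _ (pairs (rot 1 w))).
- exact: edge_pairs_closed.
- by apply: edge_pairs_closed; rewrite rot_cycle.
- by rewrite !ends_pairs ?size_rot // perm_sym perm_rot.
by apply: contra f2 => /perm_mem <-.
Qed.

Section EvenCycle.
Variables (q : nat) (C : q.-tuple 'I_d).
Hypotheses (uC : uniq C) (cC : path.cycle adj C) (oq : ~~ odd q) (q6 : 6 <= q).
Implicit Types i j : 'I_q.

Let injC : injective (tnth C). Proof. exact/tuple_uniqP. Qed.

Lemma odd_ordS i : odd (ordS i) = ~~ odd i.
Proof.
rewrite val_ordS; case: ltnP => //= qi.
have /eqP qE : i.+1 == q by rewrite eqn_leq qi ltn_ord.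
by move: oq; rewrite -{1}qE /= negbK => ->.
Qed.

Lemma ordS2_neq i : ordS (ordS i) <> i.
Proof.
move/(congr1 (@nat_of_ord q)); rewrite !val_ordS; have := ltn_ord i.
move: (nat_of_ord i) => m; move: q6; clear => hq hm.
by case: (ltnP m.+1 q) => h1; [case: (ltnP m.+2 q)|case: (ltnP 1 q)]; lia.
Qed.

Lemma ordS4_neq i : ordS (ordS (ordS (ordS i))) <> i.
Proof.
move/(congr1 (@nat_of_ord q)); rewrite !val_ordS; have := ltn_ord i.
move: (nat_of_ord i) => m; move: q6; clear => hq hm.
case: (ltnP m.+1 q) => h1; last by rewrite !ifT; lia.
case: (ltnP m.+2 q) => h2; last by rewrite !ifT; lia.
case: (ltnP m.+3 q) => h3; last by rewrite !ifT; lia.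
by case: (ltnP m.+4 q) => h4; lia.
Qed.

Lemma cycle_edgeP i j : [set tnth C i; tnth C j] \in cycle_edges C ->
  j = ordS i \/ i = ordS j.
Proof.
by case/imsetP=> k _ /eq_set2[] -[/injC -> /injC ->]; [left|right].
Qed.

(** As q is even, the parity of a chord can be read off the parities of its ends, in
either order. *)
Lemma chord_parity i j : adj (tnth C i) (tnth C j) ->
    j <> ordS i -> i <> ordS j ->
  if odd i == odd j then odd_chord G C [set tnth C i; tnth C j]
  else even_chord G C [set tnth C i; tnth C j].
Proof.
move=> eij nij nji.
have gij : [set tnth C i; tnth C j] \in edges G :\: cycle_edges C.
  rewrite inE -[X in _ && X]/(adj _ _) eij andbT; apply/negP.
  by case/cycle_edgeP.
wlog ij : i j eij nij nji gij / i < j.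
  move=> H; have [ij|ji|/val_inj ij] := ltngtP i j; first exact: H.
    by rewrite eq_sym finset.setUC; apply: H; rewrite // 1?adjC // finset.setUC.
  by rewrite ij adj_irr in eij.
have op : odd (j - i) = odd j (+) odd i by rewrite oddB // ltnW.
case: ifP => ev; exists i, j; split=> //.
  by rewrite op (eqP ev) addbb.
by rewrite op; move: ev; do 2 case: odd.
Qed.

(** The case distinction is whether the successor of the larger index is 0. *)
Lemma crossS i j : i != j -> odd i = odd j ->
  cross C [set tnth C i; tnth C j] [set tnth C (ordS i); tnth C (ordS j)].
Proof.
move=> + oij; wlog ij : i j oij / i < j.
  move=> H nij; have [ij|ji|/val_inj ij] := ltngtP i j; first exact: H.
    by rewrite finset.setUC (finset.setUC [set tnth C (ordS i)]); apply: H; rewrite // eq_sym.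
  by rewrite ij eqxx in nij.
move=> _; have jq := ltn_ord j.
have Si : ordS i = i.+1 :> nat by rewrite val_ordS ifT //; clear -ij jq; lia.
have e1 : [set tnth C i; tnth C (ordS i)] \in cycle_edges C by apply: imset_f.
have e2 : [set tnth C j; tnth C (ordS j)] \in cycle_edges C by apply: imset_f.
have [jS|jS] := ltnP j.+1 q.
  have Sj : ordS j = j.+1 :> nat by rewrite val_ordS jS.
  exists i, j, (ordS i), (ordS j); split; [split=> // | left | by left].
    by rewrite Si Sj.
  by rewrite Si Sj; clear -ij oij; lia.
have Sj : ordS j = 0 :> nat by rewrite val_ordS ltnNge jS.
exists i, j, (ordS j), (ordS i); split; [split=> // | right | by right].
- by rewrite Si Sj.
- by rewrite finset.setUC.
by rewrite Si Sj; clear -ij oij jq jS oq; lia.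
Qed.

Lemma nth_rot_tuple x0 k m (mq : m < q) : k <= q ->
  nth x0 (rot k C) m = tnth C (iter k (@ordS q) (Ordinal mq)).
Proof.
elim: k m mq => [|k IHk] m mq kq; first by rewrite rot0 (tnth_nth x0).
rewrite rotS ?size_tuple // iterSr.
have sk : size (rot k C) = q by rewrite size_rot size_tuple.
have -> : nth x0 (rot 1 (rot k C)) m = nth x0 (rot k C) (ordS (Ordinal mq)).
  rewrite val_ordS /=; case: (rot k C) sk => [|a l] /= sk; first by rewrite -sk in mq.
  have ml : m <= size l by rewrite -ltnS sk.
  by rewrite rot1_cons nth_rcons -sk ltnS; case: ltngtP ml.
by rewrite (IHk _ (ltn_ord _)) 1?ltnW //; congr (tnth _ (iter _ _ _)); apply: val_inj.
Qed.

Lemma mem_edge_sets_rot k f : k < q -> f \in edge_sets (pairs (rot k C)) ->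
  exists i, odd i = odd k /\ f = [set tnth C i; tnth C (ordS i)].
Proof.
move=> kq fk; have x0 := tnth C (Ordinal kq).
have [m [mq ->]] := mem_edge_sets fk x0.
rewrite size_rot size_tuple in mq.
exists (iter k (@ordS q) (Ordinal (ltnW mq))); split.
  elim: (k) => [|k' IHk] /=; first by rewrite odd_double.
  by rewrite -[_ %% _]/(nat_of_ord (ordS _)) odd_ordS IHk.
rewrite !nth_rot_tuple 1?ltnW // -iterS iterSr.
move=> mq0; have -> : Ordinal mq0 = Ordinal (ltnW mq) by apply: val_inj.
suff -> : Ordinal mq = ordS (Ordinal (ltnW mq)) by [].
by apply: ord_inj; rewrite val_ordS /= mq.
Qed.

(** Among the steps from positions of parity b, two can be switched.  The two new
edges join positions of different parity, and then one of them is an even chord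
because q is at least 6, or they are crossing odd chords. *)
Lemma switch_chords (b : bool) : switchable ->
  (exists f, even_chord G C f) \/
  exists i j, [/\ i != j, odd i = b, odd j = b,
     odd_chord G C [set tnth C i; tnth C j] &
     odd_chord G C [set tnth C (ordS i); tnth C (ordS j)]].
Proof.
move=> sw; have q0 : 0 < q by apply: leq_trans q6.
have b2 : b.+1 < q by apply: leq_trans q6; case: b.
(* The first step of the walk rotated by b starts at i0; it is in only one class. *)
pose i0 := iter b (@ordS q) (Ordinal q0); have oi0 : odd i0 = b.
  by rewrite /i0; case: (b); first exact: (odd_ordS (Ordinal q0)).
pose f := [set tnth C i0; tnth C (ordS i0)].
have f1 : f \in edge_sets (pairs (rot b C)).
  have := nth_rot_tuple (tnth C i0) q0 (ltnW (ltnW b2)).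
  have := nth_rot_tuple (tnth C i0) (leq_trans (isT : 1 < 6) q6) (ltnW (ltnW b2)).
  have : size (rot b C) = q by rewrite size_rot size_tuple.
  case: (rot b C) => [|x [|y s]] /=; try by move=> Eq; have := q6; rewrite -{1}Eq.
  move=> _ -> ->; rewrite inE; apply/orP; left; apply/eqP.
  rewrite /f -/i0; congr [set _; tnth _ _].
  rewrite /i0 -iterS iterSr; congr iter; apply: ord_inj.
  by rewrite val_ordS /= ifT //; apply: leq_trans q6.
have f2 : f \notin edge_sets (pairs (rot 1 (rot b C))).
  rewrite -rotS ?size_tuple 1?ltnW //; apply/negP => /(mem_edge_sets_rot b2).
  case=> i [oi /eq_set2[[/injC E _]|[/injC E /injC E']]].
    by move: oi; rewrite -E oi0; case: (b).
  by rewrite E in E'; case: (ordS2_neq E').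
have memw := mem_edge_sets_rot (ltnW b2).
have [||x [y [z [t [uxyzt /memw[i [oi xyE]] /memw[j [oj ztE]] exz eyt]]]]] :=
  switchable_walk sw _ _ f1 f2.
- by rewrite rot_cycle.
- by rewrite size_rot size_tuple.
rewrite oddb in oi oj; have ij : i != j.
  apply/eqP => ij; move: uxyzt; rewrite /= !inE !negb_or => /andP[/and3P[_ xz xt] _].
  have := set21 x y; rewrite xyE ij -ztE in_set2.
  by rewrite (negbTE xz) (negbTE xt).
have [H|H] : adj (tnth C i) (tnth C j) /\ adj (tnth C (ordS i)) (tnth C (ordS j)) \/
             adj (tnth C i) (tnth C (ordS j)) /\ adj (tnth C (ordS i)) (tnth C j).
  by case: (eq_set2 xyE) exz eyt => -[-> ->]; case: (eq_set2 ztE) => -[-> ->]; auto.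
- right; exists i, j; case: H => e1 e2.
  have nS (a b' : 'I_q) : odd a = odd b' -> b' <> ordS a.
    by move=> ab /(congr1 (fun x : 'I_q => odd x)); rewrite odd_ordS ab; case: odd.
  have oij : odd i = odd j by rewrite oi.
  have oSij : odd (ordS i) = odd (ordS j) by rewrite !odd_ordS oij.
  have := chord_parity e1; have := chord_parity e2.
  by rewrite oij oSij !eqxx => H2 H1; split=> //; [apply: H1|apply: H2]; apply: nS.
left; case: H => e1 e2.
have pS (a b' : 'I_q) : odd a = odd b' -> odd a == odd (ordS b') = false.
  by rewrite odd_ordS => ->; case: odd.
have [E|E] := eqVneq i (ordS (ordS j)).
  exists [set tnth C j; tnth C (ordS i)]; rewrite adjC in e2.
  have := chord_parity e2; rewrite pS ?oi //; apply.
    by move/ordS_inj => ji; rewrite ji eqxx in ij.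
  by rewrite E => jE; case: (@ordS4_neq j); rewrite -jE.
exists [set tnth C i; tnth C (ordS j)].
have := chord_parity e1; rewrite pS ?oj //; apply.
  by move/ordS_inj => ji; rewrite ji eqxx in ij.
by apply/eqP.
Qed.

End EvenCycle.
End Switchable.

(** * Even cycles, and odd cycles with a common vertex *)

Section SwitchableQ.
Variables (d : nat) (G : graph d).
Local Notation adj := (adjacent G).
Implicit Types (w s D : seq 'I_d) (p : seq ('I_d * 'I_d)).
Hypothesis sw : switchable G.

(** The two classes of steps give one crossing pair each.  The pairs are different:
shifting a pair of positions twice cannot restore it when q is at least 6. *)
Lemma switchable_Qi : condition_Qi G.
Proof.
move=> q C /is_cycleP[q3 uC cC] oq q6.
have injC : injective (tnth C) by apply/tuple_uniqP.
have [//|[i [j [ij oi oj f1 f2]]]] := switch_chords uC cC oq q6 false sw; first by left.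
have [//|[k [l [kl ok ol g1 g2]]]] := switch_chords uC cC oq q6 true sw; first by left.
right; have oS := odd_ordS oq.
have parity (a b a' b' : 'I_q) : odd a != odd a' -> odd a != odd b' ->
    [set tnth C a; tnth C b] != [set tnth C a'; tnth C b'].
  move=> n1 n2; apply/eqP => /eq_set2[] -[/injC E _].
    by rewrite E eqxx in n1.
  by rewrite E eqxx in n2.
have cr : cross C [set tnth C i; tnth C j] [set tnth C (ordS i); tnth C (ordS j)].
  by apply: crossS; rewrite // oi.
have [E|ne] := eqVneq [set tnth C k; tnth C l] [set tnth C (ordS i); tnth C (ordS j)].
  exists [set tnth C i; tnth C j], [set tnth C (ordS i); tnth C (ordS j)],
    [set tnth C (ordS k); tnth C (ordS l)]; split=> //=.
  rewrite !inE negb_or andbT -andbA; apply/and3P; split;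
    [by apply: parity; rewrite ?oS oi ?oj| |by apply: parity; rewrite !oS ?ok ?ol oi].
  apply/eqP => E'.
  have {E} : k = ordS i /\ l = ordS j \/ k = ordS j /\ l = ordS i.
    by case: (eq_set2 E) => -[/injC -> /injC ->]; [left|right].
  have {E'} : ordS k = i /\ ordS l = j \/ ordS k = j /\ ordS l = i.
    by case: (eq_set2 E') => -[/injC -> /injC ->]; [left|right].
  have S2 := ordS2_neq q6; have S4 := ordS4_neq q6.
  case=> -[Ei Ej] [] -[Ek El]; rewrite Ek El in Ei Ej.
  - by case: (S2 i).
  - by case: (S4 i); rewrite ?Ej ?Ei ?Ej.
  - by case: (S4 i); rewrite ?Ej ?Ei ?Ej.
  - by case: (S2 j).
exists [set tnth C i; tnth C j], [set tnth C (ordS i); tnth C (ordS j)],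
  [set tnth C k; tnth C l]; split=> //=.
rewrite !inE negb_or andbT -andbA; apply/and3P; split.
- by apply: parity; rewrite ?oS oi ?oj.
- by apply: parity; rewrite oi ?ok ?ol.
- by rewrite eq_sym.
Qed.

Lemma mem_edge_sets2 w x y : [set x; y] \in edge_sets (pairs w) ->
  x \in w /\ y \in w.
Proof.
move=> xyw; have x0 := x; have [i [iw E]] := mem_edge_sets xyw x0.
by case: (eq_set2 E) => -[-> ->]; rewrite !mem_nth // ltnW.
Qed.

Lemma edge_sets_cat p q : edge_sets (p ++ q) = edge_sets p ++ edge_sets q.
Proof. exact: map_cat. Qed.

Lemma edge_sets_adj w x y : path.cycle adj w ->
  [set x; y] \in edge_sets (pairs w) -> adj x y.
Proof.
move=> /edge_pairs_closed/allP pw /mapP[u /pw /= eu E].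
by rewrite /adjacent /= E.
Qed.

Lemma closed_cat (T : eqType) (e : rel T) x l1 l2 :
  path.cycle e (x :: l1) -> path.cycle e (x :: l2) ->
  path.cycle e (x :: l1 ++ x :: l2).
Proof.
by rewrite /= rcons_cat cat_path /= rcons_path => /andP[-> ->] ->.
Qed.

Lemma cycle_edge_mem q (C : q.-tuple 'I_d) x y :
  [set x; y] \in cycle_edges C -> x \in C /\ y \in C.
Proof.
by case/imsetP=> i _ /eq_set2[] -[-> ->]; rewrite !mem_tnth.
Qed.

(** The two edges of a switch cannot both come from an induced odd cycle, as this would
contain a 4-cycle. *)
Lemma induced_odd_cycle_square D w x y z t : induced_odd_cycle adj D ->
    path.cycle adj w -> uniq [:: x; y; z; t] ->
    [set x; y] \in edge_sets (pairs w) -> [set z; t] \in edge_sets (pairs w) ->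
    adj x z -> adj y t ->
  ~ [/\ x \in D, y \in D, z \in D & t \in D].
Proof.
move=> iD cw u xyw ztw xz yt [xD yD zD tD].
apply: (induced_odd_cycle_no_square (@adjC _ G) (@adj_irr _ G) iD xD yD zD tD u) => //.
  exact: edge_sets_adj xyw.
exact: edge_sets_adj ztw.
Qed.

Lemma induced_odd_cycle_rot_to q (C : q.-tuple 'I_d) v :
    induced_odd_cycle adj C -> v \in C ->
  exists l, [/\ induced_odd_cycle adj (v :: l), v :: l =i C, ~~ odd (size l)
               & 0 < size l].
Proof.
move=> iC /rot_to[k l El]; exists l.
have iD : induced_odd_cycle adj (v :: l).
  by rewrite -El; apply: induced_odd_cycle_rot => //; apply: adjC.
have [cD uD oD _] := iD; split=> //.
- by move=> a; rewrite -El mem_rot.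
- by have := odd_closed_size (@adj_irr _ G) cD oD; rewrite /= ltnS; apply: ltnW.
Qed.

(** Walk around one cycle and then around the other.  By [induced_odd_cycle_square] the
switch involves one edge of each; at most one of the two new edges contains the
common vertex, and the other one is in neither cycle. *)
Lemma switchable_Qii : condition_Qii G.
Proof.
move=> q1 C1 q2 C2 ic1 o1 ic2 o2 /eqP/cards1P[v Ev].
have i1 : induced_odd_cycle adj C1 by apply/induced_odd_cycleP.
have i2 : induced_odd_cycle adj C2 by apply/induced_odd_cycleP.
have common a : a \in C1 -> a \in C2 -> a = v.
  by move=> a1 a2; apply/set1P; rewrite -Ev !inE a1 a2.
have [v1 v2] : v \in C1 /\ v \in C2.
  by have := set11 v; rewrite -Ev !inE => /andP[].
have [l1 [j1 E1 ol1 nl1]] := induced_odd_cycle_rot_to i1 v1.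
have [l2 [j2 E2 ol2 nl2]] := induced_odd_cycle_rot_to i2 v2.
pose w := v :: l1 ++ v :: l2.
have cw : path.cycle adj w by apply: closed_cat; [case: j1|case: j2].
have ow : ~~ odd (size w) by rewrite /= size_cat /= addnS /= negbK oddD (negbTE ol1).
have pw : pairs w = pairs (v :: rcons l1 v) ++ pairs l2.
  by rewrite /w -cat_rcons -cat_cons pairs_cat //= size_rcons /= negbK.
have in12 x y : [set x; y] \in edge_sets (pairs w) ->
    x \in C1 /\ y \in C1 \/ x \in C2 /\ y \in C2.
  rewrite pw edge_sets_cat mem_cat => /orP[] /mem_edge_sets2[xl yl]; [left|right].
    by move: xl yl; rewrite -!E1 !(inE, mem_rcons) !orbA !orbb.
  by rewrite -!E2 !inE xl yl !orbT.
have fin x y z t : x \in C1 -> y \in C1 -> z \in C2 -> t \in C2 ->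
    uniq [:: x; y; z; t] -> adj x z -> adj y t ->
    exists i j, [/\ i \in cycle_vertices C1, j \in cycle_vertices C2,
      [set i; j] \in edges G & [set i; j] \notin cycle_edges C1 :|: cycle_edges C2].
  move=> x1 y1 z2 t2; rewrite /= !inE !negb_or andbT.
  case/and3P=> /and3P[xy xz xt] /andP[yz yt] zt exz eyt.
  have cross a b : a \in C1 -> b \in C2 -> a != v -> b != v ->
      [set a; b] \notin cycle_edges C1 :|: cycle_edges C2.
    move=> a1 b2 av bv; rewrite inE negb_or; apply/andP; split.
      by apply: contra bv => /cycle_edge_mem[_ b1]; apply/eqP/common.
    by apply: contra av => /cycle_edge_mem[a2 _]; apply/eqP/common.
  have [xv|xv] := eqVneq x v.
    exists y, t; split; [by rewrite inE | by rewrite inE | by [] |].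
    by apply: cross; rewrite // -xv eq_sym.
  have [zv|zv] := eqVneq z v; last first.
    by exists x, z; split; [rewrite inE | rewrite inE | | apply: cross].
  exists y, t; split; [by rewrite inE | by rewrite inE | by [] |].
  by apply: cross; rewrite // -zv // eq_sym.
pose y0 := head v l1.
have y0l : y0 \in l1 by rewrite /y0; case: (l1) nl1 => //= a l _; rewrite mem_head.
have [||x [y [z [t [u xyw ztw xz yt]]]]] := @switchable_walk _ G w [set v; y0] sw cw ow.
- rewrite pw edge_sets_cat mem_cat /y0; case: (l1) nl1 => //= a l _.
  by rewrite inE eqxx.
- rewrite rot1_cons rcons_cat pairs_cat // edge_sets_cat mem_cat negb_or.
  have [_ /andP[vl1 _] _ _] := j1.
  apply/andP; split; apply/negP => /mem_edge_sets2[vl yl].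
    by rewrite vl in vl1.
  have y2 : y0 \in C2.
    by move: yl; rewrite -E2 !(inE, mem_rcons) !orbA orbb.
  have y1 : y0 \in C1 by rewrite -E1 inE y0l orbT.
  by rewrite -(common _ y1 y2) y0l in vl1.
case: (in12 _ _ xyw) (in12 _ _ ztw) => -[x1 y1] [] [z2 t2].
- by case: (induced_odd_cycle_square i1 cw u xyw ztw xz yt).
- exact: (fin x y z t).
- apply: (fin z t x y) => //; rewrite // 1?adjC //.
  by rewrite -(rot_uniq 2) in u.
- by case: (induced_odd_cycle_square i2 cw u xyw ztw xz yt).
Qed.
End SwitchableQ.

(** * Odd cycles at positive distance *)

Section SwitchableQiii.
Variables (d : nat) (G : graph d).
Local Notation adj := (adjacent G).
Implicit Types (w s m D : seq 'I_d).
Hypothesis sw : switchable G.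

Definition reach D k y :=
  exists x s, [/\ x \in D, path adj x s, last x s = y & size s = k].

Lemma reach0 D x : x \in D -> reach D 0 x.
Proof. by exists x, [::]. Qed.

Lemma reach_path D k y s :
  reach D k y -> path adj y s -> reach D (k + size s) (last y s).
Proof.
case=> x [t [xD pt <- <-]] ps; exists x, (t ++ s).
by rewrite cat_path pt last_cat size_cat.
Qed.

Lemma reachS D k y z : reach D k y -> adj y z -> reach D k.+1 z.
Proof.
move=> ry yz; have := @reach_path D k y [:: z] ry; rewrite /= yz addn1.
by apply.
Qed.

Lemma last_take_nth (x : 'I_d) s j : j <= size s ->
  last x (take j s) = nth x (x :: s) j.
Proof. by elim: s x j => [|a s IHs] x [|j] //= js; rewrite IHs //; apply: set_nth_default. Qed.

(** The path has length [size m + 1]; v and z are its ends and m its inner vertices. *)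
Definition shortest D1 D2 v m z :=
  [/\ v \in D1, z \in D2, path adj v (rcons m z) &
      forall k y, y \in D2 -> reach D1 k y -> size m < k].

Section ShortestPath.
Variables (D1 D2 : seq 'I_d) (v z : 'I_d) (m : seq 'I_d).
Hypothesis shortvz : shortest D1 D2 v m z.
Local Notation u := (nth v (v :: rcons m z)).

Lemma shortest_reach j : j <= (size m).+1 -> reach D1 j (u j).
Proof.
case: shortvz => vD _ pv _ jm; exists v, (take j (rcons m z)).
rewrite last_take_nth ?size_rcons // size_takel ?size_rcons //; split=> //.
exact: take_path.
Qed.

(** The rest of the path leads from its j-th vertex to D2, so a shorter way to this
vertex would give a shorter path. *)
Lemma shortest_level j k : j <= (size m).+1 -> reach D1 k (u j) -> j <= k.
Proof.
case: shortvz => vD zD pv min jm rj.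
have := pv; rewrite -{1}(cat_take_drop j (rcons m z)) cat_path.
rewrite last_take_nth ?size_rcons // => /andP[_ pj].
have Ez : last (u j) (drop j (rcons m z)) = z.
  rewrite -last_take_nth ?size_rcons // -last_cat cat_take_drop.
  by rewrite last_rcons.
have := reach_path rj pj; rewrite Ez size_drop size_rcons => /(min _ _ zD).
by clear -jm; lia.
Qed.

Lemma shortest_level_mid i k : i < size m -> reach D1 k (nth v m i) -> i < k.
Proof.
move=> im; have -> : nth v m i = u i.+1 by rewrite /= nth_rcons im.
by apply: shortest_level; rewrite ltnS ltnW.
Qed.

Lemma shortest_reach_mid i : i < size m -> reach D1 i.+1 (nth v m i).
Proof.
move=> im; have -> : nth v m i = u i.+1 by rewrite /= nth_rcons im.
by apply: shortest_reach; rewrite ltnS ltnW.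
Qed.

End ShortestPath.

(** Once around the first cycle, along the path, once around the second cycle, and back
along the path.  Path edges are traversed twice, both times in the same class of
steps. *)
Definition barbell v l1 m z l2 := v :: l1 ++ v :: m ++ z :: l2 ++ z :: rev m.

Section Barbell.
Variables (v z : 'I_d) (l1 l2 m : seq 'I_d).
Let D1 := v :: l1. Let D2 := z :: l2.
Hypotheses (i1 : induced_odd_cycle adj D1) (i2 : induced_odd_cycle adj D2).
Hypothesis shortvz : shortest D1 D2 v m z.
Let w := barbell v l1 m z l2.

Lemma barbell_closed : path.cycle adj w.
Proof.
have [c1 _ _ _] := i1; have [c2 _ _ _] := i2.
case: shortvz => _ _ pv _; rewrite /w /barbell /=.
rewrite rcons_cat cat_path /= rcons_cat cat_path /= rcons_cat cat_path /=.
move: c1 c2 pv; rewrite /= !rcons_path => /andP[-> ->] /andP[-> ->] /andP[-> ->] /=.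
have /andP[pv ez] : path adj v m && adj (last v m) z.
  by case: shortvz => _ _; rewrite rcons_path.
have := rev_path adj v (rcons m z); rewrite last_rcons belast_rcons rev_cons.
by rewrite rcons_path (eq_path (e' := adj)) ?rcons_path ?pv ?ez // => x y; apply: adjC.
Qed.

Lemma barbell_even : ~~ odd (size w).
Proof.
have [_ _ o1 _] := i1; have [_ _ o2 _] := i2.
move: o1 o2; rewrite /w /barbell /= !size_cat /= !size_cat /= !size_cat /= size_rev.
by move: (size l1) (size l2) (size m); clear; lia.
Qed.

Lemma disjoint_ends a : a \in D1 -> a \in D2 -> False.
Proof. by case: shortvz => _ _ _ min a1 a2; have := min 0 a a2 (reach0 a1). Qed.

(** The first step vy of the walk occurs in one class of steps only, because y is not
visited outside of the first cycle. *)
Lemma barbell_switch : exists x y x' y',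
  [/\ uniq [:: x; y; x'; y'], [set x; y] \in edge_sets (pairs w),
      [set x'; y'] \in edge_sets (pairs w), adj x x' & adj y y'].
Proof.
have [c1 uD1 o1 _] := i1; have ol1 : ~~ odd (size l1) by move: o1.
have nl1 : 0 < size l1.
  by have := odd_closed_size (@adj_irr _ G) c1 o1; rewrite /= ltnS; apply: ltnW.
pose y0 := head v l1.
have y0l : y0 \in l1 by rewrite /y0; case: (l1) nl1 => //= a l _; rewrite mem_head.
have /andP[/= vl1 _] := uD1.
have yD : y0 \in D1 by rewrite inE y0l orbT.
apply: (@switchable_walk _ G w [set v; y0] sw barbell_closed barbell_even).
  rewrite /w /barbell /y0; case: (l1) nl1 => //= a l _.
  by rewrite inE eqxx.
rewrite /w /barbell rot1_cons rcons_cat pairs_cat // edge_sets_cat mem_cat negb_or.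
apply/andP; split; apply/negP => /mem_edge_sets2[vl yl]; first by rewrite vl in vl1.
have ym : y0 \notin m.
  apply/negP => ym; have im : index y0 m < size m by rewrite index_mem.
  have := @shortest_level_mid _ _ _ _ _ shortvz _ 0 im.
  by rewrite nth_index // => /(_ (reach0 yD)).
have yv : y0 != v by apply: contraNneq vl1 => <-.
have yD2 : y0 \notin D2 by apply/negP; apply: disjoint_ends.
move: yl; rewrite !(inE, mem_rcons, mem_cat, mem_rev) (negbTE ym) (negbTE yv) /=.
by move: yD2; rewrite inE negb_or => /andP[/negPf-> /negPf->].
Qed.

Let P := rcons m z.
Let N := size m + odd (size m).

(** The path edges in the first class of steps join the vertices number 2i + 1 and
2i + 2 of the path; N rounds [size m] up to an even number. *)
Definition mid_edge x y i :=
  i.*2.+1 < N /\ [set x; y] = [set nth v P i.*2; nth v P i.*2.+1].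

Lemma edge_sets_rev s f : ~~ odd (size s) ->
  f \in edge_sets (pairs (rev s)) -> f \in edge_sets (pairs s).
Proof.
move: s; apply: even_seq_ind => // x y s os IHs.
rewrite !rev_cons -!cats1 -catA pairs_cat ?size_rev //= edge_sets_cat mem_cat !inE.
by case/orP=> [/IHs->|]; rewrite ?orbT //= finset.setUC => ->.
Qed.

(** The length of the first cycle is odd, so the class starts on the path with its
second edge.  It enters the second cycle with the first edge if [size m] is even,
and with the second edge, avoiding z, if [size m] is odd. *)
Lemma barbell_edge x y : [set x; y] \in edge_sets (pairs w) ->
  [\/ x \in D1 /\ y \in D1, exists i, mid_edge x y i |
      x \in D2 /\ y \in D2 /\ (odd (size m) -> x \in l2 /\ y \in l2)].
Proof.
have [_ _ o1 _] := i1; have [_ _ o2 _] := i2.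
have ol1 : ~~ odd (size l1) by move: o1.
have ol2 : ~~ odd (size l2) by move: o2.
rewrite /w /barbell -cat_rcons -cat_cons pairs_cat; last by rewrite /= size_rcons /= negbK.
rewrite edge_sets_cat mem_cat => /orP[/mem_edge_sets2[]|].
  by rewrite !(inE, mem_rcons) !orbA !orbb => xD yD; constructor 1.
have [om|om] := boolP (odd (size m)).
  rewrite -cat_rcons pairs_cat; last by rewrite size_rcons /= om.
  rewrite -rev_rcons pairs_cat // !edge_sets_cat !mem_cat.
  have oP : ~~ odd (size P) by rewrite size_rcons /= om.
  have mid : [set x; y] \in edge_sets (pairs P) -> exists i, mid_edge x y i.
    case/(mem_edge_sets)/(_ v) => i [iP E]; exists i; split=> //.
    by rewrite /N om addn1 -(size_rcons m z).
  case/or3P => [/mid H|/mem_edge_sets2[xl yl]|/(edge_sets_rev oP)/mid H];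
    [by constructor 2| |by constructor 2].
  by constructor 3; rewrite /D2 !inE xl yl !orbT.
rewrite pairs_cat // -cat_rcons -cat_cons pairs_cat; last by rewrite /= size_rcons /= negbK.
rewrite !edge_sets_cat !mem_cat.
have mid : [set x; y] \in edge_sets (pairs m) -> exists i, mid_edge x y i.
  case/(mem_edge_sets)/(_ v) => i [iP E]; exists i; split.
    by rewrite /N (negbTE om) addn0.
  by rewrite E /P !nth_rcons iP (ltnW iP).
case/or3P => [/mid H|/mem_edge_sets2[]|/(edge_sets_rev om)/mid H];
  [by constructor 2| |by constructor 2].
rewrite !(inE, mem_rcons) !orbA !orbb => xD yD; constructor 3; split=> //; split.
Qed.

Definition within x y r := forall a, a \in [set x; y] -> exists2 k, k <= r & reach D1 k a.

Lemma nthP_level k r : k <= size m -> reach D1 r (nth v P k) -> k < r.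
Proof. by move=> km; apply: (@shortest_level _ _ _ _ _ shortvz k.+1). Qed.

Lemma nthP_reach k : k <= size m -> reach D1 k.+1 (nth v P k).
Proof. by move=> km; apply: (@shortest_reach _ _ _ _ _ shortvz k.+1). Qed.

Lemma mid_size i : i.*2.+1 < N -> i.*2.+1 <= size m.
Proof. by rewrite /N; clear; move: (size m) => n; lia. Qed.

Lemma mid_within x y i : mid_edge x y i -> within x y i.*2.+2.
Proof.
move=> [/mid_size iN E] a; rewrite E in_set2 => /orP[]/eqP->.
  by exists i.*2.+1 => //; apply: nthP_reach; apply: ltnW.
by exists i.*2.+2 => //; apply: nthP_reach.
Qed.

(** Distances from D1 change by at most 1 along an edge, and the outer vertex of the
i-th of these path edges has distance 2i + 2. *)
Lemma within_mid x y x' y' r i : within x y r -> mid_edge x' y' i ->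
  adj x x' -> adj y y' -> i.*2.+1 <= r.
Proof.
move=> wxy [/mid_size iN E] exx eyy.
have next a b : a \in [set x; y] -> adj a b -> nth v P i.*2.+1 = b -> i.*2.+1 <= r.
  move=> /wxy[k kr rk] eab Eb; rewrite -ltnS.
  apply: leq_trans (_ : k.+1 <= _) => //; apply: nthP_level => //.
  by rewrite Eb; apply: reachS eab.
case: (eq_set2 E) => -[Ex Ey].
  by apply: (next y y') => //; rewrite set22.
by apply: (next x x') => //; rewrite set21.
Qed.

(** D2 has distance [size m + 1] from D1, so only the last edge of the path qualifies,
when it belongs to the class. *)
Lemma mid_far x y x' y' i : mid_edge x y i -> x' \in D2 -> y' \in D2 ->
  adj x x' -> adj y y' ->
  odd (size m) /\ (adj (last v m) x' \/ adj (last v m) y').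
Proof.
move=> [iN E] xD yD exx eyy; have im := ltnW (mid_size iN).
have ilast : adj (nth v P i.*2) x' \/ adj (nth v P i.*2) y'.
  by case: (eq_set2 E) => -[Ex Ey]; [left; rewrite -Ex|right; rewrite -Ey].
have ri : size m < i.*2.+2.
  have [_ _ _ min] := shortvz; have ri := nthP_reach im.
  by case: ilast => e; [apply: (min _ x')|apply: (min _ y')] => //; apply: reachS ri e.
have [om Em] : odd (size m) /\ i.*2 = (size m).-1.
  by move: iN ri; rewrite /N; clear; move: (size m) => n; case on: (odd n); lia.
split=> //; move: ilast; rewrite Em /P nth_rcons ltn_predL odd_gt0 //.
by rewrite nth_last.
Qed.

(** By distance from D1, the only possible switches involve an edge of each cycle, or
the last path edge and an edge of the second cycle.  The latter requires the
last inner vertex of the path to have two neighbours on the second cycle. *)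
Lemma barbell_bridge :
  (exists x y x' y', [/\ uniq [:: x; y; x'; y'], x \in D1 /\ y \in D1,
      x' \in D2 /\ y' \in D2, adj x x' & adj y y']) \/
  (odd (size m) /\ exists2 b, b \in l2 & adj (last v m) b).
Proof.
have [x [y [x' [y' [u xyw xyw' exx eyy]]]]] := barbell_switch.
have cw := barbell_closed.
have sq D : induced_odd_cycle adj D -> ~ [/\ x \in D, y \in D, x' \in D & y' \in D].
  by move=> iD; apply: induced_odd_cycle_square iD cw u xyw xyw' exx eyy.
have exx' := exx; have eyy' := eyy; rewrite adjC in exx'; rewrite adjC in eyy'.
have within0 a b : a \in D1 -> b \in D1 -> within a b 0.
  by move=> aD bD c; rewrite in_set2 => /orP[]/eqP->; exists 0 => //; apply: reach0.
case: (barbell_edge xyw) (barbell_edge xyw') => [[xD yD]|[i xyi]|[xD [yD lo]]]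
  [[xD' yD']|[k xyk]|[xD' [yD' lo']]].
- by case: (sq _ i1).
- by have := within_mid (within0 _ _ xD yD) xyk exx eyy.
- by left; exists x, y, x', y'.
- by have := within_mid (within0 _ _ xD' yD') xyi exx' eyy'.
- have := within_mid (mid_within xyi) xyk exx eyy.
  have := within_mid (mid_within xyk) xyi exx' eyy'.
  move=> ki ik; have ik' : i = k by clear -ki ik; lia.
  case: xyi xyk => _ E [_ E']; have := set21 x y; rewrite E ik' -E' in_set2.
  by move: u; rewrite /= !inE => /andP[]; rewrite !negb_or => /and3P[_ /negPf-> /negPf->].
- right; have [om H] := mid_far xyi xD' yD' exx eyy; split=> //.
  by have [xl yl] := lo' om; case: H; [exists x'|exists y'].
- left; exists x', y', x, y; split=> //.
  by rewrite -(rot_uniq 2) in u.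
- right; have [om H] := mid_far xyk xD yD exx' eyy'; split=> //.
  by have [xl yl] := lo om; case: H; [exists x|exists y].
by case: (sq _ i2).
Qed.

End Barbell.

Lemma eq_shortest D1 D2 E1 E2 v m z : E1 =i D1 -> E2 =i D2 ->
  shortest D1 D2 v m z -> shortest E1 E2 v m z.
Proof.
move=> e1 e2 [vD zD pv min]; split; rewrite ?e1 ?e2 // => k y.
rewrite e2 => yD [x [s [xE ps ls ss]]]; apply: (min k y yD).
by exists x, s; rewrite -e1.
Qed.

Lemma exists_shortest D1 D2 a b : a \in D1 -> b \in D2 -> connect adj a b ->
  (forall c, c \in D1 -> c \in D2 -> False) ->
  exists v m z, shortest D1 D2 v m z.
Proof.
move=> aD bD /connectP[s ps Eb] dis.
pose near k := `[< exists2 y, y \in D2 & reach D1 k y >].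
have ex : exists k, near k.
  by exists (size s); apply/asboolP; exists b => //; exists a, s.
case: (ex_minnP ex) => k /asboolP[z zD [v [t [vD pt lt st]]]] min.
case/lastP: t pt lt st => [_ /= vz _|m z' pm].
  by case: (dis v) => //; rewrite vz.
rewrite last_rcons size_rcons => zz' st; exists v, m, z; split=> //.
  by rewrite -zz'.
by move=> k' y yD ry; rewrite st; apply: min; apply/asboolP; exists y.
Qed.

Lemma shortest_bridge D1 D2 v m z :
    induced_odd_cycle adj D1 -> induced_odd_cycle adj D2 ->
    shortest D1 D2 v m z ->
  (exists x y x' y', [/\ uniq [:: x; y; x'; y'], x \in D1 /\ y \in D1,
      x' \in D2 /\ y' \in D2, adj x x' & adj y y']) \/
  (odd (size m) /\ exists b, [/\ b \in D2, b != z & adj (last v m) b]).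
Proof.
move=> i1 i2 short; have [vD zD _ _] := short.
have [l1 [j1 E1 _ _]] := @induced_odd_cycle_rot_to _ G _ (in_tuple D1) v i1 vD.
have [l2 [j2 E2 _ _]] := @induced_odd_cycle_rot_to _ G _ (in_tuple D2) z i2 zD.
have short' := eq_shortest E1 E2 short.
case: (barbell_bridge j1 j2 short') => [[x [y [x' [y' [u xyD xyD' exx eyy]]]]]|].
  by left; exists x, y, x', y'; move: xyD xyD'; rewrite !E1 !E2.
case=> om [b bl eb]; right; split=> //; exists b; split=> //.
  by rewrite -E2 inE bl orbT.
by have [_ /andP[zl _] _ _] := j2; apply: contraNneq zl => <-.
Qed.

(** For a shortest path of odd length [shortest_bridge] gives two bridges.  If the length
is even, the last inner vertex u has two neighbours on C2, and an induced odd
cycle D2 through u inside C2 and u is nearer to C1 by 1.  The distance is then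
odd: it cannot exceed 1, as there is a bridge between C1 and D2.  So u is also
adjacent to C1, and by symmetry it lies on an induced odd cycle inside C1 and u;
then u separates two odd cycles, contrary to (Q-ii). *)
Lemma switchable_Qiii : condition_Qiii G.
Proof.
move=> q1 C1 q2 C2 ic1 o1 ic2 o2 con dis.
have i1 : induced_odd_cycle adj C1 by apply/induced_odd_cycleP.
have i2 : induced_odd_cycle adj C2 by apply/induced_odd_cycleP.
have {}dis c : c \in C1 -> c \in C2 -> False.
  move=> c1 c2; have := disjointFr dis (x := c); rewrite !inE c1 c2.
  by move=> /(_ isT).
have [v [m [z short]]] : exists v m z, shortest C1 C2 v m z.
  have [cC1 _ oC1 _] := i1; have [cC2 _ oC2 _] := i2.
  have := odd_closed_size (@adj_irr _ G) cC1 oC1.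
  have := odd_closed_size (@adj_irr _ G) cC2 oC2.
  have hdC (C : seq 'I_d) : 2 < size C -> exists a, a \in C.
    by case: C => // a C _; exists a; apply: mem_head.
  move=> /hdC[b bC] /hdC[a aC].
  by apply: (exists_shortest aC bC) => //; apply: con; rewrite inE.
have [vD zD pv min] := short.
case: (shortest_bridge i1 i2 short) => [[x [y [x' [y' [u [xD yD] [xD' yD'] exx eyy]]]]]|].
  apply/card_gt1P; exists [set x; x'], [set y; y']; split.
  - by apply/bridgesP; exists x, x'.
  - by apply/bridgesP; exists y, y'.
  move: u; rewrite /= !inE !negb_or andbT => /and3P[/and3P[xy xx xy'] _ _].
  by apply/eqP => /eq_set2[] [E _]; [rewrite E eqxx in xy|rewrite E eqxx in xy'].
case=> om [b [bD bz eb]]; exfalso.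
case/lastP: m om eb short pv min => // m u; rewrite size_rcons last_rcons /= => om eb short pv min.
have um : u = nth v (rcons m u) (size m) by rewrite nth_rcons ltnn eqxx.
have ms : size m < size (rcons m u) by rewrite size_rcons.
have ru : reach C1 (size m).+1 u.
  by have := shortest_reach_mid short ms; rewrite -um.
have lu k : reach C1 k u -> size m < k.
  by have := @shortest_level_mid _ _ _ _ _ short _ k ms; rewrite -um.
have uD2 : u \notin C2 by apply/negP => uD; have := min _ _ uD ru; rewrite ltnn.
have uD1 : u \notin C1 by apply/negP => /reach0/lu.
have euz : adj u z by move: pv; rewrite rcons_path last_rcons => /andP[].
have [D2 [j2 uD sD]] :=
  induced_odd_cycle_through (@adjC _ G) i2 uD2 bD zD bz eb euz.
(* If m is empty, u is adjacent to both cycles; otherwise D2 is still at distance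
   at least 3 from C1. *)
have [m0|m0] := posnP (size m).
  move/size0nil: m0 => m0; move: short pv min; rewrite m0 /= andbT => short /andP[evu _] min.
  have far x y : x \in C1 -> y \in C2 -> adj x y -> False.
    move=> xD yD exy; suff : 1 < 1 by rewrite ltnn.
    by apply: (min 1 y yD); exists x, [:: y]; rewrite /= exy.
  have short' : shortest C2 C1 z [:: u] v.
    split=> //; first by rewrite /= andbT adjC euz adjC.
    move=> [|[|k]] y yD // [x [s [xD]]].
      by case: s => //= _ xy _; case: (dis x) => //; rewrite xy.
    case: s => [|x' [|? ?]] //=; rewrite andbT => exx Ey _.
    by case: (far y x) => //; rewrite adjC -Ey.
  case: (shortest_bridge i2 i1 short').
    case=> x [y [x' [y' [_ [xD _] [xD' _] exx _]]]].
    by apply: (far x' x) => //; rewrite adjC.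
  case=> _ [b' [bD' bv /= eub']].
  rewrite adjC in evu.
  have [D1 [j1 uD' sD']] :=
    induced_odd_cycle_through (@adjC _ G) i1 uD1 bD' vD bv eub' evu.
  apply: (no_cut_shared (switchable_Qii sw) j1 j2 uD' uD).
  move=> x y /sD' + /sD; rewrite !inE => /orP[->//|xD] /orP[->//|yD] _ _; split.
    by apply/eqP => xy; apply: (dis x) => //; rewrite xy.
  by apply/negP => /(far _ _ xD yD).
have short' : shortest C1 D2 v m u.
  split=> //; first by move: pv; rewrite rcons_path => /andP[].
  move=> k y /sD; rewrite inE => /orP[/eqP->|yD] ry; first exact: lu.
  by apply: ltnW; apply: min ry.
case: (shortest_bridge i1 j2 short') => [|[om' _]]; last by rewrite om' in om.
case=> x [y [x' [y' [_ [xD _] [xD' _] exx _]]]].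
have [_ _ _ min'] := short'.
suff : size m < 1 by rewrite ltnNge m0.
by apply: (min' 1 x' xD'); exists x, [:: x']; rewrite /= exx.
Qed.

Lemma switchable_condition_Q : condition_Q G.
Proof.
by split; [apply: switchable_Qi | apply: switchable_Qii | apply: switchable_Qiii].
Qed.

End SwitchableQiii.

(** * Ideals and toric ideals *)

Local Open Scope ring_scope.

Section Ideals.
Variables (K : fieldType) (n : nat).
Implicit Types (S I : set {mpoly K[n]}) (f g : {mpoly K[n]}) (m : 'X_{1..n}).

Lemma ideal_generated0 S : ideal_generated S 0.
Proof. by exists 0%N, (fun=> 0), (fun=> 0); split=> [[]|] //; rewrite big_ord0. Qed.

Lemma ideal_generatedM S h f : S f -> ideal_generated S (h * f).
Proof.
by move=> Sf; exists 1%N, (fun=> f), (fun=> h); rewrite big_ord_recl big_ord0 addr0.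
Qed.

Lemma ideal_generatedD S f g :
  ideal_generated S f -> ideal_generated S g -> ideal_generated S (f + g).
Proof.
move=> [k [u [h [Su ->]]]] [k' [u' [h' [Su' ->]]]].
pose glue T (x : 'I_k -> T) (x' : 'I_k' -> T) (i : 'I_(k + k')) :=
  match fintype.split i with inl j => x j | inr j => x' j end.
exists (k + k')%N, (glue _ u u'), (glue _ h h'); split.
  by move=> i; rewrite /glue; case: fintype.split.
rewrite big_split_ord /=; congr (_ + _); apply: eq_bigr => i _; rewrite /glue.
  by have := unsplitK (inl i : 'I_k + 'I_k'); rewrite /= => ->.
by have := unsplitK (inr i : 'I_k + 'I_k'); rewrite /= => ->.
Qed.

Lemma ideal_generated_mul S h f : ideal_generated S f -> ideal_generated S (h * f).
Proof.
move=> [k [u [h' [Su ->]]]]; exists k, u, (fun i => h * h' i); split=> //.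
by rewrite mulr_sumr; apply: eq_bigr => i _; rewrite mulrA.
Qed.

Lemma msupp_binomial m m' : m != m' ->
  msupp ('X_[m] - 'X_[m'] : {mpoly K[n]}) =i [:: m; m'].
Proof.
move=> mm k; rewrite mcoeff_msupp mcoeffB !mcoeffX !inE !(eq_sym k).
have [<-|mk] := eqVneq m k; first by rewrite [m' == m]eq_sym (negbTE mm) subr0 oner_eq0.
by case: (eqVneq m' k) => _; rewrite ?mulr1n ?mulr0n ?sub0r ?subr0 ?oppr_eq0 ?oner_eq0 ?eqxx.
Qed.

(** A monomial of a combination of generators is a multiple of a monomial of one of
them. *)
Lemma monomial_divisor S f m : ideal_generated S f -> m \in msupp f ->
  exists b p, [/\ S b, p \in msupp b & (p <= m)%MM].
Proof.
case=> k [g [h [Sg ->]]] /msupp_sum_le/flatten_mapP[i _] /msuppM_le.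
case/allpairsP=> -[m1 m2] /= [_ m2g ->]; exists (g i), m2; split=> //.
exact: lem_addl.
Qed.

End Ideals.

Section ToricIdeal.
Variables (K : fieldType) (n d : nat) (a : 'I_n -> 'rV[int]_d).
Hypothesis a_ge0 : forall i j, 0 <= a i 0 j.
Implicit Types (m : 'X_{1..n}) (p : {mpoly K[n]}).
Local Notation I := (toric_ideal K a).

Definition multidegree m : 'X_{1..d} := [multinom (\sum_i m i * `|a i 0%R j|)%N | j < d].

Definition fibre m := (mdeg m, multidegree m).

Lemma multidegreeD m m' : multidegree (m + m')%MM = (multidegree m + multidegree m')%MM.
Proof.
apply/mnmP => j; rewrite mnmDE !mnmE -big_split; apply: eq_bigr => i _.
by rewrite mnmDE mulnDl.
Qed.

Lemma fibre_add2l m m1 m2 : (fibre (m + m1)%MM == fibre (m + m2)%MM) = (fibre m1 == fibre m2).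
Proof.
rewrite /fibre !mdegD !multidegreeD !xpair_eqE eqn_add2l; congr (_ && _).
by apply/eqP/eqP => [/addmI|->].
Qed.

Let coef_morph : {rmorphism K -> {poly {fraction {mpoly K[d]}}}} :=
  polyC \o @tofrac {mpoly K[d]} \o (@mpolyC d K).

Let toric_morph : {rmorphism {mpoly K[n]} -> {poly {fraction {mpoly K[d]}}}} :=
  mmap coef_morph (fun i => (laurent_monomial K (a i))%:P * 'X).

Lemma toric_mapE p : toric_map a p = toric_morph p.
Proof. by []. Qed.

Lemma laurent_monomialE i : laurent_monomial K (a i) =
  tofrac (\prod_j 'X_j ^+ `|a i 0 j|) :> {fraction {mpoly K[d]}}.
Proof.
rewrite /laurent_monomial rmorph_prod; apply: eq_bigr => j _.
by rewrite -{1}(gez0_abs (a_ge0 i j)) -exprnP rmorphXn.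
Qed.

Lemma prod_multidegree m :
  \prod_i (\prod_j 'X_j ^+ `|a i 0%R j|) ^+ m i =
  'X_[multidegree m] :> {mpoly K[d]}.
Proof.
rewrite mpolyXE_id; under eq_bigr do rewrite -prodrXl.
rewrite exchange_big; apply: eq_bigr => j _; rewrite mnmE.
by under eq_bigr do rewrite -exprM mulnC; rewrite prodrXr.
Qed.

Lemma toric_map_monomial m : toric_morph 'X_[m] =
  (tofrac 'X_[multidegree m])%:P * 'X^(mdeg m).
Proof.
rewrite /toric_morph /= mmapX /mmap1.
under eq_bigr do rewrite exprMn -rmorphXn laurent_monomialE -rmorphXn.
by rewrite big_split /= prodrXr -mdegE -rmorph_prod -rmorph_prod prod_multidegree.
Qed.

Lemma polyC_morphM (A B : comNzRingType) (f : {rmorphism A -> B}) x y k :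
  (f x)%:P * ((f y)%:P * 'X^k) = (f (x * y))%:P * 'X^k.
Proof. by rewrite mulrA -polyCM rmorphM. Qed.

Lemma toric_map_term c m : toric_morph (c *: 'X_[m]) =
  (tofrac (c *: 'X_[multidegree m]))%:P * 'X^(mdeg m).
Proof.
have -> : toric_morph (c *: 'X_[m]) = coef_morph c * toric_morph 'X_[m].
  exact: mmapZ.
have -> : coef_morph c = (tofrac c%:MP)%:P by [].
rewrite toric_map_monomial -mul_mpolyC; exact: polyC_morphM.
Qed.

Lemma toric_binomial m m' : I ('X_[m] - 'X_[m']) <-> fibre m = fibre m'.
Proof.
rewrite /toric_ideal /= toric_mapE rmorphB /= !toric_map_monomial /fibre.
split=> [/eqP|/eqP]; last by rewrite xpair_eqE => /andP[/eqP-> /eqP->]; rewrite subrr.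
rewrite subr_eq0 => /eqP E.
have X0 k : tofrac 'X_[k] != 0 :> {fraction {mpoly K[d]}}.
  by rewrite tofrac_eq0 -msupp_eq0 msuppX.
have := congr1 (fun q : {poly _} => q`_(mdeg m)) E; rewrite !coefCM !coefXn eqxx mulr1.
case: eqVneq => [Em|_]; last by rewrite mulr0 => /eqP; rewrite (negbTE (X0 _)).
rewrite mulr1 => /eqP; rewrite tofrac_eq => /eqP/(congr1 (@msupp _ _)).
rewrite !msuppX => /eqP; rewrite eqseq_cons andbT => /eqP Eb.
by rewrite -Em Eb.
Qed.

Lemma ideal_generated_toric S f :
  (forall g, S g -> I g) -> ideal_generated S f -> I f.
Proof.
move=> SI [k [g [h [Sg ->]]]]; rewrite /toric_ideal /= toric_mapE rmorph_sum big1 // => i _.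
by rewrite rmorphM; have := SI _ (Sg i); rewrite /toric_ideal /= toric_mapE => ->; rewrite mulr0.
Qed.

(** The coefficient of the image of p at the image of m is the sum of the coefficients
of p over the fibre of m.  It vanishes, so m is not the only monomial of p in its
fibre. *)
Lemma toric_ideal_partner p m : I p -> m \in msupp p ->
  exists2 m', m' \in msupp p & m' != m /\ fibre m' = fibre m.
Proof.
rewrite /toric_ideal /= toric_mapE => p0 mp; apply: contrapT => alone.
have {}alone m' : m' \in msupp p -> m' != m -> fibre m' != fibre m.
  by move=> m'p mm'; apply/eqP => E; apply: alone; exists m'.
pose Q : {mpoly K[d]} :=
  \sum_(m' <- msupp p | mdeg m' == mdeg m) p@_m' *: 'X_[multidegree m'].
have Q0 : Q = 0.
  apply/eqP; rewrite -tofrac_eq0 rmorph_sum.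
  have /(congr1 (fun q : {poly _} => q`_(mdeg m))) := p0.
  rewrite {1}[p]mpolyE rmorph_sum coef_sum coef0 => E; rewrite -[X in _ == X]E.
  apply/eqP; rewrite big_mkcond; apply: eq_bigr => m' _.
  rewrite toric_map_term coefCM coefXn eq_sym.
  by case: eqP => _; rewrite ?mulr1 ?mulr0.
have : Q@_(multidegree m) = p@_m.
  rewrite /Q raddf_sum /= big_mkcond (bigD1_seq m) ?msupp_uniq //= eqxx.
  rewrite mcoeffZ mcoeffX eqxx mulr1 big_seq_cond big1 ?addr0 // => m' /andP[m'p mm'].
  case: eqP => // dm'; rewrite mcoeffZ mcoeffX; case: eqP => [E|]; last by rewrite mulr0.
  by have := alone m' m'p mm'; rewrite /fibre dm' E eqxx.
by rewrite Q0 mcoeff0 => pm0; move: mp; rewrite mcoeff_msupp -pm0 eqxx.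
Qed.

(** An ideal that contains all binomials of the toric ideal contains it: subtract
multiples of binomials, using [toric_ideal_partner], to remove the monomials of p
one by one. *)
Lemma toric_ideal_sub (J : set {mpoly K[n]}) :
    J 0 -> (forall f g, J f -> J g -> J (f + g)) -> (forall f h, J f -> J (h * f)) ->
    (forall m m', m != m' -> fibre m = fibre m' -> J ('X_[m] - 'X_[m'])) ->
  forall p, I p -> J p.
Proof.
move=> J0 JD JM Jbin p; have [k] := ubnP (size (msupp p)).
elim: k p => // k IHk p pk Ip.
have [p0|pn0] := eqVneq p 0; first by rewrite p0.
have [m mp] : exists m, m \in msupp p.
  move: pn0; rewrite -msupp_eq0; case: (msupp p) => // m s _.
  by exists m; rewrite mem_head.
have [m' m'p [mm' E]] := toric_ideal_partner Ip mp.
pose b : {mpoly K[n]} := p@_m *: ('X_[m] - 'X_[m']).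
have Ib : I b.
  apply: (@ideal_generated_toric [set 'X_[m] - 'X_[m']]%classic).
    by move=> _ ->; apply/toric_binomial.
  by rewrite /b -mul_mpolyC; apply: ideal_generatedM.
rewrite -(subrK b p); apply: JD; last first.
  by rewrite /b -mul_mpolyC; apply/JM/Jbin; rewrite 1?eq_sym.
apply: IHk.
  apply: leq_trans (_ : (size (msupp (p - b)) < size (msupp p))%N) _; last by rewrite -ltnS.
  apply: (@leq_trans (size (rem m (msupp p))).+1); last first.
    by rewrite size_rem // prednK //; case: (msupp p) mp.
  rewrite ltnS; apply: uniq_leq_size; first exact: msupp_uniq.
  move=> k'; rewrite rem_filter ?msupp_uniq // mem_filter /= !mcoeff_msupp.
  rewrite mcoeffB mcoeffZ mcoeffB !mcoeffX.
  have [<-|mk] := eqVneq m k'; first by rewrite (negbTE mm') subr0 mulr1 subrr eqxx.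
  case: (eqVneq m' k') => [<- _|_]; first by rewrite -mcoeff_msupp.
  by rewrite subr0 mulr0 subr0.
rewrite /toric_ideal /= toric_mapE rmorphB /=.
by move: Ip Ib; rewrite /toric_ideal /= !toric_mapE => -> ->; rewrite subr0.
Qed.

End ToricIdeal.

(** * Indispensable monomials *)

Section Indispensable.
Variables (K : fieldType) (n d : nat) (a : 'I_n -> 'rV[int]_d).
Hypothesis a_ge0 : forall i j, 0 <= a i 0 j.
Implicit Types (m p q : 'X_{1..n}).
Local Notation I := (toric_ideal K a).
Local Notation fibre := (fibre a).

Definition movable m := exists2 m', m' != m & fibre m' = fibre m.

Lemma eq_divisor p m : (p <= m)%MM -> mdeg p = mdeg m -> p = m.
Proof.
move=> /submK Em dE; move: (dE); rewrite -Em mdegD -{1}[mdeg p]add0n => /eqP.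
by rewrite eqn_add2r eq_sym mdeg_eq0 => /eqP ->; rewrite add0m.
Qed.

Lemma binomial_generators_movable S b p : binomial_generators I S -> S b ->
  p \in msupp b -> movable p.
Proof.
move=> [Sbin SI] Sb pb; have [m [m' [mm Eb]]] := Sbin _ Sb.
have /(toric_binomial K a_ge0) E : I ('X_[m] - 'X_[m']).
  by rewrite -Eb -SI -[b]mul1r; apply: ideal_generatedM.
move: pb; rewrite Eb (msupp_binomial _ mm) !inE => /orP[]/eqP->.
  by exists m'; rewrite // eq_sym.
by exists m.
Qed.

(** The binomial of m and of another monomial of its fibre is a combination of the
generators. *)
Lemma binomial_generators_divisor S m : binomial_generators I S -> movable m ->
  exists b p, [/\ S b, p \in msupp b, (p <= m)%MM & movable p].
Proof.
move=> gS [m' mm E]; have mm' : m != m' by rewrite eq_sym.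
have Imm : ideal_generated S ('X_[m] - 'X_[m']).
  by have [_ ->] := gS; apply/(toric_binomial K a_ge0).
have [|b [p [Sb pb pm]]] := @monomial_divisor _ _ _ _ m Imm.
  by rewrite (msupp_binomial _ mm') mem_head.
by exists b, p; split=> //; apply: (binomial_generators_movable gS Sb pb).
Qed.

Lemma quadratic_divisor m : is_quadratic I -> movable m ->
  exists p, [/\ mdeg p = 2, (p <= m)%MM & movable p].
Proof.
move=> [S [gS S2]] /(binomial_generators_divisor gS)[b [p [Sb pb pm mp]]].
by exists p; split=> //; apply: (dhomog_mf (S2 _ Sb)).
Qed.

Lemma toric_generators S :
    (forall b, S b -> I b) -> (forall b, S b -> is_binomial b) ->
    (forall m m', m != m' -> fibre m = fibre m' ->
       ideal_generated S ('X_[m] - 'X_[m'])) ->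
  binomial_generators I S.
Proof.
move=> SI Sbin gen; split=> //; apply/seteqP; split=> f.
  exact: ideal_generated_toric.
move: f; apply: (@toric_ideal_sub K n d a a_ge0 (ideal_generated S)) => //.
- exact: ideal_generated0.
- exact: ideal_generatedD.
- by move=> f h; apply: ideal_generated_mul.
Qed.

(** If a proper divisor p of m is movable to q, then m is linked, via m - p + q, to its
fibre by binomials that do not involve m; hence the binomials without m generate
the ideal.  Conversely, every generating system must contain a binomial one of
whose monomials divides m and is movable. *)
Lemma indispensableP m :
  indispensable I m <-> movable m /\ forall p, (p <= m)%MM -> movable p -> p = m.
Proof.
split=> [ind|[mm min] S gS]; last first.
  have [b [p [Sb pb pm mp]]] := binomial_generators_divisor gS mm.
  by exists b; rewrite // -(min p pm mp).
have mm : movable m.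
  pose S : set {mpoly K[n]} := [set b | is_binomial b /\ I b]%classic.
  have gS : binomial_generators I S.
    apply: toric_generators => [b []|b []|m1 m2 m12 E] //.
    rewrite -['X_[m1] - _]mul1r; apply: ideal_generatedM; split.
      by exists m1, m2.
    exact/toric_binomial.
  have [b Sb mb] := ind _ gS; exact: (binomial_generators_movable gS Sb mb).
split=> // p pm [q qp E]; apply: contrapT => pnm.
have qm : q != m.
  by apply/eqP => qm; apply: pnm; apply: eq_divisor pm _; rewrite -qm; case: E.
pose S : set {mpoly K[n]} := [set b | [/\ is_binomial b, I b & m \notin msupp b]]%classic.
have gS0 m1 m2 : m1 != m -> m2 != m -> fibre m1 = fibre m2 ->
    ideal_generated S ('X_[m1] - 'X_[m2]).
  move=> n1 n2 E12; have [->|m12] := eqVneq m1 m2.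
    by rewrite subrr; apply: ideal_generated0.
  rewrite -['X_[m1] - _]mul1r; apply: ideal_generatedM; split.
  - by exists m1, m2.
  - exact/toric_binomial.
  - by rewrite (msupp_binomial _ m12) !inE negb_or ![m == _]eq_sym n1.
have gSm m2 : m2 != m -> fibre m = fibre m2 -> ideal_generated S ('X_[m] - 'X_[m2]).
  move=> n2 E2; pose p' := (m - p + q)%MM; have Em := submK pm.
  have -> : 'X_[m] - 'X_[m2] = 'X_[m - p] * ('X_[p] - 'X_[q]) + ('X_[p'] - 'X_[m2]) :> {mpoly K[n]}.
    by rewrite mulrBr -!mpolyXD Em addrA subrK.
  apply: ideal_generatedD; first apply: ideal_generated_mul.
    by apply: gS0 => //; apply/eqP.
  apply: gS0 => //.
    by rewrite -[m in _ != m]Em; apply: contraNneq qp => /addmI ->.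
  rewrite -E2 -[in RHS]Em; apply/eqP.
  by rewrite fibre_add2l E.
have gS : binomial_generators I S.
  apply: toric_generators => [b []|b []|m1 m2 m12 E12] //.
  have [n1|n1] := eqVneq m1 m; last first.
    have [n2|n2] := eqVneq m2 m; last exact: gS0.
    rewrite -opprB -mulN1r; apply: ideal_generated_mul.
    by rewrite n2 in E12 *; apply: gSm.
  by rewrite n1 in m12 E12 *; apply: gSm; rewrite // eq_sym.
by have [b [_ _ /negP]] := ind _ gS.
Qed.

Lemma movable_descent m :
    (forall m', (3 <= mdeg m')%N -> ~ indispensable I m') -> movable m ->
  exists p, [/\ (mdeg p <= 2)%N, (p <= m)%MM & movable p].
Proof.
move=> noind; have [k] := ubnP (mdeg m); elim: k m => // k IHk m mk mm.
have [|nind] := pselect (forall p, (p <= m)%MM -> movable p -> p = m).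
  move=> min; exists m; split=> //; last exact: lepm_refl.
  by rewrite leqNgt; apply/negP => /noind; apply; apply/indispensableP.
have [p [pm mp pnm]] : exists p, [/\ (p <= m)%MM, movable p & p <> m].
  apply: contrapT => nex; apply: nind => p pm mp; apply: contrapT => pnm.
  by apply: nex; exists p.
have pd : (mdeg p < mdeg m)%N.
  rewrite ltn_neqAle; apply/andP; split; first by apply/eqP => /(eq_divisor pm).
  by rewrite -(submK pm) mdegD leq_addl.
have [|q [q2 qp mq]] := IHk p _ mp; first exact: leq_trans pd mk.
by exists q; split=> //; apply: lepm_trans qp pm.
Qed.

End Indispensable.

(** * Monomials as lists of edges *)

Section EdgeMonomials.
Variables (K : fieldType) (n d : nat) (G : graph d) (a : 'I_n -> 'rV[int]_d).
Local Notation adj := (adjacent G).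
Implicit Types (m : 'X_{1..n}) (p q : seq ('I_d * 'I_d)) (x y z t : 'I_d).

Definition edge_vector (S : nzRingType) x y : 'rV[S]_d := delta_mx 0 x + delta_mx 0 y.

Lemma edge_vectorE (S : nzRingType) x y j :
  edge_vector S x y 0 j = ((x == j) + (y == j))%:R.
Proof. by rewrite !mxE eqxx /= natrD ![_ == j]eq_sym. Qed.

Lemma edge_vectorC (S : nzRingType) x y : edge_vector S x y = edge_vector S y x.
Proof. exact: addrC. Qed.

Definition edge_labelling := [/\ injective a,
  forall i, exists x y, adj x y /\ a i = edge_vector int x y &
  forall x y, adj x y -> exists i, a i = edge_vector int x y].

Hypothesis lab : edge_labelling.

Lemma edge_vector_eq x y x' y' : x != y -> x' != y' ->
  edge_vector int x y = edge_vector int x' y' -> [set x; y] = [set x'; y'].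
Proof.
move=> xy xy' E; apply/setP => j; move/rowP/(_ j): E.
have E u v : u != v -> ((u == j) + (v == j))%N = (j \in [set u; v]).
  move=> uv; rewrite in_set2 ![j == _]eq_sym.
  by have [uj|_] := eqVneq u j; [rewrite -uj eq_sym (negbTE uv)|].
rewrite !edge_vectorE !E // => /eqP; rewrite eqr_nat.
by case: (_ \in _); case: (_ \in _).
Qed.

Lemma adj_neq x y : adj x y -> x != y.
Proof. by apply: contraTneq => ->; rewrite adj_irr. Qed.

Lemma edge_vector_set x y x' y' : [set x; y] = [set x'; y'] ->
  edge_vector int x y = edge_vector int x' y'.
Proof. by case/eq_set2 => -[-> ->] //; rewrite edge_vectorC. Qed.

Lemma labelling_ge0 i j : 0 <= a i 0 j.
Proof. by have [_ /(_ i)[x [y [_ ->]]] _] := lab; rewrite edge_vectorE ler0n. Qed.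

(** The monomial of a list of edges; a pair that is not an edge of G contributes 1. *)
Definition monomial p : 'X_{1..n} :=
  [multinom count (fun u => a i == edge_vector int u.1 u.2) p | i < n].

Lemma monomial_cat p q : monomial (p ++ q) = (monomial p + monomial q)%MM.
Proof. by apply/mnmP => i; rewrite mnmDE !mnmE count_cat. Qed.

Lemma monomial_perm p q : perm_eq p q -> monomial p = monomial q.
Proof. by move=> /permP pq; apply/mnmP => i; rewrite !mnmE pq. Qed.

Lemma monomial_flip x y p : monomial ((x, y) :: p) = monomial ((y, x) :: p).
Proof. by apply/mnmP => i; rewrite !mnmE /= edge_vectorC. Qed.

Lemma monomial1 x y i : a i = edge_vector int x y -> monomial [:: (x, y)] = U_(i)%MM.
Proof.
have [inj _ _] := lab; move=> Ei; apply/mnmP => k.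
by rewrite !mnmE /= addn0 -Ei (inj_eq inj) eq_sym.
Qed.

Lemma monomial_fibre p : edge_pairs adj p ->
  mdeg (monomial p) = size p /\
  forall j, multidegree a (monomial p) j = count_mem j (ends p).
Proof.
elim: p => [_|[x y] p IHp /andP[/= exy /IHp[sp mp]]].
  have -> : monomial [::] = 0%MM by apply/mnmP => i; rewrite !mnmE.
  rewrite mdeg0; split=> // j; rewrite mnmE big1 // => i _.
  by rewrite mnm0E.
have [_ _ onto] := lab; have [i Ei] := onto x y exy.
rewrite -cat1s monomial_cat (monomial1 Ei) mdegD mdeg1 sp; split=> // j.
rewrite multidegreeD mnmDE mp mnmE (bigD1 i) //= big1 => [|k ki]; last first.
  by rewrite mnm1E eq_sym (negbTE ki) mul0n.
rewrite mnm1E eqxx mul1n addn0 Ei edge_vectorE natz absz_nat -!addnA.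
by rewrite ![_ == j]eq_sym.
Qed.

Lemma monomial_onto m : exists p, edge_pairs adj p /\ monomial p = m.
Proof.
have [k] := ubnP (mdeg m); elim: k m => // k IHk m mk.
have [m0|] := posnP (mdeg m).
  exists [::]; split=> //; move/eqP: m0; rewrite mdeg_eq0 => /eqP ->.
  by apply/mnmP => i; rewrite !mnmE.
rewrite mdegE => m0; have [i mi] : exists i, (0 < m i)%N.
  apply: contrapT => nex; move: m0; rewrite big1 // => i _; apply/eqP.
  by rewrite -leqn0 leqNgt; apply/negP => mi; apply: nex; exists i.
have Um : (U_(i) <= m)%MM by rewrite lep1mP -lt0n.
have [p [vp Ep]] : exists p, edge_pairs adj p /\ monomial p = (m - U_(i))%MM.
  by apply: IHk; move: mk; rewrite -{1}(submK Um) mdegD mdeg1 addn1.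
have [_ /(_ i)[x [y [exy Ei]]] _] := lab.
exists ((x, y) :: p); rewrite -cat1s monomial_cat Ep (monomial1 Ei) addmC submK //.
by rewrite /edge_pairs /= exy.
Qed.

Lemma fibre_ends p q : edge_pairs adj p -> edge_pairs adj q ->
  fibre a (monomial p) = fibre a (monomial q) <-> perm_eq (ends p) (ends q).
Proof.
move=> vp vq; have [sp mp] := monomial_fibre vp; have [sq mq] := monomial_fibre vq.
rewrite /fibre sp sq; split=> [/eqP|pq].
  rewrite xpair_eqE => /andP[_ /eqP/mnmP E].
  by apply/allP => x _; rewrite /= -mp -mq E.
have se r : size (ends r) = (size r).*2.
  by elim: r => // u r IHr; rewrite /= doubleS -IHr.
congr (_, _); last by apply/mnmP => j; rewrite mp mq (permP pq).
by apply/double_inj; rewrite -!se (perm_size pq).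
Qed.

Lemma monomial_edge_sets p q : edge_pairs adj p -> edge_pairs adj q ->
  monomial p = monomial q -> perm_eq (edge_sets p) (edge_sets q).
Proof.
move=> /allP vp /allP vq /mnmP E; apply/allP => f; rewrite mem_cat => fpq.
have [x [y [exy ->]]] : exists x y, adj x y /\ f = [set x; y].
  by case/orP: fpq => /mapP[u uX ->]; exists u.1, u.2; split=> //; [apply: vp|apply: vq].
have [_ _ onto] := lab; have [i Ei] := onto x y exy.
have cnt r : {in r, forall u, adj u.1 u.2} ->
    count_mem [set x; y] (edge_sets r) = monomial r i.
  move=> vr; rewrite mnmE count_map; apply: eq_in_count => u /vr eu /=.
  rewrite Ei; apply/eqP/eqP => [/esym/edge_vector_set //|].
  by move/edge_vector_eq => -> //; apply: adj_neq.
by rewrite /= !cnt // E.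
Qed.

Definition quadratic_binomials : set {mpoly K[n]} :=
  [set b | exists m m', [/\ m != m', mdeg m = 2%N, fibre a m = fibre a m' &
                           b = 'X_[m] - 'X_[m']]]%classic.

Lemma switch_equiv_binomial p q : switch_equiv adj p q ->
  ideal_generated quadratic_binomials ('X_[monomial p] - 'X_[monomial q]).
Proof.
elim=> {p q} [p q pq|x y p|x y z t p exy eyz ezt etx|p q _ IH|q p r _ IH1 _ IH2].
- by rewrite (monomial_perm pq) subrr; apply: ideal_generated0.
- by rewrite monomial_flip subrr; apply: ideal_generated0.
- pose s1 := [:: (x, y); (z, t)]; pose s2 := [:: (y, z); (t, x)].
  have v1 : edge_pairs adj s1 by rewrite /edge_pairs /= exy ezt.
  have v2 : edge_pairs adj s2 by rewrite /edge_pairs /= eyz etx.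
  rewrite (monomial_cat s1) (monomial_cat s2) !(addmC _ (monomial p)) !mpolyXD -mulrBr.
  have [->|s12] := eqVneq (monomial s1) (monomial s2).
    by rewrite subrr mulr0; apply: ideal_generated0.
  apply: ideal_generatedM; exists (monomial s1), (monomial s2); split=> //.
    by have [-> _] := monomial_fibre v1.
  apply/fibre_ends => //=.
  by rewrite perm_sym; apply: (permEl (perm_catC [:: y; z; t] [:: x])).
- by rewrite -opprB -mulN1r; apply: ideal_generated_mul.
- by rewrite -(subrK 'X_[monomial q] 'X_[monomial p]) -addrA; apply: ideal_generatedD.
Qed.

Lemma condition_Q_quadratic : condition_Q G -> is_quadratic (toric_ideal K a).
Proof.
move=> [Qi Qii Qiii]; exists quadratic_binomials; split; last first.
  move=> _ [m [m' [mm m2 [E _] ->]]]; apply/dhomogP => k.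
  by rewrite (msupp_binomial _ mm) !inE => /orP[]/eqP->; rewrite /= -?E m2.
apply: toric_generators; first exact: labelling_ge0.
- by move=> _ [m [m' [_ _ E ->]]]; apply/toric_binomial; first exact: labelling_ge0.
- by move=> _ [m [m' [mm _ _ ->]]]; exists m, m'.
move=> m m' _; have [p [vp <-]] := monomial_onto m; have [q [vq <-]] := monomial_onto m'.
move=> /(fibre_ends vp vq) pq; apply: switch_equiv_binomial.
apply: (switch_of_perm_ends (@adjC _ G)) vp vq pq => w cw ow.
apply: (walk_balanced (@adjC _ G) (@adj_irr _ G)) cw ow.
  exact: condition_Q_no_odd_cut_vertex.
exact: condition_Qi_chorded.
Qed.

Lemma perm_eq2 (T : eqType) (b c b' c' : T) : perm_eq [:: b; c] [:: b'; c'] ->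
  b = b' /\ c = c' \/ b = c' /\ c = b'.
Proof.
move=> bc; have : b' \in [:: b; c] by rewrite (perm_mem bc) mem_head.
have single u v : perm_eq [:: u] [:: v] -> u = v :> T.
  by move/perm_mem/(_ u); rewrite !inE eqxx => /esym/eqP.
rewrite !inE => /orP[]/eqP Eb; rewrite Eb in bc *.
  by left; move: bc; rewrite perm_cons => /single.
right; split=> //; apply: single; rewrite -(perm_cons c); apply: perm_trans bc.
exact: (permEl (perm_catC [:: c] [:: b])).
Qed.

Lemma uniq_swap (T : eqType) (b c b' c' : T) :
  uniq [:: b; c; b'; c'] = uniq [:: b; c; c'; b'].
Proof.
by apply: perm_uniq; rewrite !perm_cons; apply: (permEl (perm_catC [:: b'] [:: c'])).
Qed.

Lemma switch_of_two_head x y z t y' z' t' :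
    adj x y -> adj z t -> adj x y' -> adj z' t' ->
    perm_eq [:: x; y; z; t] [:: x; y'; z'; t'] ->
    monomial [:: (x, y); (z, t)] != monomial [:: (x, y'); (z', t')] ->
  uniq [:: x; y; z; t] /\ (adj x z /\ adj y t \/ adj x t /\ adj y z).
Proof.
move=> xy zt xy' zt'; rewrite perm_cons => yzt ne.
have flip2 u b c : monomial [:: u; (b, c)] = monomial [:: u; (c, b)].
  by rewrite (monomial_cat [:: u] [:: (b, c)]) (monomial_cat [:: u] [:: (c, b)]) (monomial_flip b).
have swap u v : monomial [:: u; v] = monomial [:: v; u].
  by apply: monomial_perm; rewrite (perm_catC [:: u] [:: v]).
have key c e : adj x c -> adj c e -> adj x y -> adj y e ->
    monomial [:: (x, y); (c, e)] != monomial [:: (x, c); (y, e)] ->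
    uniq [:: x; y; c; e].
  move=> xc ce _ ye ne'; rewrite /= !inE !negb_or.
  rewrite (adj_neq xy) (adj_neq xc) (adj_neq ce) (adj_neq ye) /= !andbT.
  apply/andP; split.
    by apply: contraNneq ne' => <-; rewrite flip2 swap flip2.
  by apply: contraNneq ne' => <-.
have : y' \in [:: y; z; t] by rewrite (perm_mem yzt) mem_head.
rewrite !inE => /or3P[]/eqP Ey; subst y'.
- move: yzt; rewrite perm_cons => /perm_eq2[] [Ez Et]; case/negP: ne.
    by rewrite Ez Et.
  by rewrite Ez Et flip2.
- have {yzt} /perm_eq2 yzt : perm_eq [:: y; t] [:: z'; t'].
    rewrite -(perm_cons z); apply: perm_trans yzt.
    exact: (permEl (perm_catCA [:: z] [:: y] [:: t])).
  have yt : adj y t by case: yzt => -[-> ->] //; rewrite adjC.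
  split; last by left.
  apply: key => //; apply: contraNneq ne => ->.
  by case: yzt => -[-> ->] //; rewrite flip2.
- have {yzt} /perm_eq2 yzt : perm_eq [:: y; z] [:: z'; t'].
    rewrite -(perm_cons t); apply: perm_trans yzt.
    exact: (permEl (perm_catC [:: t] [:: y; z])).
  have yz : adj y z by case: yzt => -[-> ->] //; rewrite adjC.
  split; last by right.
  have : uniq [:: x; y; t; z].
    apply: key => //; first by rewrite adjC.
    apply: contraNneq ne => E; rewrite flip2 E.
    by case: yzt => -[-> ->] //; rewrite flip2.
  by rewrite uniq_swap.
Qed.

(** Two disjoint edges have the same vertices as two other edges only if the four edges
form a 4-cycle; if the first two are not disjoint, the other two are the same. *)
Lemma switch_of_two x y z t x' y' z' t' :
    adj x y -> adj z t -> adj x' y' -> adj z' t' ->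
    perm_eq [:: x; y; z; t] [:: x'; y'; z'; t'] ->
    monomial [:: (x, y); (z, t)] != monomial [:: (x', y'); (z', t')] ->
  uniq [:: x; y; z; t] /\ (adj x z /\ adj y t \/ adj x t /\ adj y z).
Proof.
move=> xy zt xy' zt' xyzt ne.
have swap u v : monomial [:: u; v] = monomial [:: v; u].
  by apply: monomial_perm; rewrite (perm_catC [:: u] [:: v]).
have : x \in [:: x'; y'; z'; t'] by rewrite -(perm_mem xyzt) mem_head.
rewrite !inE => /or4P[]/eqP Ex; subst x.
- exact: (@switch_of_two_head x' y z t y' z' t').
- apply: (@switch_of_two_head y' y z t x' z' t') => //; first by rewrite adjC.
    by apply: perm_trans xyzt _; apply: (permEl (perm_catCA [:: x'] [:: y'] _)).
  by rewrite (monomial_flip y' x').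
- apply: (@switch_of_two_head z' y z t t' x' y') => //.
    by apply: perm_trans xyzt _; apply: (permEl (perm_catC [:: x'; y'] _)).
  by rewrite [X in _ != X]swap.
- apply: (@switch_of_two_head t' y z t z' x' y') => //; first by rewrite adjC.
    apply: perm_trans xyzt _; apply: (perm_trans (permEl (perm_catC [:: x'; y'] _))).
    exact: (permEl (perm_catCA [:: z'] [:: t'] _)).
  by rewrite (monomial_flip t' z') [X in _ != X]swap.
Qed.

(** Monomials of degree at most 1 are alone in their fibres, so the divisor is a product
of two edges and [switch_of_two] applies. *)
Lemma movable_switchable :
  (forall m, movable a m ->
     exists r, [/\ (mdeg r <= 2)%N, (r <= m)%MM & movable a r]) ->
  switchable G.
Proof.
move=> H p q vp vq pq npq.
have mp : movable a (monomial p).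
  exists (monomial q); last by apply/(fibre_ends vq vp); rewrite perm_sym.
  apply: contra npq => /eqP E; rewrite perm_sym.
  exact: monomial_edge_sets.
have [r [r2 rp [r' rr' Er]]] := H _ mp.
have [s [vs Es]] := monomial_onto r; have [s' [vs' Es']] := monomial_onto r'.
rewrite -Es -Es' in r2 rp rr' Er.
have [ss _] := monomial_fibre vs; have [ss' _] := monomial_fibre vs'.
have sss : size s' = size s by rewrite -ss' -ss; case: Er.
have /(fibre_ends vs' vs) ends' := Er.
have inp u : u \in s -> [set u.1; u.2] \in edge_sets p.
  move=> us; have [_ _ onto] := lab.
  have eu : adj u.1 u.2 by apply: (allP vs).
  have [i Ei] := onto _ _ eu; have /mnm_lepP/(_ i) := rp; rewrite !mnmE Ei => le.
  have : has (fun u' => edge_vector int u.1 u.2 == edge_vector int u'.1 u'.2) p.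
    rewrite has_count; apply: leq_trans le; rewrite -has_count.
    by apply/hasP; exists u.
  case/hasP => u' u'p /eqP /edge_vector_eq E; apply/mapP; exists u' => //.
  by apply: E; apply: adj_neq => //; apply: (allP vp).
rewrite ss in r2.
case: s vs r2 rr' {Es Er rp ss} sss ends' inp => [|[x y] [|[z t] [|? ?]]] //= vs _ rr'.
- by case: s' vs' rr' {Es' ss'} => // _; rewrite eqxx.
- case: s' vs' rr' {Es' ss'} => [|[x' y'] [|? ?]] // /andP[/= exy' _] + _.
  move: vs => /andP[/= exy _] + /perm_eq2 ends' _.
  case/negP; apply/eqP; case: ends' => -[/= -> ->] //; exact: monomial_flip.
case: s' vs' rr' {Es' ss'} => [|[x' y'] [|[z' t'] [|? ?]]] // /and3P[/= exy' ezt' _] ne _.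
rewrite perm_sym => ends' inp; case/and3P: vs => /= exy ezt _.
rewrite eq_sym in ne; have [u H'] := switch_of_two exy ezt exy' ezt' ends' ne.
have xyp := inp (x, y) (mem_head _ _).
have ztp : [set z; t] \in edge_sets p by apply: (inp (z, t)); rewrite !inE eqxx orbT.
case: H' => -[e1 e2]; first by exists x, y, z, t.
rewrite uniq_swap in u; rewrite finset.setUC in ztp.
by exists x, y, t, z.
Qed.

End EdgeMonomials.

(** * Faces of convex hulls and of the edge polytope *)

Section ConvexHulls.
Local Open Scope classical_set_scope.
Variables (R : realType) (d : nat).
Implicit Types (A P F : set 'rV[R]_d) (c x y u : 'rV[R]_d) (b : R).

Definition dot (S : nzRingType) (k : nat) (c x : 'rV[S]_k) : S := \sum_i c 0 i * x 0 i.

Lemma dot_sum (S : nzRingType) (k l : nat) (c : 'rV[S]_k) (t : 'I_l -> S) (p : 'I_l -> 'rV[S]_k) :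
  (forall s r : S, s * r = r * s) ->
  dot c (\sum_i t i *: p i) = \sum_i t i * dot c (p i).
Proof.
move=> com; rewrite /dot; under eq_bigr do rewrite summxE mulr_sumr.
rewrite exchange_big; apply: eq_bigr => i _; rewrite mulr_sumr.
by apply: eq_bigr => j _; rewrite mxE mulrA (com (c 0 j)) mulrA.
Qed.

Lemma sub_convex_hull A x : A x -> convex_hull A x.
Proof.
move=> Ax; exists 1%N, (fun=> x), (fun=> 1); split=> //.
- by rewrite big_ord1.
- by rewrite big_ord1 scale1r.
Qed.

Lemma convex_hull1 x y : convex_hull [set x] y -> y = x.
Proof.
move=> [k [p [t [px _ t1 ->]]]]; under eq_bigr do rewrite (px _ : p _ = x).
by rewrite -scaler_suml t1 scale1r.
Qed.

Lemma convex_hull_le A c b x : (forall y, A y -> dot c y <= b) ->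
  convex_hull A x -> dot c x <= b.
Proof.
move=> Ab [k [p [t [pA t0 t1 ->]]]]; rewrite dot_sum; last exact: mulrC.
rewrite -[b]mul1r -t1 mulr_suml; apply: ler_sum => i _.
by apply: ler_wpM2l => //; apply: Ab.
Qed.

(** A point with maximal value is a combination of generators with maximal value.  The
generators of weight 0 are replaced by one of positive weight. *)
Lemma convex_hull_max A c b x : (forall y, A y -> dot c y <= b) ->
  convex_hull A x -> dot c x = b -> convex_hull [set y | A y /\ dot c y = b] x.
Proof.
move=> Ab [k [p [t [pA t0 t1 Ex]]]] xb.
have tight i : t i != 0 -> dot c (p i) = b.
  move=> ti; apply/eqP; rewrite -subr_eq0 -oppr_eq0 opprB.
  have : \sum_i t i * (b - dot c (p i)) == 0.
    under eq_bigr do rewrite mulrBr.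
    rewrite sumrB -mulr_suml t1 mul1r -dot_sum; last exact: mulrC.
    by rewrite -Ex xb subrr.
  rewrite psumr_eq0 => [/allP/(_ i (mem_index_enum _))|j _].
    by rewrite /= mulf_eq0 (negbTE ti).
  by apply: mulr_ge0 => //; rewrite subr_ge0; apply: Ab.
have [i0 ti0] : exists i, t i != 0.
  apply: contrapT => nex; move/eqP: t1; rewrite big1 => [|i _].
    by rewrite eq_sym oner_eq0.
  by apply/eqP/negPn/negP => ti; apply: nex; exists i.
exists k, (fun i => if t i == 0 then p i0 else p i), t; split=> //.
  by move=> i; case: ifPn => ti; split=> //; apply: tight.
by rewrite Ex; apply: eq_bigr => i _; case: eqP => [->|//]; rewrite !scale0r.
Qed.

Lemma convex_hull_nonempty A x : convex_hull A x -> exists y, A y.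
Proof.
move=> [[|k] [p [t [pA _ t1 _]]]]; last by exists (p ord0).
by move/eqP: t1; rewrite big_ord0 eq_sym oner_eq0.
Qed.

(** The functional that singles out u is maximal on A, and only u attains this
maximum. *)
Lemma vertex_convex_hull P A u : (forall y, A y -> P y) ->
  vertices P u -> convex_hull A u -> A u.
Proof.
move=> AP [c [b [Pb Eu]]] hu.
have [Pu cu] : P u /\ dot c u = b by move/seteqP: Eu => [/(_ u erefl)].
have Ab y : A y -> dot c y <= b by move=> /AP /Pb.
have [y [Ay cy]] := convex_hull_nonempty (convex_hull_max Ab hu cu).
suff -> : u = y by [].
by move/seteqP: Eu => [_ /(_ y)] H; apply/esym/H; split=> //; apply: AP.
Qed.

Lemma vertices_sub P F u : (forall y, F y -> P y) -> F u ->
  vertices P u -> vertices F u.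
Proof.
move=> FP Fu [c [b [Pb Eu]]]; exists c, b; split; first by move=> x /FP /Pb.
apply/seteqP; split=> x.
  by move=> ->; split=> //; move/seteqP: Eu => [/(_ u erefl) []].
by move=> [Fx cx]; move/seteqP: Eu => [_ /(_ x)]; apply; split=> //; apply: FP.
Qed.

Lemma convex_hull_face A c b : (forall y, A y -> dot c y <= b) ->
  is_face (convex_hull A) (convex_hull [set y | A y /\ dot c y = b]).
Proof.
move=> Ab; exists c, b; split; first by move=> x; apply: convex_hull_le.
apply/seteqP; split=> x; last by case=> [hx cx]; apply: convex_hull_max.
move=> [k [p [t [pA t0 t1 Ex]]]]; split.
  by exists k, p, t; split=> // i; case: (pA i).
rewrite -/(dot c x) Ex dot_sum; last exact: mulrC.
rewrite -[b]mul1r -t1 mulr_suml; apply: eq_bigr => i _.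
by case: (pA i) => _ ->.
Qed.

End ConvexHulls.

Section EdgePolytope.
Local Open Scope classical_set_scope.
Variables (R : realType) (d : nat) (G : graph d).
Local Notation adj := (adjacent G).
Implicit Types (x y z t : 'I_d).
Local Notation P := (edge_polytope R G).

Definition edge_vectors : set 'rV[R]_d :=
  [set w | exists x y, adj x y /\ w = edge_vector R x y].

Lemma edge_polytopeE : P = convex_hull edge_vectors.
Proof. by []. Qed.

Lemma dot_edge_vector (S : nzRingType) (c : 'rV[S]_d) x y :
  dot c (edge_vector S x y) = c 0 x + c 0 y.
Proof.
have one z : \sum_i c 0 i * (delta_mx 0 z : 'rV[S]_d) 0 i = c 0 z.
  rewrite (bigD1 z) //= big1 => [|i iz]; last by rewrite mxE (negbTE iz) andbF mulr0.
  by rewrite mxE !eqxx mulr1 addr0.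
rewrite /dot; under eq_bigr do rewrite mxE mulrDr.
by rewrite big_split /= !one.
Qed.

Lemma map_edge_vector x y :
  map_mx intr (edge_vector int x y) = edge_vector R x y.
Proof. by apply/rowP => j; rewrite mxE !edge_vectorE natz pmulrn. Qed.

Lemma lattice_edge_vector x y : adj x y -> lattice_points P (edge_vector int x y).
Proof.
move=> exy; rewrite /lattice_points /= map_edge_vector.
by apply: sub_convex_hull; exists x, y.
Qed.

(** A generator of positive weight, say that of the edge xy, forces the coordinates of z
at x and y to be positive; as the coordinates are nonnegative and their sum is 2,
z is the vector of xy. *)
Lemma lattice_points_edge (z : 'rV[int]_d) : lattice_points P z ->
  exists x y, adj x y /\ z = edge_vector int x y.
Proof.
rewrite /lattice_points /= edge_polytopeE => hz.
have coord (c : 'rV[R]_d) : dot c (map_mx intr z) = \sum_j c 0 j * (z 0 j)%:~R.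
  by apply: eq_bigr => j _; rewrite mxE.
have delta (s : R) j : \sum_i (s *: delta_mx 0 j : 'rV[R]_d) 0 i * (z 0 i)%:~R = s * (z 0 j)%:~R.
  rewrite (bigD1 j) //= big1 => [|i ij]; last by rewrite !mxE (negbTE ij) andbF mulr0 mul0r.
  by rewrite !mxE !eqxx mulr1 addr0.
have z0 j : 0 <= z 0 j.
  have : dot (-1 *: delta_mx 0 j) (map_mx intr z : 'rV[R]_d) <= 0.
    apply: convex_hull_le hz => _ [x [y [_ ->]]]; rewrite dot_edge_vector !mxE.
    by rewrite -mulrDr mulN1r oppr_le0 addr_ge0 ?ler0n.
  by rewrite coord delta mulN1r oppr_le0 ler0z.
have z2 : \sum_j z 0 j = 2.
  have le (s : R) : dot (const_mx s) (map_mx intr z : 'rV[R]_d) <= s * 2.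
    apply: convex_hull_le hz => _ [x [y [_ ->]]]; rewrite dot_edge_vector !mxE.
    by rewrite mulrDr mulr1.
  have E s : dot (const_mx s) (map_mx intr z : 'rV[R]_d) = s * (\sum_j z 0 j)%:~R.
    by rewrite coord rmorph_sum /= mulr_sumr; apply: eq_bigr => j _; rewrite mxE.
  have := le 1; have := le (-1); rewrite !E !mul1r !mulN1r lerN2 => h1 h2.
  by apply/eqP; rewrite -(eqr_int R) eq_le h1 h2.
case: hz => k [p [s [pV s0 s1 Ez]]].
have [i si] : exists i, 0 < s i.
  apply: contrapT => nex; move/eqP: s1; rewrite big1 => [|i _].
    by rewrite eq_sym oner_eq0.
  apply/eqP/negPn/negP => si; apply: nex; exists i.
  by rewrite lt0r si s0.
have [x [y [exy Ep]]] := pV i.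
have pos j : 0 < p i 0 j -> 0 < z 0 j.
  move=> pj; rewrite -(ltr0z R); have -> : (z 0 j)%:~R = \sum_i s i * p i 0 j.
    have := congr1 (fun w : 'rV[R]_d => w 0 j) Ez; rewrite mxE => ->.
    by rewrite summxE; apply: eq_bigr => l _; rewrite mxE.
  rewrite (bigD1 i) //= ltr_pwDl ?mulr_gt0 //; apply: sumr_ge0 => l _.
  apply: mulr_ge0 => //; have [x' [y' [_ ->]]] := pV l.
  by rewrite edge_vectorE ler0n.
have zx : 0 < z 0 x by apply: pos; rewrite Ep edge_vectorE eqxx ltr0n addn_gt0.
have zy : 0 < z 0 y by apply: pos; rewrite Ep edge_vectorE eqxx ltr0n addn_gt0 orbT.
exists x, y; split=> //; have xy := adj_neq exy.
have rest : \sum_(j | (j != x) && (j != y)) z 0 j = 2 - z 0 x - z 0 y.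
  have := z2; rewrite (bigD1 x) //= (bigD1 y) /= 1?eq_sym // => <-.
  by move: (\sum_(_ | _) _) => S; ring.
have rest0 : 0 <= \sum_(j | (j != x) && (j != y)) z 0 j by apply: sumr_ge0.
have [zx1 zy1] : z 0 x = 1 /\ z 0 y = 1 by lia.
apply/rowP => j; rewrite edge_vectorE.
have [<-|xj] := eqVneq x j; first by rewrite zx1 eq_sym (negbTE xy).
have [<-|yj] := eqVneq y j; first by rewrite zy1.
have /eqP : \sum_(j | (j != x) && (j != y)) z 0 j = 0 by rewrite rest zx1 zy1.
rewrite psumr_eq0 // => /allP/(_ j (mem_index_enum _)).
by rewrite /= ![j == _]eq_sym xj yj => /eqP.
Qed.

End EdgePolytope.

(** * Farkas' lemma *)

Section Farkas.
Variables (F : realFieldType) (d : nat).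
Implicit Types (b c v : 'rV[F]_d) (L : seq 'rV[F]_d).

Lemma dotBr c x y : dot c (x - y) = dot c x - dot c y.
Proof. by rewrite /dot -sumrB; apply: eq_bigr => i _; rewrite !mxE mulrBr. Qed.

Lemma dotZr c s x : dot c (s *: x) = s * dot c x.
Proof. by rewrite /dot mulr_sumr; apply: eq_bigr => i _; rewrite mxE mulrCA. Qed.

Lemma dotBl c c' x : dot (c - c') x = dot c x - dot c' x.
Proof. by rewrite /dot -sumrB; apply: eq_bigr => i _; rewrite !mxE mulrBl. Qed.

Lemma dotZl c s x : dot (s *: c) x = s * dot c x.
Proof. by rewrite /dot mulr_sumr; apply: eq_bigr => i _; rewrite mxE mulrA. Qed.

Lemma dotNr c x : dot c (- x) = - dot c x.
Proof. by rewrite -sub0r dotBr /dot big1 ?sub0r // => i _; rewrite mxE mulr0. Qed.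

Lemma dot_suml (I : Type) (r : seq I) (A : pred I) (f : I -> 'rV[F]_d) x :
  dot (\sum_(i <- r | A i) f i) x = \sum_(i <- r | A i) dot (f i) x.
Proof.
rewrite /dot exchange_big; apply: eq_bigr => j _.
by rewrite summxE mulr_suml.
Qed.

(** The cone generated by L, with one coefficient for each generator in turn. *)
Fixpoint cone L b : Prop :=
  if L is v :: L' then exists2 s, 0 <= s & cone L' (b - s *: v) else b = 0.

(** A combination of the vectors u - f u *: v differs from the combination of the u with
the same coefficients by a multiple of v, whose coefficient has a sign because
all f u do. *)
Lemma cone_shift L (f : 'rV[F]_d -> F) v b : {in L, forall u, f u <= 0} ->
  cone [seq u - f u *: v | u <- L] b -> exists2 s, 0 <= s & cone L (b - s *: v).
Proof.
elim: L b => [|u L IHL] b fL /=; first by move=> ->; exists 0; rewrite // scale0r subr0.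
case=> s s0 /IHL[|r r0 bL]; first by move=> u' u'L; apply: fL; rewrite inE u'L orbT.
exists (r - s * f u).
  by rewrite subr_ge0 (le_trans _ r0) // mulr_ge0_le0 // fL // mem_head.
exists s => //; move: bL; congr (cone L _).
by apply/rowP => j; rewrite !mxE; ring.
Qed.

(** Induction on the number of generators.  A functional c that separates b from L but
is negative on v is used to project L and b along v to the kernel of c, where the
induction hypothesis applies again. *)
Lemma farkas L b :
  cone L b \/ exists2 c, {in L, forall v, 0 <= dot c v} & dot c b < 0.
Proof.
have [n] := ubnP (size L); elim: n L b => // n IHn [|v L] b /=.
  move=> _; have [->|b0] := eqVneq b 0; [by left|right].
  exists (- b) => //; rewrite /dot.
  have [j bj] : exists j, b 0 j != 0.
    apply: contrapT => nex; case/eqP: b0; apply/rowP => j; rewrite mxE.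
    by apply/eqP/negPn/negP => bj; apply: nex; exists j.
  rewrite (bigD1 j) //= -oppr_gt0 opprD ltr_pwDl //.
    by rewrite mxE mulNr opprK -expr2 exprn_even_gt0.
  rewrite -sumrN; apply: sumr_ge0 => i _.
  by rewrite mxE mulNr opprK -expr2 sqr_ge0.
rewrite ltnS => Ln; case: (IHn L b Ln) => [bL|[c cL cb]].
  by left; exists 0; rewrite // scale0r subr0.
have [cv|cv] := leP 0 (dot c v).
  by right; exists c => // u; rewrite inE => /orP[/eqP-> //|/cL].
pose f u := dot c u / dot c v.
have fL : {in L, forall u, f u <= 0}.
  by move=> u uL; rewrite /f mulr_ge0_le0 ?cL // invr_le0 (ltW cv).
case: (IHn [seq u - f u *: v | u <- L] (b - f b *: v)); first by rewrite size_map.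
  move/(cone_shift fL) => [s s0 bL]; left; exists (f b + s).
    by rewrite addr_ge0 // /f mulr_le0 // ?invr_le0 ltW.
  by move: bL; rewrite scalerDl opprD addrA.
case=> y yL yb; right; exists (y - (dot y v / dot c v) *: c) => [u|].
  rewrite inE => /orP[/eqP->|uL].
    by rewrite dotBl dotZl mulfVK ?subrr // lt_eqF.
  have := yL _ (map_f _ uL); rewrite dotBr dotZr dotBl dotZl /f.
  by rewrite mulrAC [dot c u * _]mulrC -[X in 0 <= _ - X]mulrAC.
move: yb; rewrite dotBr dotZr dotBl dotZl /f.
by rewrite mulrAC [dot c b * _]mulrC -[X in _ - X < 0]mulrAC.
Qed.

Lemma cone_family (I : eqType) (f : I -> 'rV[F]_d) (r : seq I) b :
    uniq r -> cone [seq f i | i <- r] b ->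
  exists2 t : I -> F, forall i, 0 <= t i & b = \sum_(i <- r) t i *: f i.
Proof.
elim: r b => [|i r IHr] b /=; first by move=> _ ->; exists (fun=> 0); rewrite ?big_nil.
case/andP=> ir ur [s s0 /(IHr _ ur)[t t0 E]].
exists (fun j => if j == i then s else t j) => [j|]; first by case: ifP.
rewrite big_cons eqxx -[LHS](subrK (s *: f i)) E addrC; congr (_ + _).
apply: eq_big_seq => j jr.
by case: eqP jr => // ->; rewrite (negbTE ir).
Qed.

(** Apply [farkas] to - v i for each i outside of W, with the generators v k and, for k
in W, - v k.  The functionals so obtained vanish on W; their negated sum is
negative at every point outside of W. *)
Lemma separate_or_relate n (v : 'I_n -> 'rV[F]_d) (W : {set 'I_n}) :
  (exists c, (forall i, i \in W -> dot c (v i) = 0) /\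
             (forall i, i \notin W -> dot c (v i) < 0)) \/
  (exists t s : 'I_n -> F, [/\ forall i, 0 <= t i, forall i, 0 <= s i,
     forall i, i \notin W -> s i = 0, exists2 i, i \notin W & 0 < t i &
     \sum_i t i *: v i = \sum_i s i *: v i]).
Proof.
pose r : seq ('I_n + 'I_n) := map inl (enum 'I_n) ++ map inr (enum W).
pose f (k : 'I_n + 'I_n) := match k with inl i => v i | inr i => - v i end.
have ur : uniq r.
  rewrite cat_uniq !map_inj_uniq; try by move=> ? ? [].
  apply/and3P; split; [by rewrite -enumT enum_uniq | | exact: enum_uniq].
  by apply/hasPn => _ /mapP[i _ ->]; apply/mapP => -[].
have [[i0 [i0W ci0]]|none] :=
  pselect (exists i0, i0 \notin W /\ cone [seq f k | k <- r] (- v i0)).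
  right; have [t t0 E] := cone_family ur ci0.
  (* Moving - v i0 to the other side adds 1 to its coefficient. *)
  exists (fun i => t (inl i) + (i == i0)%:R), (fun i => if i \in W then t (inr i) else 0).
  split=> [i|i|i iW||].
  - by rewrite addr_ge0 ?ler0n.
  - by case: ifP.
  - by rewrite (negbTE iW).
  - by exists i0; rewrite // eqxx ltr_wpDl ?ltr01.
  under eq_bigr do rewrite scalerDl.
  rewrite big_split /= [X in _ + X](bigD1 i0) //= eqxx scale1r.
  rewrite [X in _ + (_ + X)]big1 => [|i ii]; last by rewrite (negbTE ii) scale0r.
  rewrite addr0; move: E; rewrite big_cat !big_map /= !big_enum /=.
  under [X in _ = _ + X]eq_bigr do rewrite scalerN.
  rewrite sumrN => /eqP; rewrite eq_sym subr_eq => /eqP ->.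
  rewrite addrAC addNr add0r big_mkcond; apply: eq_bigr => i _; by case: ifP => _; rewrite ?scale0r.
left.
have sep i0 : exists c, i0 \notin W ->
    [/\ forall i, 0 <= dot c (v i), forall i, i \in W -> dot c (v i) = 0 & 0 < dot c (v i0)].
  have [i0W|i0W] := boolP (i0 \in W); first by exists 0.
  case: (farkas [seq f k | k <- r] (- v i0)) => [ci0|[c cr ci0]].
    by case: none; exists i0.
  exists c => _.
  have pos i : 0 <= dot c (v i).
    by apply: (cr (f (inl i))); apply: map_f; rewrite mem_cat map_f // mem_enum.
  split=> //; last by move: ci0; rewrite dotNr oppr_lt0.
  move=> i iW; apply/eqP; rewrite eq_le pos andbT -oppr_ge0 -dotNr.
  apply: (cr (f (inr i))); apply: map_f; rewrite mem_cat orbC map_f //.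
  by rewrite mem_enum.
have [c cP] := choice sep.
exists (- \sum_(i0 | i0 \notin W) c i0).
have E i : dot (- \sum_(i0 | i0 \notin W) c i0) (v i) =
           - \sum_(i0 | i0 \notin W) dot (c i0) (v i).
  by rewrite -scaleN1r dotZl mulN1r dot_suml.
split=> i iW; rewrite E.
  by rewrite big1 ?oppr0 // => i0 /cP[_ c0 _]; apply: c0.
rewrite oppr_lt0 (bigD1 i) //= ltr_pwDl //; first by have [] := cP i iW.
by apply: sumr_ge0 => i0 /andP[/cP[c0 _ _] _].
Qed.

End Farkas.

Lemma clear_denominators (I : finType) (q : I -> rat) : (forall i, 0 <= q i) ->
  exists2 N : nat, (0 < N)%N & exists k : I -> nat, forall i, q i * N%:R = (k i)%:R.
Proof.
move=> q0; exists (\prod_i `|denq (q i)|)%N.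
  by rewrite prodn_gt0 // => i; rewrite absz_gt0 denq_neq0.
exists (fun i => `|numq (q i)| * \prod_(j | j != i) `|denq (q j)|)%N => i.
rewrite (bigD1 i) //= !natrM mulrA; congr (_ * _).
rewrite !natr_absz !ger0_norm ?denq_ge0 ?numq_ge0 //.
by rewrite -{1}[q i]divq_num_den mulfVK // intr_eq0 denq_neq0.
Qed.

(** * The clique-face property *)

Section CliqueFaces.
Local Open Scope classical_set_scope.
Variables (R : realType) (K : fieldType) (d : nat) (G : graph d).
Variables (n : nat) (a : 'I_n -> 'rV[int]_d).
Hypothesis lab : edge_labelling G a.
Local Notation adj := (adjacent G).
Local Notation P := (edge_polytope R G).
Local Notation I := (toric_ideal K a).
Implicit Types (m : 'X_{1..n}) (i j k : 'I_n) (x y z t : 'I_d).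

Definition point i : 'rV[R]_d := map_mx intr (a i).

Lemma pointP i : exists x y, [/\ adj x y, a i = edge_vector int x y &
  point i = edge_vector R x y].
Proof.
have [_ /(_ i)[x [y [exy Ei]]] _] := lab; exists x, y; split=> //.
by rewrite /point Ei map_edge_vector.
Qed.

Lemma point_inj : injective point.
Proof.
have [inj _ _] := lab; move=> i j /rowP E; apply: inj; apply/rowP => k.
by move: (E k); rewrite !mxE => /intr_inj.
Qed.

Lemma edge_vectors_point w : @edge_vectors R d G w <-> exists i, w = point i.
Proof.
split=> [[x [y [exy ->]]]|[i ->]].
  have [_ _ /(_ x y exy)[i Ei]] := lab; exists i.
  by rewrite /point Ei map_edge_vector.
by have [x [y [exy _ ->]]] := pointP i; exists x, y.
Qed.

Lemma polytope_point i : P (point i).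
Proof. by apply/sub_convex_hull/edge_vectors_point; exists i. Qed.

Lemma vertex_point u : vertices P u -> exists i, u = point i.
Proof.
move=> vu; apply/edge_vectors_point; apply: (vertex_convex_hull _ vu).
  exact: sub_convex_hull.
by have [c [b [_ /seteqP[/(_ u erefl)[]]]]] := vu.
Qed.

Lemma face_of_weights (c : 'rV[R]_d) b : (forall i, dot c (point i) <= b) ->
  is_face P (convex_hull [set w | exists2 i, w = point i & dot c (point i) = b]).
Proof.
move=> cb.
have -> : [set w | exists2 i, w = point i & dot c (point i) = b] =
          [set w | @edge_vectors R d G w /\ dot c w = b].
  apply/seteqP; split=> w; first by move=> [i -> ci]; split=> //; apply/edge_vectors_point; exists i.
  by move=> [/edge_vectors_point[i ->] ci]; exists i.
by apply: convex_hull_face => w /edge_vectors_point[i ->].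
Qed.

(** The scalar product with the point of an edge is the number of common vertices, which
is 2 only for the edge itself. *)
Lemma point_vertex i : vertices P (point i).
Proof.
have [x [y [exy Ei Epi]]] := pointP i.
pose c := point i.
have cmax k : dot c (point k) <= 2 /\ (dot c (point k) = 2 -> k = i).
  have [x' [y' [exy' Ek Epk]]] := pointP k.
  have xy := adj_neq exy; have xy' := adj_neq exy'.
  rewrite /c Epi Epk dot_edge_vector !edge_vectorE -natrD ler_nat.
  have le : ((x == x') + (y == x') + ((x == y') + (y == y')) <= 2)%N /\
     ((x == x') + (y == x') + ((x == y') + (y == y')) = 2 -> [set x; y]%SET = [set x'; y']%SET)%N.
    have mem u : ((u == x') + (u == y'))%N = (u \in [set x'; y']%SET).
      rewrite in_set2; have [ux|//] := eqVneq u x'.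
      by rewrite ux (negbTE xy').
    rewrite addnACA !mem; case xin: (x \in _); case yin: (y \in _); split=> // _.
    apply/eqP; rewrite eqEcard !cards2 xy xy' andbT; apply/fintype.subsetP => u.
    by rewrite in_set2 => /orP[]/eqP->.
  case: le => le eq2; split=> // /eqP; rewrite eqr_nat => /eqP/eq2 E.
  have [inj _ _] := lab; apply: inj; rewrite Ei Ek.
  by apply: edge_vector_set.
have ci : dot c (point i) = 2.
  rewrite /c Epi dot_edge_vector !edge_vectorE !eqxx [y == x]eq_sym.
  by rewrite (negbTE (adj_neq exy)) -natrD.
have := @face_of_weights c 2 (fun k => (cmax k).1).
congr (is_face P _); apply/seteqP; split=> w.
  move=> h; apply: convex_hull1; move: h; congr (convex_hull _ w).
  by apply/seteqP; split=> [_ [k -> /(cmax k).2 ->]|_ ->] //; exists i.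
by move=> ->; apply: sub_convex_hull; exists i.
Qed.

Lemma vertices_face (c : 'rV[R]_d) b (F := [set w | P w /\ dot c w = b]) :
  (forall i, dot c (point i) <= b) ->
  is_face P F /\ vertices F = [set w | exists2 i, w = point i & dot c (point i) = b].
Proof.
move=> cb; have cV w : @edge_vectors R d G w -> dot c w <= b.
  by move=> /edge_vectors_point[i ->].
split; first by exists c, b; split=> // w; apply: convex_hull_le.
apply/seteqP; split=> w.
  move=> vw; have [c' [b' [_ /seteqP[/(_ w erefl)[[Pw cw] _] _]]]] := vw.
  have sub (w' : 'rV[R]_d) : @edge_vectors R d G w' /\ dot c w' = b -> F w'.
    by move=> [Vw cw']; split=> //; apply: sub_convex_hull.
  have [/edge_vectors_point[i Ew] cw'] :=
    vertex_convex_hull sub vw (convex_hull_max cV Pw cw).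
  by exists i; rewrite -?Ew.
move=> [i -> ci]; apply: (@vertices_sub _ _ P); last exact: point_vertex.
  by move=> y [].
by split=> //; apply: polytope_point.
Qed.

Lemma dot_multidegree (c : 'rV[R]_d) m :
  \sum_i (m i)%:R * dot c (point i) = \sum_j c 0 j * (multidegree a m j)%:R.
Proof.
under eq_bigr do rewrite mulr_sumr.
rewrite exchange_big; apply: eq_bigr => j _; rewrite mnmE natr_sum mulr_sumr.
apply: eq_bigr => i _; rewrite natrM mulrCA; congr (_ * (_ * _)).
by rewrite mxE -{1}(gez0_abs (labelling_ge0 lab i j)).
Qed.

Lemma mdeg2P m : mdeg m = 2%N -> exists i j, m = (U_(i) + U_(j))%MM.
Proof.
move=> m2; have [p [vp Ep]] := monomial_onto lab m.
have [sp _] := monomial_fibre lab vp; rewrite Ep m2 in sp.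
case: p vp Ep sp => [|[x y] [|[z t] [|? ?]]] //= /and3P[/= exy ezt _] <- _.
have [_ _ onto] := lab; have [i Ei] := onto x y exy; have [j Ej] := onto z t ezt.
exists i, j; rewrite (monomial_cat a [:: (x, y)] [:: (z, t)]).
by rewrite (monomial1 lab Ei) (monomial1 lab Ej).
Qed.

(** The sum of the values of c over the variables of a monomial depends only on the
fibre; it is the maximal one for m, hence for m'. *)
Lemma fibre_face (c : 'rV[R]_d) b m m' : fibre a m = fibre a m' ->
    (forall i, dot c (point i) <= b) ->
    (forall i, (0 < m i)%N -> dot c (point i) = b) ->
  forall i, (0 < m' i)%N -> dot c (point i) = b.
Proof.
move=> E cb cm i mi.
have dE : mdeg m = mdeg m' by case: E.
have mE : multidegree a m = multidegree a m' by move/eqP: E; rewrite xpair_eqE => /andP[_ /eqP].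
have : \sum_k (m' k)%:R * (b - dot c (point k)) == 0.
  under eq_bigr do rewrite mulrBr.
  rewrite sumrB dot_multidegree -mE -dot_multidegree -mulr_suml -natr_sum -mdegE -dE.
  rewrite mdegE natr_sum mulr_suml -sumrB big1 // => k _.
  have [->|mk] := posnP (m k); first by rewrite !mul0r subrr.
  by rewrite cm // subrr.
rewrite psumr_eq0 => [/allP/(_ i (mem_index_enum _))|k _].
  by rewrite /= mulf_eq0 pnatr_eq0 gtn_eqF //= subr_eq0 => /eqP.
by rewrite mulr_ge0 // subr_ge0.
Qed.

Lemma face_functional (F : set 'rV[R]_d) : is_face P F -> exists c b,
  (forall i, dot c (point i) <= b) /\ F = [set w | P w /\ dot c w = b].
Proof.
move=> [c [b [Pb ->]]]; exists c, b; split=> // i.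
exact: (Pb _ (polytope_point i)).
Qed.

(** A monomial of the fibre has its variables in the face spanned by the two points, and
the only vertices there are these two points. *)
Lemma face_pair_not_movable i j :
  is_face P (convex_hull [set point i; point j]) -> ~ movable a (U_(i) + U_(j))%MM.
Proof.
move=> /face_functional[c [b [cb EF]]] [m' m'ij E].
have m2 : mdeg m' = 2%N.
  by have := congr1 fst E; rewrite /= => ->; rewrite mdegD !mdeg1.
have [k [l Em']] := mdeg2P m2.
have cij h : h = i \/ h = j -> dot c (point h) = b.
  move=> hij; have : convex_hull [set point i; point j] (point h).
    by apply: sub_convex_hull; case: hij => ->; [left|right].
  by rewrite EF => -[].
have only h : (0 < m' h)%N -> h = i \/ h = j.
  move=> mh; have ch : dot c (point h) = b.
    apply: (fibre_face (esym E) cb) => // g; rewrite mnmDE !mnm1E addn_gt0 !lt0b.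
    by case/orP=> /eqP <-; apply: cij; [left|right].
  have hF : convex_hull [set point i; point j] (point h).
    by rewrite EF; split=> //; apply: polytope_point.
  have := vertex_convex_hull _ (point_vertex h) hF.
  case=> [y [] ->|/point_inj|/point_inj]; try exact: polytope_point.
    by left.
  by right.
have ki : k = i \/ k = j by apply: only; rewrite Em' mnmDE mnm1E eqxx.
have li : l = i \/ l = j by apply: only; rewrite Em' mnmDE !mnm1E eqxx addn_gt0 orbT.
have cancel g h : fibre a (U_(g) + U_(h))%MM = fibre a (U_(g) + U_(g))%MM -> h = g.
  move=> /eqP; rewrite fibre_add2l => /eqP E'; apply: point_inj.
  have mE : multidegree a U_(h)%MM = multidegree a U_(g)%MM.
    by move/eqP: E'; rewrite xpair_eqE => /andP[_ /eqP].
  apply/rowP => q; have := congr1 (fun w : 'X_{1..d} => w q) mE.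
  have one f : multidegree a U_(f)%MM q = `|a f 0%R q|%N.
    rewrite mnmE (bigD1 f) //= big1 ?mnm1E ?eqxx ?mul1n ?addn0 // => g' gf.
    by rewrite mnm1E eq_sym (negbTE gf) mul0n.
  rewrite !one !mxE => Eq; rewrite -(gez0_abs (labelling_ge0 lab h q)).
  by rewrite Eq gez0_abs // (labelling_ge0 lab).
rewrite Em' in E m'ij; case: ki E m'ij => ->; case: li => -> E /eqP; apply.
- by rewrite (cancel _ _ (esym E)).
- by [].
- by rewrite addmC.
- by rewrite (cancel j i) // addmC.
Qed.

(** Either a functional vanishes on W and is negative at the other points, and then it
cuts out the face; or there is a linear relation which, after clearing
denominators, gives a monomial m supported on W in the fibre of a monomial m' with
a variable outside of W. *)
Lemma quadratic_clique_face : is_quadratic I -> clique_face_property P.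
Proof.
move=> quad W [WP Wadj].
pose Wi := [set i | `[< W (point i) >]]%SET.
have WiP i : reflect (W (point i)) (i \in Wi) by rewrite inE; apply: asboolP.
have WE w : W w <-> exists2 i, w = point i & i \in Wi.
  split=> [Ww|[i -> /WiP//]]; have [i Ei] := vertex_point (WP w Ww).
  by exists i => //; apply/WiP; rewrite -Ei.
pose v i : 'rV[rat]_d := map_mx intr (a i).
case: (separate_or_relate v Wi) => [[c [c0 cneg]]|[t [s [t0 s0 sW [i0 i0W ti0] Ets]]]].
  pose cR : 'rV[R]_d := map_mx ratr c.
  have dotR i : dot cR (point i) = ratr (dot c (v i)).
    rewrite /dot rmorph_sum /=; apply: eq_bigr => j _.
    by rewrite rmorphM /= !mxE ratr_int.
  have cle i : dot cR (point i) <= 0.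
    rewrite dotR lerq0; have [iW|iW] := boolP (i \in Wi); first by rewrite c0.
    exact/ltW/cneg.
  have [faceF vF] := vertices_face cle.
  eexists; split; first exact: faceF.
  rewrite vF; apply/seteqP; split=> w.
    move=> [i -> ci]; apply/WE; exists i => //; apply: contraT => /cneg.
    by move: ci; rewrite dotR => /eqP; rewrite fmorph_eq0 => /eqP ->; rewrite ltxx.
  by move=> /WE[i -> /c0 ci]; exists i => //; rewrite dotR ci rmorph0.
exfalso.
(* One common denominator for both sides of the relation. *)
pose coef (k : 'I_n + 'I_n) := match k with inl i => t i | inr i => s i end.
have [|N N0 [q qE]] := @clear_denominators _ coef; first by case.
pose m : 'X_{1..n} := [multinom q (inr i) | i < n].
pose m' : 'X_{1..n} := [multinom q (inl i) | i < n].
have mE : multidegree a m = multidegree a m'.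
  apply/mnmP => j; apply/eqP; rewrite -(eqr_nat rat) !mnmE !natr_sum.
  have absE i : (`|a i 0%R j|%N)%:R = v i 0 j :> rat.
    by rewrite mxE -{2}(gez0_abs (labelling_ge0 lab i j)).
  have term (k : 'I_n + 'I_n) i : (q k * `|a i 0%R j|)%N%:R = N%:R * (coef k *: v i) 0 j.
    have -> : (coef k *: v i) 0 j = coef k * v i 0 j by rewrite [LHS]mxE.
    by rewrite natrM absE -qE mulrA [N%:R * _]mulrC.
  have := congr1 (fun w : 'rV[rat]_d => N%:R * w 0 j) Ets.
  rewrite !summxE !mulr_sumr => E; rewrite eq_sym; apply/eqP.
  under eq_bigr do rewrite mnmE (term (inl _)).
  by rewrite E; apply: eq_bigr => i _; rewrite mnmE (term (inr _)).
have degE r : (mdeg r).*2 = mdeg (multidegree a r).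
  have [p [vp <-]] := monomial_onto lab r; have [-> mp] := monomial_fibre lab vp.
  rewrite mdegE; under eq_bigr do rewrite mp.
  have -> : (size p).*2 = size (ends p).
    by elim: (p) => // u p' IHp; rewrite /= doubleS IHp.
  elim: (ends p) => [|x l IHl]; first by rewrite big1.
  rewrite /= big_split /= -IHl (bigD1 x) //= eqxx big1 ?addn0 // => y.
  by rewrite eq_sym => /negPf ->.
have FE : fibre a m = fibre a m'.
  by rewrite /fibre mE; congr (_, _); apply: double_inj; rewrite !degE mE.
have mm' : m' != m.
  apply/eqP => /mnmP/(_ i0); rewrite !mnmE => E.
  have := qE (inr i0); rewrite /= sW // mul0r -E -(qE (inl i0)) => /eqP.
  by rewrite eq_sym mulf_eq0 gt_eqF //= pnatr_eq0 gtn_eqF.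
have [p [p2 pm mp]] := quadratic_divisor (labelling_ge0 lab) quad (ex_intro2 _ _ m' mm' (esym FE)).
have supp i : (0 < p i)%N -> i \in Wi.
  move=> pi; apply: contraLR pi => iW; rewrite -leqNgt.
  have /mnm_lepP/(_ i) := pm; rewrite mnmE.
  have := qE (inr i); rewrite /= sW // mul0r => /esym/eqP; rewrite pnatr_eq0 => /eqP ->.
  by [].
have [i [j Ep]] := mdeg2P p2.
have iW : W (point i) by apply/WiP/supp; rewrite Ep mnmDE mnm1E eqxx.
have jW : W (point j) by apply/WiP/supp; rewrite Ep mnmDE !mnm1E eqxx addn_gt0 orbT.
move: mp; rewrite Ep; apply: face_pair_not_movable.
have [->|ij] := eqVneq i j.
  have -> : [set point j; point j] = [set point j] by apply/seteqP; split=> w; [case|left].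
  have -> : convex_hull [set point j] = [set point j].
    by apply/seteqP; split=> w; [apply: convex_hull1 | apply: sub_convex_hull].
  exact: point_vertex.
have [//|_ _ _ //] := Wadj _ _ iW jW.
by move/point_inj => E; rewrite E eqxx in ij.
Qed.

Lemma face_of_two_edges (c : 'I_d -> nat) b i j x y z t :
    a i = edge_vector int x y -> a j = edge_vector int z t ->
    (forall u w, adj u w -> (c u + c w <= b)%N /\
       (c u + c w = b -> [set u; w]%SET = [set x; y]%SET \/
                         [set u; w]%SET = [set z; t]%SET)%N) ->
    (c x + c y = b)%N -> (c z + c t = b)%N ->
  is_face P (convex_hull [set point i; point j]).
Proof.
move=> Ei Ej cb cxy czt; pose cR : 'rV[R]_d := \row_u (c u)%:R.
have cE k u w : a k = edge_vector int u w -> dot cR (point k) = (c u + c w)%:R.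
  by move=> Ek; rewrite /point Ek map_edge_vector dot_edge_vector !mxE natrD.
have cle k : dot cR (point k) <= b%:R.
  have [u [w [euw Ek _]]] := pointP k.
  by rewrite (cE _ _ _ Ek) ler_nat; have [] := cb u w euw.
have := face_of_weights cle; congr (is_face P (convex_hull _)).
have [inj _ _] := lab.
apply/seteqP; split=> [_ [k -> ck]|_ [->|->]]; last 2 first.
- by exists i; rewrite // (cE _ _ _ Ei) cxy.
- by exists j; rewrite // (cE _ _ _ Ej) czt.
have [u [w [euw Ek _]]] := pointP k; have [_ eqb] := cb u w euw.
move/eqP: ck; rewrite (cE _ _ _ Ek) eqr_nat => /eqP/eqb[] E; [left|right].
  by congr point; apply: inj; rewrite Ek Ei; apply: edge_vector_set.
by congr point; apply: inj; rewrite Ek Ej; apply: edge_vector_set.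
Qed.

(** Weight 2 at the common vertex, 1 at the other two vertices. *)
Lemma face_of_incident_edges i j x y t :
    a i = edge_vector int x y -> a j = edge_vector int x t ->
    adj x y -> adj x t -> y != t ->
  is_face P (convex_hull [set point i; point j]).
Proof.
move=> Ei Ej exy ext yt.
pose c u := if u == x then 2 else if (u == y) || (u == t) then 1%N else 0%N.
have xy := adj_neq exy; have xt := adj_neq ext.
apply: (@face_of_two_edges c 3 i j x y x t) => //; last 2 first.
- by rewrite /c eqxx [y == x]eq_sym (negbTE xy) eqxx.
- by rewrite /c eqxx [t == x]eq_sym (negbTE xt) eqxx orbT.
move=> u w euw; have uw := adj_neq euw; rewrite /c.
have [ux|ux] := eqVneq u x; have [wx|wx] := eqVneq w x.
- by rewrite ux wx eqxx in uw.
- have [->|wy] := eqVneq w y; first by rewrite ux /=; split=> // _; left.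
  have [->|wt] /= := eqVneq w t; first by rewrite ux /=; split=> // _; right.
  by [].
- have [->|wy] := eqVneq u y.
    by rewrite wx /=; split=> // _; left; rewrite finset.setUC.
  have [->|wt] /= := eqVneq u t; last by [].
  by rewrite wx /=; split=> // _; right; rewrite finset.setUC.
by do 2 case: (_ || _).
Qed.

(** Weights 3, 1 on xy and 2, 2 on zt: the only pairs of weight more than 4 are xz and
xt. *)
Lemma face_of_disjoint_edges i j x y z t :
    a i = edge_vector int x y -> a j = edge_vector int z t ->
    adj x y -> adj z t -> uniq [:: x; y; z; t] -> ~~ adj x z -> ~~ adj x t ->
  is_face P (convex_hull [set point i; point j]).
Proof.
move=> Ei Ej exy ezt; rewrite /= !inE !negb_or andbT.
case/and3P => /and3P[xy xz xt] /andP[yz yt] zt nxz nxt.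
pose c u := if u == x then 3 else if u == y then 1%N else
            if (u == z) || (u == t) then 2 else 0%N.
have [cx cy cz ct] : [/\ c x = 3, c y = 1, c z = 2 & c t = 2]%N.
  rewrite /c !eqxx [y == x]eq_sym [z == x]eq_sym [t == x]eq_sym.
  rewrite [z == y]eq_sym [t == y]eq_sym.
  by rewrite (negbTE xy) (negbTE xz) (negbTE xt) (negbTE yz) (negbTE yt) orbT.
have c0 u : u != x -> u != y -> u != z -> u != t -> c u = 0%N.
  by move=> ux uy uz ut; rewrite /c (negbTE ux) (negbTE uy) (negbTE uz) (negbTE ut).
apply: (@face_of_two_edges c 4 i j x y z t) => //; rewrite ?cx ?cy ?cz ?ct //.
have cval u : [\/ u = x, u = y, u = z | u = t] \/ c u = 0%N.
  have [->|ux] := eqVneq u x; first by left; constructor 1.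
  have [->|uy] := eqVneq u y; first by left; constructor 2.
  have [->|uz] := eqVneq u z; first by left; constructor 3.
  have [->|ut] := eqVneq u t; first by left; constructor 4.
  by right; apply: c0.
move=> u w euw; have uw := adj_neq euw.
have nzx : ~~ adj z x by rewrite adjC.
have ntx : ~~ adj t x by rewrite adjC.
have [[]Eu|cu] := cval u; have [[]Ew|cw] := cval w;
  rewrite ?Eu ?Ew in euw uw *; rewrite ?cu ?cw ?cx ?cy ?cz ?ct ?addn0 ?add0n.
all: first [ by rewrite eqxx in uw | by rewrite euw in nxz | by rewrite euw in nxt
  | by rewrite euw in nzx | by rewrite euw in ntx
  | by split=> // /eqP | by split=> // _; left | by split=> // _; right
  | by split=> // _; left; rewrite finset.setUC
  | by split=> // _; right; rewrite finset.setUC ].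
Qed.

(** If the edges xy and zt are disjoint, one of xz, yt and one of xt, yz is not an edge
of G.  These two pairs share a vertex, which is therefore not adjacent to the
edge that does not contain it. *)
Lemma face_of_not_movable i j : i != j -> ~ movable a (U_(i) + U_(j))%MM ->
  is_face P (convex_hull [set point i; point j]).
Proof.
move=> ij nm; have [x [y [exy Ei _]]] := pointP i; have [z [t [ezt Ej _]]] := pointP j.
have Ei' := Ei; rewrite edge_vectorC in Ei'; have Ej' := Ej; rewrite edge_vectorC in Ej'.
have eyx := exy; rewrite adjC in eyx; have etz := ezt; rewrite adjC in etz.
have [inj _ _] := lab.
have nij : edge_vector int x y != edge_vector int z t.
  by rewrite -Ei -Ej (inj_eq inj).
have [xz|xz] := eqVneq x z.
  subst z; apply: (face_of_incident_edges Ei Ej) => //.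
  by apply: contraNneq nij => ->.
have [xt|xt] := eqVneq x t.
  subst t; apply: (face_of_incident_edges Ei Ej') => //.
  by apply: contraNneq nij => ->; rewrite edge_vectorC.
have [yz|yz] := eqVneq y z.
  by subst z; apply: (face_of_incident_edges Ei' Ej).
have [yt|yt] := eqVneq y t.
  by subst t; apply: (face_of_incident_edges Ei' Ej').
have xy := adj_neq exy; have zt := adj_neq ezt.
have u4 : uniq [:: x; y; z; t].
  by rewrite /= !inE !negb_or xy xz xt yz yt zt.
have Eij : monomial a [:: (x, y); (z, t)] = (U_(i) + U_(j))%MM.
  by rewrite (monomial_cat a [:: (x, y)] [:: (z, t)]) (monomial1 lab Ei) (monomial1 lab Ej).
have mov x' y' z' t' : adj x' y' -> adj z' t' ->
    perm_eq [:: x; y; z; t] [:: x'; y'; z'; t'] ->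
    [set x'; y']%SET \notin [:: [set x; y]; [set z; t]]%SET -> False.
  move=> e1 e2 pe nin; apply: nm; rewrite -Eij.
  have v1 : edge_pairs adj [:: (x, y); (z, t)] by rewrite /edge_pairs /= exy ezt.
  have v2 : edge_pairs adj [:: (x', y'); (z', t')] by rewrite /edge_pairs /= e1 e2.
  exists (monomial a [:: (x', y'); (z', t')]).
    apply: contraNneq nin => /(monomial_edge_sets lab v2 v1)/perm_mem/(_ [set x'; y']%SET).
    by rewrite /= mem_head => <-.
  by apply/(fibre_ends lab v2 v1); rewrite perm_sym.
have n1 : ~ (adj x z /\ adj y t).
  case=> e1 e2; apply: (mov x z y t e1 e2).
    by rewrite perm_cons; apply: (permEl (perm_catCA [:: y] [:: z] [:: t])).
  rewrite !inE; apply/norP; split; apply/eqP => /eq_set2[] [E1 E2].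
  - by rewrite E2 eqxx in yz.
  - by rewrite E1 eqxx in xy.
  - by rewrite E1 eqxx in xz.
  - by rewrite E1 eqxx in xt.
have n2 : ~ (adj x t /\ adj y z).
  case=> e1 e2; apply: (mov x t y z e1 e2).
    by rewrite perm_cons; apply: (permEl (perm_catC [:: y; z] [:: t])).
  rewrite !inE; apply/norP; split; apply/eqP => /eq_set2[] [E1 E2].
  - by rewrite E2 eqxx in yt.
  - by rewrite E1 eqxx in xy.
  - by rewrite E1 eqxx in xz.
  - by rewrite E1 eqxx in xt.
have u4' : uniq [:: y; x; z; t].
  by rewrite (perm_uniq (permEl (perm_catCA [:: y] [:: x] [:: z; t]))).
have u4z : uniq [:: z; t; x; y] by rewrite -(rot_uniq 2).
have u4t : uniq [:: t; z; x; y].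
  by rewrite (perm_uniq (permEl (perm_catCA [:: t] [:: z] [:: x; y]))).
have sw : [set point i; point j] = [set point j; point i] by rewrite classical_sets.setUC.
have [xz'|xz'] := boolP (adj x z); last first.
  have [xt'|xt'] := boolP (adj x t); last exact: (face_of_disjoint_edges Ei Ej exy ezt u4).
  have yz' : ~~ adj y z by apply/negP => yz'; apply: n2.
  by rewrite sw; apply: (face_of_disjoint_edges Ej Ei ezt exy u4z); rewrite adjC.
have yt' : ~~ adj y t by apply/negP => yt'; apply: n1.
have [xt'|xt'] := boolP (adj x t); last first.
  by rewrite sw; apply: (face_of_disjoint_edges Ej' Ei etz exy u4t); rewrite adjC.
have yz' : ~~ adj y z by apply/negP => yz'; apply: n2.
exact: (face_of_disjoint_edges Ei' Ej eyx ezt u4').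
Qed.

(** With m' in the fibre of m, the monomial m - m' divides m and is movable to m' - m, so
it is m by minimality: m and m' have no common variable.  The face on the support
of m contains that of m' by [fibre_face], so m' has no variable at all. *)
Lemma clique_face_no_indispensable m : clique_face_property P ->
  (3 <= mdeg m)%N -> ~ indispensable I m.
Proof.
move=> cfp m3 /(indispensableP K (labelling_ge0 lab))[[m' mm' E] min].
have dE : mdeg m' = mdeg m by case: E.
have disj i : (0 < m i)%N -> (0 < m' i)%N -> False.
  have Em : ((m - m') + (m - (m - m')) = m)%MM.
    by rewrite addmC; apply: submK; apply: lem_subr.
  have Em' : ((m' - m) + (m - (m - m')) = m')%MM.
    by apply/mnmP => k; rewrite mnmDE !mnmBE; lia.
  have /mnmP/(_ i) : (m - m')%MM = m.
    apply: min; first exact: lem_subr.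
    exists (m' - m)%MM.
      by apply: contra mm' => /eqP Eq; rewrite -Em -[X in X == _]Em' Eq.
    apply/eqP; rewrite -(fibre_add2l _ (m - (m - m'))%MM) addmC Em'.
    by rewrite addmC Em E.
  by rewrite mnmBE; lia.
pose W := [set w | exists2 i, w = point i & (0 < m i)%N].
have clique : is_clique P W.
  split=> [_ [i -> _]|_ _ [i -> mi] [j -> mj] ij]; first exact: point_vertex.
  have ij' : i != j by apply: contra_notN ij => /eqP ->.
  split=> //; try exact: point_vertex.
  apply: face_of_not_movable => // mov.
  have ijm : (U_(i) + U_(j) <= m)%MM.
    apply/mnm_lepP => k; rewrite mnmDE !mnm1E.
    have [<-|_] := eqVneq i k; first by rewrite eq_sym (negbTE ij').
    by have [<-|//] := eqVneq j k.
  by move: m3; rewrite -(min _ ijm mov) mdegD !mdeg1.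
have [F [/face_functional[c [b [cb EF]]] vF]] := cfp W clique.
have [_ vF'] := vertices_face cb.
rewrite EF vF' in vF.
have cm i : (0 < m i)%N -> dot c (point i) = b.
  move=> mi; have : W (point i) by exists i.
  by rewrite -vF => -[j /point_inj ->].
have m'0 i : m' i = 0%N.
  apply/eqP; rewrite -leqn0 leqNgt; apply/negP => mi'.
  have ci := fibre_face (esym E) cb cm mi'.
  have : W (point i) by rewrite -vF; exists i.
  by move=> [j /point_inj <- mj]; apply: disj mi'.
move: m3; rewrite -dE mdegE big1 // => i _; exact: m'0.
Qed.

End CliqueFaces.

(** * The theorem *)

Lemma edge_labelling_of_lattice (R : realType) (d : nat) (G : graph d) (n : nat)
    (a : 'I_n -> 'rV[int]_d) : injective a ->
  range a = lattice_points (edge_polytope R G) -> edge_labelling G a.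
Proof.
move=> inj E; split=> // [i|x y exy].
  have /lattice_points_edge : lattice_points (edge_polytope R G) (a i).
    by rewrite -E; exists i.
  by [].
have : range a (edge_vector int x y) by rewrite E; apply: lattice_edge_vector.
by case=> i _ <-; exists i.
Qed.

Theorem theorem3p10 (R : realType) (K : fieldType) (d : nat) (G : graph d)
    (n : nat) (a : 'I_n -> 'rV[int]_d) (a_inj : injective a)
    (a_enum : range a = lattice_points (edge_polytope R G)) :
  [<-> condition_Q G;
       is_quadratic (toric_ideal K a);
       clique_face_property (edge_polytope R G);
       forall m : 'X_{1..n}, (3 <= mdeg m)%N -> ~ indispensable (toric_ideal K a) m].
Proof.
have lab := edge_labelling_of_lattice a_inj a_enum.
tfae.
- exact: condition_Q_quadratic.
- exact: quadratic_clique_face.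
- by move=> cfp m; apply: (clique_face_no_indispensable lab cfp).
move=> noind; apply: switchable_condition_Q.
apply: (movable_switchable lab) => m.
exact: (movable_descent (labelling_ge0 lab) noind).
Qed.
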